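(* Let $\lambda$ be a Cherednik diagram of degree $n$. The element $E_\lambda\in\mathcal H_n$ can be calculated as follows: (1) arrange the elementary factors $T_{j-i}+\langle x_j/x_i\rangle$, for $(i,j)\in\mathcal P$, of the product $\varphi_0$ according to the special order on $\mathcal P$; (2) for every row of $\Lambda$ of length $m=1,2,\ldots$ with $h=1,2,\ldots$ entries in the rows preceding and parallel to that row, replace by $E_m^{(h)}$ the product $E_m$ of the factors corresponding to all pairs $(i,j)$ where both $i$ and $j$ are in that row; (3) for every two distinct parallel rows of $\lambda$ of length $m=1,2,\ldots$ replace by the scalar factor $f_m=(-1)^m q^{m(m-1)/2}(q^m-1)$ the product of factors corresponding to all $(i,j)$ where $i$ and $j$ are respectively in the first and second of the two parallel rows; (4) for every remaining singular pair $\xi=(i,j)$, with $k=j-i-1$, replace the two adjacent factors corresponding to $\xi$ by a three-term factor: if $e(\xi)=-$, replace the factors corresponding to $\xi^-,\xi$ by $T_kT_{k+1}-q\,T_{k+1}-q$; if $e(\xi)=+$, replace the factors corresponding to $\xi,\xi^+$ by $T_{k+1}T_k-q\,T_{k+1}-q$; (5) evaluate the factors corresponding to all remaining non-singular pairs at the point $(x_1,\ldots,x_n)=(q^{c_1},\ldots,q^{c_n})$. That is, the resulting ordered product equals $E_\lambda$.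
   Context: **Hecke algebra.** $q$ is a formal parameter. $\mathcal H_n$ is the associative $\mathbb C(q)$-algebra with generators $T_1,\ldots,T_{n-1}$ and relations $T_kT_{k+1}T_k=T_{k+1}T_kT_{k+1}$ for $1\le k\le n-2$; $T_kT_l=T_lT_k$ for $|k-l|>1$; $(T_k-q)(T_k+1)=0$. $s_k=(k,k+1)\in\mathcal S_n$ and $w_0$ is the longest element of $\mathcal S_n$. **Cherednik diagrams.** A diagram $\lambda=(\lambda_1,\ldots,\lambda_r)$ with rows $\lambda_i=[a_i,b_i]$ (integers $a_i\le b_i$) is the set of boxes $\{(i,j)\in\mathbb Z^2\mid 1\le i\le r,\ a_i\le j\le b_i\}$; its degree is $n=\sum_i(b_i-a_i+1)$. It is a Cherednik diagram if for each $i=1,\ldots,r-1$ either $b_{i+1}\le b_i$, or $b_{i+1}=b_i+1$ and $a_{i+1}\le a_i+1$. The row filling $\Lambda$ is obtained by filling the boxes with $1,\ldots,n$, row by row from left to right and then from top (row $1$) to bottom (row $r$). The content of the box $(i,j)$ is $j-i$, and $c_k$ is the content of the box filled with $k$ in $\Lambda$. Rows $\lambda_i,\lambda_j$ are parallel if $a_i-i=a_j-j$ and $b_i-i=b_j-j$. **The element $E_\lambda$.** Put $\langle x\rangle=(1-q)/(1-x)$ and $\varphi_k(x_1,\ldots,x_n)=T_k+\langle x_{k+1}/x_k\rangle$. For $w\in\mathcal S_n$ and an $\mathcal H_n$-valued rational function $\psi$ put ${}^w\psi(x_1,\ldots,x_n)=\psi(x_{w(1)},\ldots,x_{w(n)})$.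 For a reduced decomposition $w_0=s_{k_1}\cdots s_{k_m}$ put $\varphi_0=\varphi_{k_1}({}^{s_{k_1}}\varphi_{k_2})\cdots({}^{s_{k_1}\cdots s_{k_{m-1}}}\varphi_{k_m})$, which is independent of the choice of the decomposition. $\delta_\lambda(x_1,\ldots,x_n)$ is the product of $1-x_l/x_k$ over all $k<l$ occurring in $\Lambda$ in the leftmost boxes of two parallel rows of $\lambda$ ($\delta_\lambda=1$ if there are none). $\mathcal F_\lambda\subset\mathbb C(q)^{\times n}$ is the affine subspace of points with $x_kq^{c_l}=q^{c_k}x_l$ whenever $k,l$ are in the same row of $\Lambda$. The restriction of $\delta_\lambda\varphi_0$ to $\mathcal F_\lambda$ is regular at $(q^{c_1},\ldots,q^{c_n})$, and $E_\lambda\in\mathcal H_n$ is its value there. **One-row elements.** $E_m\in\mathcal H_m$ denotes $E_\mu$ for a diagram $\mu$ consisting of a single row of length $m$; explicitly $E_m=\prod_{1\le i<j\le m}\bigl(T_{j-i}+\frac{1-q}{1-q^{j-i}}\bigr)$ with pairs ordered lexicographically, and $E_1=1$. It is regarded as an element of $\mathcal H_n$, $n\ge m$, via the natural embedding $\mathcal H_m\to\mathcal H_n$. For $h\ge0$ with $h+m\le n$, $\iota_h:\mathcal H_m\to\mathcal H_n$ is the embedding with $\iota_h(T_k)=T_{k+h}$, and $E_m^{(h)}=\iota_h(E_m)$. **Special order.** $\mathcal P=\{(i,j)\mid1\le i<j\le n\}$. On $\mathcal P$: $(i,j)<_1(k,l)$ iff $i<k$, or $i=k$ and $j<l$; $(i,j)<_2(k,l)$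 iff $j<l$, or $j=l$ and $i<k$. For $1\le k\le l\le r$ let $\mathcal P_{kl}$ be the set of $(i,j)\in\mathcal P$ with $i,j$ in rows $k,l$ of $\Lambda$ respectively. The special order on $\mathcal P$ restricts on $\mathcal P_{kl}$ to $<_1$ if $b_k-k=b_l-l$ and to $<_2$ otherwise, and the blocks are ordered by $\mathcal P_{11}<\mathcal P_{12}<\mathcal P_{22}<\ldots<\mathcal P_{1r}<\mathcal P_{2r}<\ldots<\mathcal P_{rr}$. With respect to this order, $\varphi_0$ is the ordered product over $(i,j)\in\mathcal P$ of the factors $T_{j-i}+\langle x_j/x_i\rangle$. **Singular pairs.** A pair $(i,j)\in\mathcal P$ is singular if $c_i=c_j$. For a singular pair $\xi=(i,j)$ put $\xi^+=(i+1,j)$ if $i,i+1$ are in the same row of $\Lambda$, and $\xi^-=(i,j-1)$ if $j-1,j$ are in the same row of $\Lambda$. For $\xi\in\mathcal P_{kl}$ put $e(\xi)=-$ if $b_k-k=b_l-l$ and $e(\xi)=+$ otherwise. For each singular pair $\xi\in\mathcal P_{kl}$ with rows $k,l$ not parallel, $\xi^{e(\xi)}$ is defined, lies in $\mathcal P_{kl}$, and is adjacent to $\xi$ in the special order ($\xi^-$ immediately precedes $\xi$, respectively $\xi^+$ immediately follows $\xi$). *)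

(* Defs.v *)
From HB Require Import structures.
From mathcomp Require Import all_boot all_order all_fingroup all_algebra.
From mathcomp Require Import complex.
From mathcomp Require Import boolp classical_sets reals.
From mathcomp Require Import mpoly.

Set Implicit Arguments.
Unset Strict Implicit.
Unset Printing Implicit Defensive.

Import Order.TTheory GRing.Theory Num.Theory.
Local Open Scope ring_scope.
Local Open Scope quotient_scope.

(* Index k of a generator T_k of H_n, or of a simple transposition s_k,
   1 <= k <= n - 1. *)
Definition sgen (n : nat) := {k : nat | (0 < k < n)%N}.

(* The Hecke algebra is the set of formal expressions in the generators and the
   scalars, modulo the smallest congruence that contains the axioms of
   associative unital F-algebras and the defining relations. *)

Section HeckeAlgebra.
Variables (F : fieldType) (q : F) (n : nat).

Inductive hterm : Type :=
| HScal of F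
| HGen of sgen n
| HAdd of hterm & hterm
| HMul of hterm & hterm.

Inductive hcong : hterm -> hterm -> Prop :=
| hc_refl x : hcong x x
| hc_sym x y : hcong x y -> hcong y x
| hc_trans x y z : hcong x y -> hcong y z -> hcong x z
| hc_add x x' y y' : hcong x x' -> hcong y y' -> hcong (HAdd x y) (HAdd x' y')
| hc_mul x x' y y' : hcong x x' -> hcong y y' -> hcong (HMul x y) (HMul x' y')
| hc_addA x y z : hcong (HAdd x (HAdd y z)) (HAdd (HAdd x y) z)
| hc_addC x y : hcong (HAdd x y) (HAdd y x)
| hc_add0 x : hcong (HAdd (HScal 0) x) x
| hc_mulA x y z : hcong (HMul x (HMul y z)) (HMul (HMul x y) z)
| hc_mul1 x : hcong (HMul (HScal 1) x) x
| hc_mul0 x : hcong (HMul (HScal 0) x) (HScal 0)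
| hc_mulDl x y z : hcong (HMul (HAdd x y) z) (HAdd (HMul x z) (HMul y z))
| hc_mulDr x y z : hcong (HMul x (HAdd y z)) (HAdd (HMul x y) (HMul x z))
| hc_scalD c d : hcong (HScal (c + d)) (HAdd (HScal c) (HScal d))
| hc_scalM c d : hcong (HScal (c * d)) (HMul (HScal c) (HScal d))
| hc_central c x : hcong (HMul (HScal c) x) (HMul x (HScal c))
| hc_braid (k l : sgen n) : val l = (val k).+1 ->
    hcong (HMul (HMul (HGen k) (HGen l)) (HGen k))
          (HMul (HMul (HGen l) (HGen k)) (HGen l))
| hc_comm (k l : sgen n) : ((val k).+1 < val l)%N ->
    hcong (HMul (HGen k) (HGen l)) (HMul (HGen l) (HGen k))
| hc_quad (k : sgen n) :
    hcong (HMul (HAdd (HGen k) (HScal (- q))) (HAdd (HGen k) (HScal 1)))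
          (HScal 0).

HB.instance Definition _ := gen_eqMixin hterm.
HB.instance Definition _ := gen_choiceMixin hterm.

Definition hcongb (x y : hterm) : bool := `[< hcong x y >].

Lemma hcongb_refl : reflexive hcongb.
Proof. by move=> x; apply/asboolP; exact: hc_refl. Qed.

Lemma hcongb_sym : ssrbool.symmetric hcongb.
Proof. by move=> x y; apply/asboolP/asboolP => /hc_sym. Qed.

Lemma hcongb_trans : transitive hcongb.
Proof.
by move=> y x z /asboolP xy /asboolP yz; apply/asboolP; exact: hc_trans xy yz.
Qed.

Canonical hcong_equiv :=
  EquivRel hcongb hcongb_refl hcongb_sym hcongb_trans.

Definition hecke : Type := {eq_quot hcong_equiv}.

HB.instance Definition _ := Choice.on hecke.

Definition hcls (x : hterm) : hecke := \pi_({eq_quot hcong_equiv}) x.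
Definition hrep (x : hecke) : hterm := generic_quotient.repr (x : {eq_quot hcong_equiv}).

Lemma hrepK x : hcls (hrep x) = x.
Proof. exact: reprK. Qed.

Lemma hclsP x y : hcls x = hcls y <-> hcong x y.
Proof.
split=> [/eqP|xy]; first by rewrite eqmodE => /asboolP.
by apply/eqP; rewrite eqmodE; apply/asboolP.
Qed.

Lemma hrep_cls x : hcong (hrep (hcls x)) x.
Proof. by apply/hclsP; rewrite hrepK. Qed.

Lemma hclsW (P : hecke -> Prop) : (forall x, P (hcls x)) -> forall x, P x.
Proof. by move=> Px x; rewrite -(hrepK x). Qed.

Definition hadd (x y : hecke) : hecke := hcls (HAdd (hrep x) (hrep y)).
Definition hmul (x y : hecke) : hecke := hcls (HMul (hrep x) (hrep y)).
Definition hscale (c : F) (x : hecke) : hecke := hmul (hcls (HScal c)) x.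
Definition hopp (x : hecke) : hecke := hscale (-1) x.

Lemma haddE x y : hadd (hcls x) (hcls y) = hcls (HAdd x y).
Proof. by apply/hclsP; apply: hc_add; exact: hrep_cls. Qed.

Lemma hmulE x y : hmul (hcls x) (hcls y) = hcls (HMul x y).
Proof. by apply/hclsP; apply: hc_mul; exact: hrep_cls. Qed.

Lemma haddA : associative hadd.
Proof.
elim/hclsW=> x; elim/hclsW=> y; elim/hclsW=> z; rewrite !haddE.
by apply/hclsP; exact: hc_addA.
Qed.

Lemma haddC : commutative hadd.
Proof.
by elim/hclsW=> x; elim/hclsW=> y; rewrite !haddE; apply/hclsP; exact: hc_addC.
Qed.

Lemma hadd0 : left_id (hcls (HScal 0)) hadd.
Proof. by elim/hclsW=> x; rewrite haddE; apply/hclsP; exact: hc_add0. Qed.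

Lemma hmulA : associative hmul.
Proof.
elim/hclsW=> x; elim/hclsW=> y; elim/hclsW=> z; rewrite !hmulE.
by apply/hclsP; exact: hc_mulA.
Qed.

Lemma hmul1 : left_id (hcls (HScal 1)) hmul.
Proof. by elim/hclsW=> x; rewrite hmulE; apply/hclsP; exact: hc_mul1. Qed.

Lemma hscalC c x : hmul (hcls (HScal c)) x = hmul x (hcls (HScal c)).
Proof.
by elim/hclsW: x => x; rewrite !hmulE; apply/hclsP; exact: hc_central.
Qed.

Lemma hmul1r : right_id (hcls (HScal 1)) hmul.
Proof. by move=> x; rewrite -hscalC hmul1. Qed.

Lemma hmulDl : left_distributive hmul hadd.
Proof.
elim/hclsW=> x; elim/hclsW=> y; elim/hclsW=> z; rewrite !(haddE, hmulE).
by apply/hclsP; exact: hc_mulDl.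
Qed.

Lemma hmulDr : right_distributive hmul hadd.
Proof.
elim/hclsW=> x; elim/hclsW=> y; elim/hclsW=> z; rewrite !(haddE, hmulE).
by apply/hclsP; exact: hc_mulDr.
Qed.

Lemma hclsD c d : hcls (HScal (c + d)) = hadd (hcls (HScal c)) (hcls (HScal d)).
Proof. by rewrite haddE; apply/hclsP; exact: hc_scalD. Qed.

Lemma hclsM c d : hcls (HScal (c * d)) = hmul (hcls (HScal c)) (hcls (HScal d)).
Proof. by rewrite hmulE; apply/hclsP; exact: hc_scalM. Qed.

Lemma haddN : left_inverse (hcls (HScal 0)) hopp hadd.
Proof.
move=> x; rewrite /hopp /hscale -{2}(hmul1 x) -hmulDl -hclsD addNr.
by elim/hclsW: x => x; rewrite hmulE; apply/hclsP; exact: hc_mul0.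
Qed.

(* The character T_k |-> q of H_n, which shows that H_n is not trivial. *)
Fixpoint hchar (x : hterm) : F :=
  match x with
  | HScal c => c
  | HGen _ => q
  | HAdd y z => hchar y + hchar z
  | HMul y z => hchar y * hchar z
  end.

Lemma hchar_cong x y : hcong x y -> hchar x = hchar y.
Proof.
elim=> {x y} //=.
- by move=> x y z _ -> _ ->.
- by move=> x x' y y' _ -> _ ->.
- by move=> x x' y y' _ -> _ ->.
- by move=> x y z; rewrite addrA.
- by move=> x y; rewrite addrC.
- by move=> x; rewrite add0r.
- by move=> x y z; rewrite mulrA.
- by move=> x; rewrite mul1r.
- by move=> x; rewrite mul0r.
- by move=> x y z; rewrite mulrDl.
- by move=> x y z; rewrite mulrDr.
- by move=> c x; rewrite mulrC.
- by rewrite subrr mul0r.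
Qed.

Lemma hone_neq0 : hcls (HScal 1) != hcls (HScal 0).
Proof.
by apply/eqP => /hclsP/hchar_cong /= /eqP; rewrite oner_eq0.
Qed.

HB.instance Definition _ :=
  GRing.isZmodule.Build hecke haddA haddC hadd0 haddN.
HB.instance Definition _ := GRing.Zmodule_isNzRing.Build hecke
  hmulA hmul1 hmul1r hmulDl hmulDr hone_neq0.

Lemma hscaleA c d x : hscale c (hscale d x) = hscale (c * d) x.
Proof. by rewrite /hscale hmulA hclsM. Qed.

Lemma hscale1 : left_id 1 hscale.
Proof. exact: hmul1. Qed.

Lemma hscaleDr : right_distributive hscale +%R.
Proof. by move=> c x y; exact: hmulDr. Qed.

Lemma hscaleDl x : {morph hscale^~ x : c d / c + d}.
Proof. by move=> c d; rewrite /hscale hclsD; exact: hmulDl. Qed.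

HB.instance Definition _ :=
  GRing.Zmodule_isLmodule.Build F hecke hscaleA hscale1 hscaleDr hscaleDl.

Lemma hscaleAl (c : F) (x y : hecke) : c *: (x * y) = (c *: x) * y.
Proof. exact: hmulA. Qed.

Lemma hscaleAr (c : F) (x y : hecke) : c *: (x * y) = x * (c *: y).
Proof.
have e : c *: (x * y) = hmul (hcls (HScal c)) (hmul x y) by [].
rewrite e hmulA (hscalC c x) -hmulA; by [].
Qed.

HB.instance Definition _ := GRing.Lmodule_isLalgebra.Build F hecke hscaleAl.
HB.instance Definition _ := GRing.Lalgebra_isAlgebra.Build F hecke hscaleAr.

(* T_k, extended by 0 to the indices k outside of 1, ..., n - 1. *)
Definition T (k : nat) : hecke :=
  if insub k is Some g then hcls (HGen g) else 0.

Lemma T_gen (g : sgen n) : T (val g) = hcls (HGen g).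
Proof. by rewrite /T valK. Qed.

Definition hecke_rel (A : algType F) (t : nat -> A) : Prop :=
  [/\ forall k, (0 < k)%N -> (k.+1 < n)%N ->
        t k * t k.+1 * t k = t k.+1 * t k * t k.+1,
      forall k l, (0 < k)%N -> (k.+1 < l < n)%N -> t k * t l = t l * t k
    & forall k, (0 < k < n)%N -> (t k - q%:A) * (t k + 1) = 0].

Lemma hcls_scal (c : F) : hcls (HScal c) = c%:A :> hecke.
Proof. by rewrite -[LHS]hmul1r. Qed.

Lemma hecke_relT : hecke_rel T.
Proof.
have TE k (Hk : (0 < k < n)%N) : T k = hcls (HGen (Sub k Hk)).
  by rewrite -T_gen.
split.
- move=> k k0 kn.
  have Hk : (0 < k < n)%N by rewrite k0 ltnW.
  have Hk1 : (0 < k.+1 < n)%N by [].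
  rewrite (TE _ Hk) (TE _ Hk1).
  change (hmul (hmul (hcls (HGen (Sub k Hk))) (hcls (HGen (Sub k.+1 Hk1))))
            (hcls (HGen (Sub k Hk))) =
          hmul (hmul (hcls (HGen (Sub k.+1 Hk1))) (hcls (HGen (Sub k Hk))))
            (hcls (HGen (Sub k.+1 Hk1)))).
  by rewrite !hmulE; apply/hclsP; exact: hc_braid.
- move=> k l k0 /andP[kl ln].
  have Hk : (0 < k < n)%N by rewrite k0 (ltn_trans _ ln) // ltnW.
  have Hl : (0 < l < n)%N by rewrite ln (leq_trans _ kl).
  rewrite (TE _ Hk) (TE _ Hl).
  change (hmul (hcls (HGen (Sub k Hk))) (hcls (HGen (Sub l Hl))) =
          hmul (hcls (HGen (Sub l Hl))) (hcls (HGen (Sub k Hk)))).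
  by rewrite !hmulE; apply/hclsP; exact: hc_comm.
- move=> k Hk; rewrite (TE _ Hk) -scaleNr -hcls_scal.
  change (hmul (hadd (hcls (HGen (Sub k Hk))) (hcls (HScal (- q))))
            (hadd (hcls (HGen (Sub k Hk))) (hcls (HScal 1))) =
          hcls (HScal 0)).
  by rewrite !haddE hmulE; apply/hclsP; exact: hc_quad.
Qed.

(* The algebra homomorphism H_n -> A with T_k |-> t k, for t that satisfies
   the relations; see hecke_lift_morph. *)
Fixpoint heval (A : algType F) (t : nat -> A) (x : hterm) : A :=
  match x with
  | HScal c => c%:A
  | HGen g => t (val g)
  | HAdd y z => heval t y + heval t z
  | HMul y z => heval t y * heval t z
  end.

Definition hecke_lift (A : algType F) (t : nat -> A) (x : hecke) : A :=
  heval t (hrep x).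

Lemma heval_cong (A : algType F) (t : nat -> A) :
  hecke_rel t -> forall x y, hcong x y -> heval t x = heval t y.
Proof.
case=> tb tc tq x y; elim=> {x y} //=.
- by move=> x y z _ -> _ ->.
- by move=> x x' y y' _ -> _ ->.
- by move=> x x' y y' _ -> _ ->.
- by move=> x y z; rewrite addrA.
- by move=> x y; rewrite addrC.
- by move=> x; rewrite scale0r add0r.
- by move=> x y z; rewrite mulrA.
- by move=> x; rewrite scale1r mul1r.
- by move=> x; rewrite scale0r mul0r.
- by move=> x y z; rewrite mulrDl.
- by move=> x y z; rewrite mulrDr.
- by move=> c d; rewrite scalerDl.
- by move=> c d; rewrite -scalerAl mul1r scalerA.
- by move=> c x; rewrite -scalerAl mul1r -scalerAr mulr1.
- move=> [k Hk] [l Hl] /= e; subst l.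
  by case/andP: Hk => k0 _; case/andP: Hl => _ ln; exact: tb.
- move=> [k Hk] [l Hl] /= kl.
  by case/andP: Hk => k0 _; case/andP: Hl => _ ln; apply: tc; rewrite ?kl.
- by move=> [k Hk] /=; rewrite scaleNr scale1r scale0r; exact: tq.
Qed.

Lemma hecke_lift_morph (A : algType F) (t : nat -> A) : hecke_rel t ->
  [/\ {morph hecke_lift t : x y / x + y},
      {morph hecke_lift t : x y / x * y},
      hecke_lift t 1 = 1,
      forall (c : F) x, hecke_lift t (c *: x) = c *: hecke_lift t x
    & forall k, (0 < k < n)%N -> hecke_lift t (T k) = t k].
Proof.
move=> ht.
have liftE x : hecke_lift t (hcls x) = heval t x.
  by apply: heval_cong ht _ _ _; exact: hrep_cls.
have liftM : {morph hecke_lift t : x y / x * y} by move=> x y; exact: liftE.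
have lift_scal (c : F) : hecke_lift t c%:A = c%:A.
  by rewrite -hcls_scal liftE.
split=> //.
- by move=> x y; exact: liftE.
- by have := lift_scal 1; rewrite !scale1r.
- by move=> c x; rewrite -mulr_algl liftM lift_scal mulr_algl.
- by move=> k Hk; rewrite /T insubT liftE.
Qed.

End HeckeAlgebra.

(* iota_h : H_m -> H_n, T_k |-> T_(k + h); an algebra homomorphism when
   h + m <= n. *)
Definition iota_hecke (F : fieldType) (q : F) (m n h : nat) :
    hecke q m -> hecke q n :=
  hecke_lift (fun k => T q n (k + h)%N).

Lemma iota_hecke_rel (F : fieldType) (q : F) (m n h : nat) :
  (h + m <= n)%N -> hecke_rel q m (fun k => T q n (k + h)%N).
Proof.
move=> hmn; have [tb tc tq] := hecke_relT q n.
have shift k : (k < m)%N -> (k + h < n)%N.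
  by move=> km; apply: leq_trans hmn; rewrite addnC ltn_add2l.
split.
- by move=> k k0 km; rewrite addSn; apply: tb; rewrite ?addn_gt0 ?k0 //;
    rewrite -addSn; exact: shift.
- move=> k l k0 /andP[kl lm]; apply: tc; first by rewrite addn_gt0 k0.
  by rewrite -addSn ltn_add2r kl shift.
- by move=> k /andP[k0 km]; apply: tq; rewrite addn_gt0 k0 shift.
Qed.

(* Rows and entries of the row filling are numbered from 1. *)

Section Diagrams.

(* The row [a, b] is the pair (a, b). *)
Definition diagram := seq (int * int).

Implicit Types (lam : diagram) (i j k l : nat) (xi : nat * nat).

Definition row_a lam i : int := (nth (0, 0) lam i.-1).1.
Definition row_b lam i : int := (nth (0, 0) lam i.-1).2.

Definition row_len lam i : nat := absz (row_b lam i - row_a lam i + 1).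

Definition is_diagram lam : Prop :=
  forall i, (0 < i <= size lam)%N -> row_a lam i <= row_b lam i.

Definition degree lam : nat := \sum_(1 <= i < (size lam).+1) row_len lam i.

Definition cherednik lam : Prop :=
  is_diagram lam /\
  forall i, (0 < i < size lam)%N ->
    row_b lam i.+1 <= row_b lam i \/
    (row_b lam i.+1 = row_b lam i + 1 /\ row_a lam i.+1 <= row_a lam i + 1).

(* The boxes (i, j) in the order of the row filling. *)
Definition boxes lam : seq (nat * int) :=
  flatten [seq [seq (i, row_a lam i + t%:Z) | t <- iota 0 (row_len lam i)]
          | i <- iota 1 (size lam)].

Definition box lam k : nat * int := nth (0%N, 0) (boxes lam) k.-1.
Definition row_of lam k : nat := (box lam k).1.
Definition content lam k : int := (box lam k).2 - (box lam k).1%:Z.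

Definition parallel lam i j : bool :=
  (row_a lam i - i%:Z == row_a lam j - j%:Z) &&
  (row_b lam i - i%:Z == row_b lam j - j%:Z).

Definition leftmost lam k : bool := (box lam k).2 == row_a lam (row_of lam k).

Definition pairs (n : nat) : seq (nat * nat) :=
  [seq xi <- [seq (i, j) | i <- iota 1 n, j <- iota 1 n] | (xi.1 < xi.2)%N].

Definition in_block lam k l xi : bool :=
  (row_of lam xi.1 == k) && (row_of lam xi.2 == l).

Definition le1 (xi zeta : nat * nat) : bool :=
  (xi.1 < zeta.1)%N || (xi.1 == zeta.1) && (xi.2 <= zeta.2)%N.
Definition le2 (xi zeta : nat * nat) : bool :=
  (xi.2 < zeta.2)%N || (xi.2 == zeta.2) && (xi.1 <= zeta.1)%N.

(* b_k - k = b_l - l: the order on P_kl is <_1, and e = - on P_kl. *)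
Definition same_end lam k l : bool :=
  row_b lam k - k%:Z == row_b lam l - l%:Z.

Definition special_le lam (xi zeta : nat * nat) : bool :=
  let k := row_of lam xi.1 in let l := row_of lam xi.2 in
  let k' := row_of lam zeta.1 in let l' := row_of lam zeta.2 in
  if (k == k') && (l == l')
  then (if same_end lam k l then le1 xi zeta else le2 xi zeta)
  else (l < l')%N || (l == l') && (k < k')%N.

Definition special_seq (n : nat) lam : seq (nat * nat) :=
  sort (special_le lam) (pairs n).

Definition singular lam xi : bool := content lam xi.1 == content lam xi.2.

(* e(xi) = - *)
Definition e_minus lam xi : bool :=
  same_end lam (row_of lam xi.1) (row_of lam xi.2).

Definition xi_plus lam xi : option (nat * nat) :=
  if row_of lam xi.1 == row_of lam xi.1.+1 then Some (xi.1.+1, xi.2) else None.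
Definition xi_minus lam xi : option (nat * nat) :=
  if row_of lam xi.2.-1 == row_of lam xi.2 then Some (xi.1, xi.2.-1) else None.
Definition xi_e lam xi : option (nat * nat) :=
  if e_minus lam xi then xi_minus lam xi else xi_plus lam xi.

(* Every row is parallel to itself, but pairs in one row are never singular. *)
Definition remaining_singular lam xi : bool :=
  singular lam xi && ~~ parallel lam (row_of lam xi.1) (row_of lam xi.2).

End Diagrams.

Section Elambda.
Variables (F : fieldType) (q : F).

Definition bracket (x : F) : F := (1 - q) / (1 - x).

Section FixedDegree.
Variable n : nat.
Implicit Types (x : n.-tuple F) (lam : diagram).

Lemma sgen_lt (g : sgen n) : ((val g).-1 < n)%N /\ (val g < n)%N.
Proof.
by case: g => k /= /andP[k0 kn]; split=> //; apply: leq_ltn_trans kn; exact: leq_pred.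
Qed.

(* The elements k and k + 1 of {1, ..., n}, as elements of 'I_n. *)
Definition sgen_l (g : sgen n) : 'I_n := Ordinal (proj1 (sgen_lt g)).
Definition sgen_r (g : sgen n) : 'I_n := Ordinal (proj2 (sgen_lt g)).

Definition simple (g : sgen n) : 'S_n := tperm (sgen_l g) (sgen_r g).

Definition w0 : 'S_n := perm (@rev_ord_inj n).

(* Products in 'S_n are composed from left to right, whence rev. *)
Definition is_word (w : 'S_n) (ks : seq (sgen n)) : Prop :=
  (\prod_(g <- rev ks) simple g)%g = w.

Definition reduced_word (w : 'S_n) (ks : seq (sgen n)) : Prop :=
  is_word w ks /\ forall ks', is_word w ks' -> (size ks <= size ks')%N.

Definition perm_point (w : 'S_n) x : n.-tuple F := [tuple tnth x (w i) | i < n].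

Definition phi (g : sgen n) x : hecke q n :=
  T q n (val g) + (bracket (tnth x (sgen_r g) / tnth x (sgen_l g)))%:A.

(* phi_{k_1} (^{s_{k_1}} phi_{k_2}) ... (^{s_{k_1} ... s_{k_{m-1}}} phi_{k_m}) *)
Fixpoint phi_word (ks : seq (sgen n)) x : hecke q n :=
  if ks is g :: ks' then phi g x * phi_word ks' (perm_point (simple g) x)
  else 1.

Definition pcoord x (k : nat) : F := x`_k.-1.

Definition delta lam x : F :=
  \prod_(xi <- pairs n | [&& leftmost lam xi.1, leftmost lam xi.2
                           & parallel lam (row_of lam xi.1) (row_of lam xi.2)])
    (1 - pcoord x xi.2 / pcoord x xi.1).

Definition F_lambda lam x : Prop :=
  forall k l, (0 < k <= n)%N -> (0 < l <= n)%N -> row_of lam k = row_of lam l ->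
    pcoord x k * q ^ content lam l = q ^ content lam k * pcoord x l.

Definition content_point lam : n.-tuple F :=
  [tuple q ^ content lam i.+1 | i < n].

(* Points at which no denominator of phi_0 or delta vanishes. They form a dense
   open subset of F_lambda if F is infinite and q is nonzero and not a root of
   unity. *)
Definition generic x : Prop := uniq x /\ 0 \notin x.

(* The rational function on D represented by psi is regular at pt with value E:
   it is a quotient P / d of an H_n-valued polynomial P = sum_i p_i h_i by a
   scalar polynomial d with d(pt) <> 0, and E = P(pt) / d(pt). *)
Definition regular_value (D : n.-tuple F -> Prop) (psi : n.-tuple F -> hecke q n)
    (pt : n.-tuple F) (E : hecke q n) : Prop :=
  exists (d : {mpoly F[n]}) (N : nat) (p : 'I_N -> {mpoly F[n]})
         (h : 'I_N -> hecke q n),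
  let P x := \sum_(i < N) (p i).@[tnth x] *: h i in
  [/\ d.@[tnth pt] != 0,
      forall x, D x -> d.@[tnth x] *: psi x = P x
    & E = (d.@[tnth pt])^-1 *: P pt].

Definition is_E_lambda lam (E : hecke q n) : Prop :=
  forall ks, reduced_word w0 ks ->
    regular_value (fun x => F_lambda lam x /\ generic x)
      (fun x => delta lam x *: phi_word ks x) (content_point lam) E.

End FixedDegree.

(* Meaningful for lam of degree n. *)
Definition E_lambda (n : nat) (lam : diagram) : hecke q n :=
  xget 0 (@is_E_lambda n lam).

(* E_m^(h) in H_n. *)
Definition E_row (n m h : nat) : hecke q n :=
  iota_hecke n h (E_lambda m [:: (0, m%:Z - 1)]).

Variables (n : nat) (lam : diagram).

Definition f_scal (m : nat) : F :=
  (-1) ^+ m * q ^+ (m * m.-1)./2 * (q ^+ m - 1).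

Definition entries_before (l : nat) : nat :=
  \sum_(1 <= i < l | parallel lam i l) row_len lam i.

Definition three_term (xi : nat * nat) : hecke q n :=
  let k := (xi.2 - xi.1 - 1)%N in
  if e_minus lam xi
  then T q n k * T q n k.+1 - q *: T q n k.+1 - q%:A
  else T q n k.+1 * T q n k - q *: T q n k.+1 - q%:A.

Definition evaluated_factor (xi : nat * nat) : hecke q n :=
  T q n (xi.2 - xi.1)%N +
  (bracket (q ^ content lam xi.2 / q ^ content lam xi.1))%:A.

Definition absorbed (zeta : nat * nat) : bool :=
  has (fun xi => remaining_singular lam xi && (xi_e lam xi == Some zeta))
    (pairs n).

(* The two adjacent factors of xi and xi^{e(xi)} are replaced
   by the three-term factor at xi and by 1 at xi^{e(xi)}. *)
Definition pair_factor (xi : nat * nat) : hecke q n :=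
  if remaining_singular lam xi then three_term xi
  else if absorbed xi then 1
  else evaluated_factor xi.

(* The value substituted for the product of the factors of P_kl. If no row
   parallel to row l precedes it, then the factors of P_ll are only evaluated,
   which gives E_m^(0). *)
Definition block_factor (k l : nat) : hecke q n :=
  if (k == l) && (0 < entries_before l)%N then
    E_row n (row_len lam l) (entries_before l)
  else if (k != l) && parallel lam k l then (f_scal (row_len lam k))%:A
  else \prod_(xi <- special_seq n lam | in_block lam k l xi) pair_factor xi.

(* The blocks come in the order P_11, P_12, P_22, ..., P_1r, ..., P_rr. *)
Definition modified_product : hecke q n :=
  \prod_(1 <= l < (size lam).+1) \prod_(1 <= k < l.+1) block_factor k l.

End Elambda.

(* R[i] is the field of complex numbers. *)
Definition Cq (R : realType) : fieldType := {fraction {poly R[i]}}.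
Definition q_Cq (R : realType) : Cq R := tofrac ('X : {poly R[i]}).

(* Main.v *)
Require Import Defs.
From mathcomp Require Import all_boot all_order all_fingroup all_algebra.
From mathcomp Require Import complex boolp classical_sets reals mpoly.
From mathcomp Require Import ring zify.

Set Implicit Arguments.
Unset Strict Implicit.
Unset Printing Implicit Defensive.

Import Order.TTheory GRing.Theory Num.Theory.
Local Open Scope ring_scope.

(** The factor of the pair (i, j) involves only T_(j - i).  Hence the factors of
    two pairs commute unless the pairs are comparable componentwise, and phi_0
    has the same value for every order on the pairs that extends this partial
    order.  In particular phi_0 is a product over the columns, [staircase], and
    it splits into the blocks P_kl, each with its rows or its columns in the
    outer place ([exchange_prod], [staircase_split]).  That phi_0 does not depend
    on the reduced decomposition of w_0 is [sorting_unique].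

    The poles cancel because of the neighbours in a row.  On F_lambda they have
    the ratio q, so their factor is T_1 + 1, which is an eigenvector of T_1 for
    q.  By the Yang--Baxter relation an element that is divisible by T_p + 1 is
    divisible by T_(p + 1) + 1 after both neighbours have crossed a third label.
    Therefore the crossings of rows with row l that are still to be made are
    divisible on the left ([crossings_div]), due to the neighbours in row l, and
    the product already made is divisible on the right ([staircase_div],
    [cols_div]), due to the neighbours in the crossed row.  In the product of the
    two adjacent factors of a singular pair the pole is a multiple of T_p - q,
    which this divisibility annihilates; what remains has a value at the content
    point, the three-term factor ([mergel], [merger]).  The divisibility is used
    on the right of a block for e = -, on its left for e = +.  So, at generic
    points of F_lambda, delta_lambda phi_0 is equal to a product of factors without
    poles ([staircase_regular_total]), and since a rational function on F_lambda
    has at most one value at the content point ([value_unique]), E_lambda is the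
    product of the values of these factors ([E_lambda_value]).

    These are the factors of the theorem except for parallel rows.  The rows
    parallel to row l are consecutive and end just above row l.  The product L of
    everything before their blocks is divisible on the right by T_d + 1 for all
    neighbours in these rows, that is, L T_d = q L.  With this rule the factors of
    the first block to the left of and at the singular pairs become scalars, and
    the remaining ones are those of E_m^(h), with the right h
    ([parallel_block_value]).  In the other blocks, and in the last E_m, the rule
    also turns the symmetrizer into a scalar ([symmetrizer_absorb]), and the two
    scalars of each block multiply to f_m ([f_scalE]). *)

(** * Ordered products in a noncommutative ring *)

Lemma prod_nat_split (A : pzRingType) (U V : nat -> A) m n :
    (forall i i', (i < i')%N -> GRing.comm (V i) (U i')) ->
  \prod_(m <= i < n) (U i * V i) =
  (\prod_(m <= i < n) U i) * \prod_(m <= i < n) V i.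
Proof.
move=> UV; have [nm|mn] := leqP n m; first by rewrite !big_geq // mulr1.
rewrite -(subnKC (ltnW mn)); elim: (n - m)%N => [|d IH].
  by rewrite addn0 !big_geq // mulr1.
rewrite addnS !big_nat_recr ?leq_addr //= IH -!mulrA; congr (_ * _).
rewrite !mulrA; congr (_ * _); apply/esym.
rewrite !big_seq; apply: commr_prod => i; rewrite mem_index_iota => /andP[_ id].
exact/commr_sym/UV.
Qed.

(** Passing from one order to the other moves [F i' j] past [F i j'] only when
    [i < i'] and [j < j'].  For the factors of phi_0 these are the incomparable
    pairs of labels, whose generators have indices that differ by at least 2. *)
Lemma exchange_prod (A : pzRingType) (F : nat -> nat -> A) m1 n1 m2 n2 :
    (forall i i' j j', (i < i')%N -> (j < j')%N ->
       GRing.comm (F i j') (F i' j)) ->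
  \prod_(m1 <= j < n1) \prod_(m2 <= i < n2) F i j =
  \prod_(m2 <= i < n2) \prod_(m1 <= j < n1) F i j.
Proof.
move=> FC; have [nm|mn] := leqP n1 m1.
  by rewrite big_geq // big1 // => i _; rewrite big_geq.
rewrite -(subnKC (ltnW mn)); elim: (n1 - m1)%N => [|d IH].
  by rewrite addn0 big_geq // big1 // => i _; rewrite big_geq.
rewrite addnS big_nat_recr ?leq_addr //= IH -prod_nat_split.
  by apply: eq_bigr => i _; rewrite big_nat_recr ?leq_addr.
move=> i i' ii'; rewrite big_seq; apply: commr_prod => j.
by rewrite mem_index_iota => /andP[_ jd]; apply: FC.
Qed.

Lemma big_nat_cut (A : pzRingType) (F : nat -> A) m k n :
    (m <= k < n)%N ->
  \prod_(m <= i < n) F i =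
  (\prod_(m <= i < k) F i) * F k * \prod_(k.+1 <= i < n) F i.
Proof.
case/andP=> mk kn; rewrite (big_cat_nat mk (ltnW kn)) /= -mulrA.
by rewrite (big_ltn kn).
Qed.

Lemma commr_prod_nat (A : pzRingType) (x : A) (F : nat -> A) m n :
    (forall i, (m <= i < n)%N -> GRing.comm x (F i)) ->
  GRing.comm x (\prod_(m <= i < n) F i).
Proof.
move=> xF; rewrite big_seq; apply: commr_prod => i.
by rewrite mem_index_iota; exact: xF.
Qed.

Section Algebra.
Variables (F : fieldType) (A : algType F).
Implicit Types (a b x : A) (c : F).

Lemma comm_alg x c : GRing.comm x c%:A.
Proof. by rewrite /GRing.comm mulr_algl mulr_algr. Qed.

Lemma comm_scale x y c : GRing.comm x y -> GRing.comm x (c *: y).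
Proof. by move=> xy; rewrite /GRing.comm -scalerAr -scalerAl xy. Qed.

Lemma comm_addalg x y c : GRing.comm x y -> GRing.comm x (y + c%:A).
Proof. by move=> xy; apply: commrD => //; exact: comm_alg. Qed.

End Algebra.

Lemma ratio_neq1 (F : fieldType) (x y : F) : x != 0 -> x != y -> 1 - y / x != 0.
Proof.
move=> x0; rewrite subr_eq0; apply: contra => /eqP e.
by rewrite -[y](divfK x0) -e mul1r.
Qed.

(** * The Yang--Baxter relation and the factors T_p - q *)

Lemma T_out (F : fieldType) (q : F) n k : ~~ (0 < k < n)%N -> T q n k = 0.
Proof. by move=> kn; rewrite /T insubN. Qed.

Section HeckeFactors.
Variables (F : fieldType) (q : F) (n : nat) (A : algType F) (T : nat -> A).
Hypotheses (T_rel : hecke_rel q n T).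
Hypothesis (T_out : forall k, ~~ (0 < k < n)%N -> T k = 0).
Local Notation br := (bracket q).

Lemma T_comm k l : ((k.+1 < l) || (l.+1 < k))%N -> GRing.comm (T k) (T l).
Proof.
wlog kl : k l / (k.+1 < l)%N.
  by move=> W /orP[kl|lk]; [|apply: commr_sym]; apply: W; rewrite ?kl ?lk.
move=> _; have [|kn] := boolP (0 < k < n)%N; last first.
  by rewrite (T_out kn); exact/commr_sym/commr0.
have [|ln _] := boolP (0 < l < n)%N; last by rewrite (T_out ln); exact: commr0.
move=> /andP[l0 ln] /andP[k0 kn]; have [_ tc _] := T_rel.
by apply: tc; rewrite ?kl.
Qed.

Lemma T_sqr k : (0 < k < n)%N -> T k * T k = (q - 1) *: T k + q%:A.
Proof.
move=> kn; have [_ _ tq] := T_rel; have /eqP := tq k kn.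
rewrite mulrDr mulr1 mulrBl mulr_algl addr_eq0 subr_eq => /eqP->.
by rewrite opprB scalerBl scale1r addrC addrA addrAC.
Qed.

Lemma bracket_q : 1 - q != 0 -> br q = 1.
Proof. by move=> q1; rewrite /bracket divff. Qed.

Lemma bracket_mul u v : 1 - u != 0 -> 1 - v != 0 -> 1 - u * v != 0 ->
  br (u * v) * (q - 1 + br u + br v) = br u * br v.
Proof. by move=> u1 v1 uv1; rewrite /bracket; field; rewrite uv1 v1 u1. Qed.

Lemma mulD_alg k (c d : F) : (0 < k < n)%N ->
  (T k + c%:A) * (T k + d%:A) = (q - 1 + (c + d)) *: T k + (q + c * d)%:A.
Proof.
move=> kn; rewrite mulrDr !mulrDl !mulr_algl mulr_algr T_sqr // scalerA.
rewrite !scalerDl.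
by rewrite [_ + c *: _]addrAC addrACA -!addrA.
Qed.

(** Beyond the braid relation, both sides have the coefficients of T_k and T_(k + 1)
    exchanged; they agree by [bracket_mul]. *)
Lemma yang_baxter k u v : (0 < k)%N -> (k.+1 < n)%N ->
    1 - u != 0 -> 1 - v != 0 -> 1 - u * v != 0 ->
  (T k + (br u)%:A) * (T k.+1 + (br (u * v))%:A) * (T k + (br v)%:A) =
  (T k.+1 + (br v)%:A) * (T k + (br (u * v))%:A) * (T k.+1 + (br u)%:A).
Proof.
move=> k0 kn u1 v1 uv1; have [tb _ _] := T_rel.
have := bracket_mul u1 v1 uv1.
move: (br u) (br v) (br (u * v)) => al be ga; rewrite -[q - 1 + _ + _]addrA => abg.
have E p r (al' be' : F) : (0 < p < n)%N -> al' + be' = al + be ->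
    (T p + al'%:A) * (T r + ga%:A) * (T p + be'%:A) =
    T p * T r * T p + be' *: (T p * T r) + al' *: (T r * T p)
      + (al' * be') *: T r + ((al * be) *: T p + (ga * (q + al' * be'))%:A).
  move=> pn ab; rewrite [_ * (T r + _)]mulrDr mulr_algr mulrDl -scalerAl.
  rewrite (mulD_alg _ _ pn) ab scalerDr !scalerA abg.
  rewrite !(mulrDl, mulrDr, scalerDl) !(mulr_algl, mulr_algr) -?scalerAl !scalerA.
  congr (_ + _); rewrite addrA [be' * al']mulrC; congr (_ + _).
  exact: addrAC.
rewrite (E k k.+1 al be) ?k0 ?(ltnW kn) // (E k.+1 k be al) //; last exact: addrC.
rewrite tb // [be * al]mulrC; set w := T k.+1 * _ * _.
rewrite [w + _ + _]addrAC -!addrA; do 3 congr (_ + _).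
exact: addrCA.
Qed.

Lemma T_mulD1 k : (0 < k < n)%N -> T k * (T k + 1) = q *: (T k + 1).
Proof.
move=> kn; rewrite mulrDr mulr1 T_sqr // addrAC -{2}[T k]scale1r -scalerDl.
by rewrite subrK scalerDr.
Qed.

Lemma T_mulD1r k : (0 < k < n)%N -> (T k + 1) * T k = q *: (T k + 1).
Proof. by move=> kn; rewrite -(T_mulD1 kn) mulrDl mulrDr mul1r mulr1. Qed.

Hypotheses (q1 : 1 - q != 0) (q2 : 1 + q != 0).

(** The equation [T p * R = q *: R] means that R is divisible by T_p + 1 on the
    left, and T_p + 1 is the factor of two neighbours in a row, whose ratio
    is q.  By Yang--Baxter this divisibility survives the crossing of two
    neighbours with a third label, at the shifted position. *)
Lemma crossl p u (R : A) : (0 < p)%N -> (p.+1 < n)%N ->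
    1 - u != 0 -> 1 - u * q != 0 -> T p * R = q *: R ->
  T p.+1 * ((T p + (br u)%:A) * (T p.+1 + (br (u * q))%:A) * R) =
  q *: ((T p + (br u)%:A) * (T p.+1 + (br (u * q))%:A) * R).
Proof.
move=> p0 pn u1 uq TR; have := yang_baxter p0 pn u1 q1 uq.
rewrite bracket_q // scale1r; set Y := (T p + _) * _ => YB.
have YR : (1 + q) *: (Y * R) = Y * (T p + 1) * R.
  by rewrite -mulrA mulrDl TR mul1r scalerAr scalerDl scale1r addrC.
apply: (scalerI q2); rewrite [RHS]scalerA [(1 + q) * q]mulrC -scalerA.
rewrite scalerAr YR YB !mulrA T_mulD1 ?pn //.
by rewrite -!scalerAl.
Qed.

Lemma crossr p w (L : A) : (0 < p)%N -> (p.+1 < n)%N ->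
    1 - w != 0 -> 1 - q * w != 0 -> L * T p = q *: L ->
  L * ((T p.+1 + (br (q * w))%:A) * (T p + (br w)%:A)) * T p.+1 =
  q *: (L * ((T p.+1 + (br (q * w))%:A) * (T p + (br w)%:A))).
Proof.
move=> p0 pn w1 qw TL; have := yang_baxter p0 pn q1 w1 qw.
rewrite bracket_q // scale1r -mulrA; set Y := (T p.+1 + _) * _ => YB.
have YL : (1 + q) *: (L * Y) = L * ((T p + 1) * Y).
  by rewrite mulrA mulrDr TL mulr1 mulrDl -scalerAl scalerDl scale1r addrC.
apply: (scalerI q2); rewrite [RHS]scalerA [(1 + q) * q]mulrC -scalerA.
rewrite scalerAl YL YB -!mulrA T_mulD1r ?pn //.
by rewrite -!scalerAr.
Qed.

(** With [br u = c - q], where c is regular and vanishes at [u * q = 1], the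
    product of the two factors has the pole [br (u * q)] once with c, which
    cancels it, and once with [T p - q], which annihilates R. *)
Lemma mergel p u (R : A) :
    1 - u != 0 -> 1 - u * q != 0 -> T p * R = q *: R ->
  (T p + (br u)%:A) * (T p.+1 + (br (u * q))%:A) * R =
  (T p * T p.+1 + ((1 - u * q) / (1 - u) - q) *: T p.+1 +
     ((1 - q) / (1 - u))%:A) * R.
Proof.
move=> u1 uq TR.
have -> : br u = (1 - u * q) / (1 - u) - q by rewrite /bracket; field.
set c := _ - q; rewrite mulrDr !mulrDl -!mulrA -!addrA; congr (_ + _).
rewrite mulr_algl -!scalerAl; congr (_ + _).
rewrite -?scalerAl !mul1r -!scalerAr TR !scalerA -scalerDl.
by congr (_ *: _); rewrite /c /bracket; field; rewrite uq u1.
Qed.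

Lemma merger p w (L : A) :
    1 - w != 0 -> 1 - q * w != 0 -> L * T p = q *: L ->
  L * ((T p.+1 + (br (q * w))%:A) * (T p + (br w)%:A)) =
  L * (T p.+1 * T p + ((1 - q * w) / (1 - w) - q) *: T p.+1 +
     ((1 - q) / (1 - w))%:A).
Proof.
move=> w1 qw TL.
have -> : br w = (1 - q * w) / (1 - w) - q by rewrite /bracket; field.
set c := _ - q; rewrite mulrDl !mulrDr -!addrA; congr (_ + _).
rewrite mulr_algr; congr (_ + _).
rewrite mulr_algl -scalerAr TL mulr_algr -scalerAr !mulr_algr !scalerA -scalerDl.
by congr (_ *: _); rewrite /c /bracket; field; rewrite qw w1.
Qed.

End HeckeFactors.

(** * Divisibility of the ordered products *)

Section Crossings.
Variables (F : fieldType) (q : F) (n : nat) (A : algType F) (T : nat -> A).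
Hypotheses (T_rel : hecke_rel q n T).
Hypothesis (T_out : forall k, ~~ (0 < k < n)%N -> T k = 0).
Variable X : nat -> F.
Local Notation br := (bracket q).

(** The factor of phi_0 for the pair [(i, j)]; it is 1 for [i >= j], so that
    products over pairs can be taken over rectangles. *)
Definition fac i j : A :=
  if (i < j)%N then T (j - i)%N + (br (X j / X i))%:A else 1.

Lemma facE i j : (i < j)%N -> fac i j = T (j - i)%N + (br (X j / X i))%:A.
Proof. by rewrite /fac => ->. Qed.

Lemma fac_ge i j : (j <= i)%N -> fac i j = 1.
Proof. by rewrite /fac ltnNge => ->. Qed.

Lemma T_fac d i j :
  ((i < j) ==> ((d.+1 < j - i) || ((j - i).+1 < d)))%N -> GRing.comm (T d) (fac i j).
Proof.
rewrite /fac; case: ifP => [ij /= dd|_ _]; last exact: commr1.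
by apply: comm_addalg; apply: (T_comm T_rel T_out).
Qed.

Lemma fac_comm i i' j j' : (i < i')%N -> (j < j')%N ->
  GRing.comm (fac i j') (fac i' j).
Proof.
move=> ii jj; rewrite {2}/fac; case: ifP => [ij|_]; last exact: commr1.
apply: comm_addalg; apply: commr_sym; apply: T_fac; apply/implyP => _; lia.
Qed.

(** A [cross] is a segment of the order <_1, a [col] a segment of the order <_2,
    if [a.+1], ..., [b] and [c.+1], ..., [d] are the entries of a row. *)
Definition cross a b i := \prod_(a.+1 <= j < b.+1) fac i j.
Definition crossings a b i := \prod_(i <= i' < b.+1) cross a b i'.
Definition col c d j := \prod_(c.+1 <= i < d.+1) fac i j.

(** This is phi_0 for the first [N] labels, in the order <_2. *)
Definition staircase N := \prod_(1 <= j < N.+1) col 0 j.-1 j.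

Lemma staircase_split a b : (a <= b)%N ->
  staircase b = staircase a * \prod_(1 <= i < b.+1) cross a b i.
Proof.
move=> ab; rewrite /staircase (@big_cat_nat _ _ _ a.+1) //=; congr (_ * _).
rewrite -exchange_prod; last exact: fac_comm.
apply: eq_big_nat => j jab; rewrite /col (@big_cat_nat _ _ _ j.-1.+1 1 b.+1) /=; [|lia..].
rewrite [X in _ = _ * X]big_nat [X in _ = _ * X]big1 ?mulr1 // => i ij.
by rewrite fac_ge //; lia.
Qed.

Hypotheses (q1 : 1 - q != 0) (q2 : 1 + q != 0).
Hypothesis X_neq0 : forall i, (0 < i <= n)%N -> X i != 0.
Hypothesis X_inj : forall i j, (0 < i)%N -> (i < j <= n)%N -> X i != X j.

Lemma ratio1 i j : (0 < i)%N -> (i < j <= n)%N -> 1 - X j / X i != 0.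
Proof.
by move=> i0 ij; apply: ratio_neq1; [apply: X_neq0; lia | exact: X_inj].
Qed.

(** ** Crossing the entries of a row from the right *)

Section Row.
Variables a b : nat.
Hypothesis bn : (b <= n)%N.
Hypothesis rowX : forall j, (a < j < b)%N -> X j.+1 = q * X j.

Local Notation cross := (cross a b).
Local Notation crossings := (crossings a b).

Lemma ratioS i j : (a < j < b)%N -> X j.+1 / X i = X j / X i * q.
Proof. by move=> /rowX->; rewrite -mulrA mulrC. Qed.

(** Before label [i] crosses the row, [j] and [j.+1] stand at the positions
    [j - i + 1] and [j - i + 2].  For [i < j] this is the case of label [i + 1],
    shifted by the crossing of [i].  For [i = j] the first factor of the
    crossings is that of the neighbours themselves. *)
Lemma crossings_div i j : (0 < i)%N -> (i <= j)%N -> (a < j < b)%N ->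
  T (j - i).+1 * crossings i = q *: crossings i.
Proof.
move Ed : (b - i)%N => d; elim: d i j Ed => [|d IH] i j Ed i0 ij jab; first by lia.
rewrite /crossings big_ltn; last by lia.
rewrite -/(crossings i.+1) /cross.
have [jE|ij'] := eqVneq i j.
  rewrite {}jE in i0 Ed ij *; rewrite subnn (@big_nat_cut _ _ _ j.+1); last by lia.
  rewrite big_nat big1 ?mul1r => [|i' ii]; last by rewrite fac_ge //; lia.
  rewrite facE // subSn // subnn ratioS // divff ?mul1r; last by apply: X_neq0; lia.
  rewrite (bracket_q q1) scale1r !mulrA (T_mulD1 T_rel); last by lia.
  by rewrite -!scalerAl.
rewrite (@big_nat_cut _ _ _ j); last by lia.
rewrite (big_ltn (m := j.+1)); last by lia.
set P := \prod_(_ <= _ < j) _; set B := \prod_(j.+2 <= _ < _) _.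
rewrite !facE; [|lia..].
have -> : (j.+1 - i = (j - i).+1)%N by lia.
rewrite ratioS //; set W1 := T (j - i) + _; set W2 := T _.+1 + _.
have TP : T (j - i).+1 * P = P * T (j - i).+1.
  by apply: commr_prod_nat => j' jj; apply: T_fac; apply/implyP; lia.
have TB : T (j - i) * B = B * T (j - i).
  by apply: commr_prod_nat => j' jj; apply: T_fac; apply/implyP; lia.
rewrite !mulrA TP -!mulrA scalerAr; congr (P * _); rewrite [W1 * _]mulrA.
apply: (crossl T_rel) => //; try lia.
- by apply: ratio1; lia.
- by rewrite -ratioS //; apply: ratio1; lia.
rewrite mulrA TB -mulrA scalerAr; congr (_ * _).
by rewrite (_ : (j - i)%N = (j - i.+1).+1) ?IH //; lia.
Qed.

End Row.

(** ** Crossing the entries of a row from the left *)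

Section Column.
Variables c d : nat.

Local Notation col := (col c d).

Lemma ratioV i j : (0 < i)%N -> (i < j <= n)%N -> X i.+1 = q * X i ->
  X j / X i = q * (X j / X i.+1).
Proof.
move=> i0 ij XS; have : X i.+1 != 0 by apply: X_neq0; lia.
by rewrite XS mulf_eq0 negb_or => /andP[q0 Xi]; field; rewrite q0 Xi.
Qed.

(** The factors above that of [(i, j)] commute with [T (j - i).-1], and those
    below that of [(i.+1, j)] commute with [T (j - i)]. *)
Lemma col_div (L : A) i j : (d < j <= n)%N -> (c < i < d)%N -> X i.+1 = q * X i ->
    L * T (j - i).-1 = q *: L ->
  L * col j * T (j - i) = q *: (L * col j).
Proof.
move=> jn id XS LT; rewrite /col (@big_nat_cut _ _ _ i); last by lia.
rewrite (big_ltn (m := i.+1)); last by lia.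
set P := \prod_(_ <= _ < i) _; set B := \prod_(i.+2 <= _ < _) _.
have jiE : (j - i = (j - i.+1).+1)%N by lia.
have XV : X j / X i = q * (X j / X i.+1) by apply: ratioV => //; lia.
rewrite !facE; [|lia..]; rewrite XV; rewrite jiE /= in LT.
have TP : T (j - i.+1) * P = P * T (j - i.+1).
  by apply: commr_prod_nat => i' ii; apply: T_fac; apply/implyP; lia.
have TB : T (j - i) * B = B * T (j - i).
  by apply: commr_prod_nat => i' ii; apply: T_fac; apply/implyP; lia.
rewrite -!mulrA -TB !mulrA.
have LP : L * P * T (j - i.+1) = q *: (L * P) by rewrite -mulrA -TP mulrA LT scalerAl.
rewrite -[L * P * _ * _]mulrA scalerAl; congr (_ * B); rewrite jiE -[q * _ / _]mulrA.
apply: (crossr T_rel) => //; try lia.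
- by apply: ratio1; lia.
- by rewrite -XV; apply: ratio1; lia.
Qed.

Lemma cols_div (L : A) a i J : (d <= a)%N -> (a <= J <= n)%N -> (c < i < d)%N ->
    X i.+1 = q * X i -> L * T (a - i) = q *: L ->
  L * \prod_(a.+1 <= j < J.+1) col j * T (J - i) =
  q *: (L * \prod_(a.+1 <= j < J.+1) col j).
Proof.
move=> da; elim: J => [|J IH] aJ id XS LT; first by lia.
have [aE|aJ'] := eqVneq a J.+1; first by rewrite aE big_geq // mulr1 -aE.
rewrite big_nat_recr; last by lia.
rewrite /= mulrA; apply: col_div => //; first by lia.
by rewrite subSn ?IH //; lia.
Qed.

End Column.

(** When label [i.+1] arrives, its last factor is that of the neighbours [i] and
    [i.+1]; each later column shifts the divisibility by one position. *)
Lemma staircase_div N i : (0 < i < N)%N -> (N <= n)%N -> X i.+1 = q * X i ->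
  staircase N * T (N - i) = q *: staircase N.
Proof.
elim: N => [|N IH] iN Nn XS; first by lia.
rewrite /staircase big_nat_recr //= -/(staircase N).
have [iE|iN'] := eqVneq i N; last first.
  by apply: col_div => //; try lia; rewrite subSn ?IH //; lia.
rewrite {}iE in iN XS *.
have N1 : (N = N.-1.+1)%N by lia.
rewrite /col [X in index_iota 1 X.+1]N1 big_nat_recr //= -N1 facE //.
rewrite subSn // subnn XS mulfK; last by apply: X_neq0; lia.
rewrite (bracket_q q1) scale1r -!mulrA (T_mulD1r T_rel); last by lia.
by rewrite -!scalerAr.
Qed.

(** ** The three-term factors *)

(** For [e = true] this replaces the factors of [(i, j.-1)] and [(i, j)], for
    [e = false] those of [(i, j)] and [(i.+1, j)]. *)
Definition merged (e : bool) i j : A :=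
  let k := (j - i - 1)%N in
  let w := if e then X j.-1 / X i else X j / X i.+1 in
  (if e then T k * T k.+1 else T k.+1 * T k) +
  ((1 - X j / X i) / (1 - w) - q) *: T k.+1 + ((1 - q) / (1 - w))%:A.

(** The factors to the right of [j] do not spoil the divisibility of R, as they
    commute with [T (j.-1 - i)]. *)
Lemma cross_merge a b i j R : (0 < i <= a)%N -> (a.+1 < j <= b)%N ->
    (b <= n)%N -> X j = q * X j.-1 -> T (j.-1 - i) * R = q *: R ->
  cross a b i * R =
  \prod_(a.+1 <= j' < b.+1) (if j' == j then merged true i j
                             else if j'.+1 == j then 1 else fac i j') * R.
Proof.
case: j => // j ia jb bn /= XS TR; rewrite /cross.
rewrite (@big_nat_cut _ _ _ j); last by lia.
rewrite [in RHS](@big_nat_cut _ _ _ j); last by lia.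
rewrite (big_ltn (m := j.+1)); last by lia.
rewrite [in RHS](big_ltn (m := j.+1)); last by lia.
rewrite eqxx ifN_eq ?eqxx; last by lia.
rewrite mulr1 -!mulrA; congr (_ * _).
  by apply: eq_big_nat => j' jj; rewrite !ifN_eq //; lia.
set B := \prod_(_ <= _ < _) _; set B' := \prod_(_ <= _ < _) _.
have <- : B = B' by apply: eq_big_nat => j' jj; rewrite !ifN_eq //; lia.
have TB : T (j - i) * B = B * T (j - i).
  by apply: commr_prod_nat => i' ii; apply: T_fac; apply/implyP; lia.
have XR : X j.+1 / X i = X j / X i * q by rewrite XS -mulrA mulrC.
rewrite mulrA !facE; [|lia..]; rewrite subSn; last by lia.
rewrite XR mergel; first 1 last.
- by apply: ratio1; lia.
- by rewrite -XR; apply: ratio1; lia.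
- by rewrite mulrA TB -mulrA TR scalerAr.
by rewrite /merged /= XR (_ : (j.+1 - i - 1 = j - i)%N) //; lia.
Qed.

Lemma col_merge c d i j L : (c < i < d)%N -> (d < j <= n)%N ->
    X i.+1 = q * X i -> L * T (j - i).-1 = q *: L ->
  L * col c d j =
  L * \prod_(c.+1 <= i' < d.+1) (if i' == i then merged false i j
                             else if i' == i.+1 then 1 else fac i' j).
Proof.
move=> id jn XS LT; rewrite /col.
rewrite (@big_nat_cut _ _ _ i); last by lia.
rewrite [in RHS](@big_nat_cut _ _ _ i); last by lia.
rewrite (big_ltn (m := i.+1)); last by lia.
rewrite [in RHS](big_ltn (m := i.+1)); last by lia.
rewrite !eqxx ifN_eq; last by lia.
rewrite mul1r !mulrA; congr (_ * _); last first.
  by apply: eq_big_nat => j' jj; rewrite !ifN_eq //; lia.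
set B := \prod_(_ <= _ < _) _; set B' := \prod_(_ <= _ < _) _.
have <- : B = B' by apply: eq_big_nat => j' jj; rewrite !ifN_eq //; lia.
have XV : X j / X i = q * (X j / X i.+1) by apply: ratioV => //; lia.
have TB : T (j - i).-1 * B = B * T (j - i).-1.
  by apply: commr_prod_nat => i' ii; apply: T_fac; apply/implyP; lia.
rewrite !facE; [|lia..].
have jiE : (j - i = (j - i).-1.+1)%N by lia.
rewrite XV (_ : j - i.+1 = (j - i).-1)%N ?[in T (j - i)]jiE; last by lia.
rewrite -mulrA merger; first 1 last.
- by apply: ratio1; lia.
- by rewrite -XV; apply: ratio1; lia.
- by rewrite -mulrA -TB mulrA LT scalerAl.
by rewrite /merged /= XV (_ : (j - i - 1 = (j - i).-1)%N) //; lia.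
Qed.

End Crossings.

(** * Independence of the reduced decomposition of w_0 *)

(** The number of pairs in increasing order, not only of neighbours: for an
    arrangement of 1, ..., n this is the distance from the decreasing one. *)
Fixpoint ascents (s : seq nat) : nat :=
  if s is a :: s' then (count (ltn a) s' + ascents s')%N else 0%N.

Lemma perm_swap (E : eqType) (u v : seq E) a b :
  perm_eq (u ++ a :: b :: v) (u ++ b :: a :: v).
Proof.
rewrite perm_cat2l -[a :: b :: v]/([:: a] ++ [:: b] ++ v).
by rewrite -[b :: a :: v]/([:: b] ++ [:: a] ++ v) perm_catCA.
Qed.

Lemma ascents_swap u a b v : (a < b)%N ->
  ascents (u ++ a :: b :: v) = (ascents (u ++ b :: a :: v)).+1.
Proof.
move=> ab; elim: u => [|c u IH] /=.
  rewrite ab [(b < a)%N]ltnNge ltnW //=; lia.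
rewrite IH addnS; congr (_ + _).+1; exact/seq.permP/perm_swap.
Qed.

Lemma ascents0 s : sorted gtn s -> ascents s = 0%N.
Proof.
elim: s => //= a s IH pas; rewrite IH ?(path_sorted pas) // addn0.
apply/eqP; rewrite -leqn0 leqNgt -has_count; apply/hasPn => b bs /=.
rewrite -leqNgt ltnW //; apply: (allP (order_path_min _ pas) _ bs).
by move=> x y z /= xy yz; apply: ltn_trans yz xy.
Qed.

Lemma ascent_exists s : uniq s -> ~~ sorted gtn s ->
  exists u a b v, (a < b)%N /\ s = u ++ a :: b :: v.
Proof.
elim: s => // a [|b s] //= IH /andP[as_ us].
rewrite negb_and => /orP[ab|/(IH us)[u [c [d [v [cd ->]]]]]]; last first.
  by exists (a :: u), c, d, v.
exists [::], a, b, s; split=> //; rewrite ltn_neqAle [(a <= b)%N]leqNgt.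
rewrite ab andbT; apply: contraNneq as_ => ->; exact: mem_head.
Qed.

Lemma cat_eq_size (E : eqType) (u u' v v' : seq E) :
  (size u <= size u')%N -> u ++ v = u' ++ v' ->
  exists2 t, u' = u ++ t & v = t ++ v'.
Proof.
move=> uu e; exists (drop (size u) u').
  have := congr1 (take (size u)) e; rewrite take_size_cat // takel_cat // => {1}->.
  by rewrite cat_take_drop.
have := congr1 (drop (size u)) e; rewrite drop_size_cat // drop_cat.
case: ltnP => // u'u; have {uu u'u} E' : size u = size u' by apply/eqP; rewrite eqn_leq uu.
by rewrite E' subnn drop0 drop_size.
Qed.

Section Sorting.
Variables (F : fieldType) (q : F) (n : nat) (A : algType F) (T : nat -> A).
Hypotheses (T_rel : hecke_rel q n T).
Hypothesis (T_out : forall k, ~~ (0 < k < n)%N -> T k = 0).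
Variable X : nat -> F.
Hypothesis X_neq0 : forall i, (0 < i <= n)%N -> X i != 0.
Hypothesis X_inj : forall i j, (0 < i)%N -> (i < j <= n)%N -> X i != X j.

Definition weight k a b : A := T k + (bracket q (X b / X a))%:A.

(** [sorting s h]: the list of labels [s] is brought into decreasing order by
    a sequence of exchanges of neighbours in increasing order, and [h] is the
    product of the weights of these exchanges.  For [s] = 1, ..., n these are
    the reduced decompositions of w_0. *)
Inductive sorting : seq nat -> A -> Prop :=
| sorting_done s : sorted gtn s -> sorting s 1
| sorting_step u a b v h : (a < b)%N -> sorting (u ++ b :: a :: v) h ->
    sorting (u ++ a :: b :: v) (weight (size u).+1 a b * h).

Lemma sorting_step_at k u a b v h s s' : (a < b)%N -> size u = k ->
    s = u ++ a :: b :: v -> s' = u ++ b :: a :: v ->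
  sorting s' h -> sorting s (weight k.+1 a b * h).
Proof. by move=> ab <- -> ->; apply: sorting_step. Qed.

Lemma sorting_exists s : uniq s -> exists h, sorting s h.
Proof.
move: {2}(ascents s) (erefl (ascents s)) => m; elim: m s => [|m IH] s sm us.
all: have [ss|/(ascent_exists us)[u [a [b [v [ab sE]]]]]] := boolP (sorted gtn s).
- by exists 1; apply: sorting_done.
- by move: sm; rewrite sE ascents_swap.
- by exists 1; apply: sorting_done.
have [||h sh] := IH (u ++ b :: a :: v).
- by move: sm; rewrite sE ascents_swap // => -[].
- move: us; rewrite sE => us; by rewrite (perm_uniq (perm_swap _ _ _ _)).
by exists (weight (size u).+1 a b * h); rewrite sE; apply: sorting_step.
Qed.

Lemma sorting_inv s h : sorting s h ->
  sorted gtn s /\ h = 1 \/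
  exists u a b v h', [/\ (a < b)%N, s = u ++ a :: b :: v,
    h = weight (size u).+1 a b * h' & sorting (u ++ b :: a :: v) h'].
Proof.
by case=> [s' ss|u a b v h' ab sh]; [left | right; exists u, a, b, v, h'].
Qed.

Lemma sorted_ascent u a b v : (a < b)%N -> sorted gtn (u ++ a :: b :: v) = false.
Proof.
move=> ab; apply/negP => s; have := ascents_swap u v ab; by rewrite ascents0.
Qed.

Lemma weight_comm k l a b c d : (k.+1 < l)%N ->
  weight k a b * weight l c d = weight l c d * weight k a b.
Proof.
move=> kl; apply: comm_addalg; apply: commr_sym; apply: comm_addalg.
by apply: (T_comm T_rel T_out); rewrite kl orbT.
Qed.

Lemma weight_braid k a b c : (0 < k)%N -> (k.+1 < n)%N -> (0 < a)%N ->
    (a < b)%N -> (b < c)%N -> (c <= n)%N ->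
  weight k a b * weight k.+1 a c * weight k b c =
  weight k.+1 b c * weight k a c * weight k.+1 a b.
Proof.
move=> k0 kn a0 ab bc cn.
have Xa : X a != 0 by apply: X_neq0; lia.
have Xb : X b != 0 by apply: X_neq0; lia.
have E : X c / X a = (X b / X a) * (X c / X b) by field; rewrite Xa Xb.
rewrite /weight E; apply: (yang_baxter T_rel) => //.
- by apply: ratio_neq1 => //; apply: X_inj; lia.
- by apply: ratio_neq1 => //; apply: X_inj; lia.
- by rewrite -E; apply: ratio_neq1 => //; apply: X_inj; lia.
Qed.

(** Newman's argument: two exchanges that can be performed first on [s] are
    completed to a common result by the commutation or by the Yang--Baxter
    relation, and the claim is known after the first exchange. *)
Lemma sorting_unique s h1 h2 : perm_eq s (iota 1 n) ->
  sorting s h1 -> sorting s h2 -> h1 = h2.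
Proof.
move: {2}(ascents s) (erefl (ascents s)) => m.
elim: m s h1 h2 => [|m IH] s h1 h2 sm sn.
  move=> /sorting_inv[[ss ->]|[u [a [b [v [h [ab sE _ _]]]]]]].
    move=> /sorting_inv[[_ ->//]|[u [a [b [v [h [ab sE _ _]]]]]]].
    by move: ss; rewrite sE sorted_ascent.
  by move: sm; rewrite sE ascents_swap.
move=> /sorting_inv[[/ascents0]|]; first by rewrite sm.
move=> [u [a [b [v [k1 [ab sE -> s1]]]]]].
move=> /sorting_inv[[/ascents0]|]; first by rewrite sm.
move=> [u' [a' [b' [v' [k2 [ab' sE' -> s2]]]]]].
wlog uu : u a b v k1 u' a' b' v' k2 ab ab' sE sE' s1 s2 / (size u <= size u')%N.
  move=> W; have [uu|/ltnW uu] := leqP (size u) (size u'); first exact: (W u a b v k1 u' a' b' v' k2).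
  by apply/esym; exact: (W u' a' b' v' k2 u a b v k1).
have swap_perm w c d z : s = w ++ c :: d :: z ->
    perm_eq (w ++ d :: c :: z) (iota 1 n).
  by move=> E; rewrite -(permPr sn) E perm_swap.
have swap_uniq w c d z : s = w ++ c :: d :: z -> uniq (w ++ d :: c :: z).
  by move=> E; rewrite (perm_uniq (swap_perm _ _ _ _ E)) iota_uniq.
have IH' w c d z k k' : (c < d)%N -> s = w ++ c :: d :: z ->
    sorting (w ++ d :: c :: z) k -> sorting (w ++ d :: c :: z) k' -> k = k'.
  move=> cd E; apply: IH; last exact: swap_perm E.
  by move: sm; rewrite E ascents_swap // => -[].
have sn_size : size s = n by rewrite (perm_size sn) size_iota.
have sn_mem c : c \in s -> (0 < c <= n)%N.
  by rewrite (perm_mem sn) mem_iota => /andP[-> ]; rewrite add1n ltnS.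
have us : uniq s by rewrite (perm_uniq sn) iota_uniq.
have [t uE vE] := cat_eq_size uu (etrans (esym sE) sE').
case: t => [|c t] in uE vE.
  move: uE vE; rewrite cats0 => uE [aE bE vE]; subst u' a' b' v'.
  by congr (_ * _); exact: (IH' u a b v).
(* The two exchanges are disjoint if t has at least two entries, and overlap in
   one label if it has one. *)
case: t => [|d t] in uE vE; case: vE => aE; last first.
  move=> bE vE; subst c d v u'; rewrite size_cat /=.
  have := @sorting_exists (u ++ b :: a :: t ++ b' :: a' :: v').
  case=> [|k kP].
    rewrite -(perm_uniq (s1 := u ++ b :: a :: t ++ a' :: b' :: v')) ?swap_uniq //.
    by rewrite perm_cat2l !perm_cons perm_swap.
  have e1 : k1 = weight (size u + (size t).+2).+1 a' b' * k.
    apply: (IH' u a b (t ++ a' :: b' :: v')) => //.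
    apply: (@sorting_step_at _ (u ++ b :: a :: t) _ _ v' _ _ _ ab' _ _ _ kP).
    - by rewrite size_cat.
    - by rewrite -catA.
    - by rewrite -catA.
  have e2 : k2 = weight (size u).+1 a b * k.
    apply: (IH' _ a' b' v' _ _ ab' sE') => //.
    apply: (@sorting_step_at _ u _ _ (t ++ b' :: a' :: v') _ _ _ ab _ _ _ kP) => //.
    by rewrite -catA.
  rewrite e1 e2 !mulrA weight_comm //; lia.
case=> bE vE; subst c a' v u'.
rewrite size_cat addn1.
have [h hP] : exists h, sorting (u ++ b' :: b :: a :: v') h.
  apply: sorting_exists.
  rewrite -(perm_uniq (s1 := u ++ b :: a :: b' :: v')) ?swap_uniq //.
  rewrite perm_cat2l -[b :: _]/([:: b; a] ++ [:: b'] ++ v').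
  by rewrite perm_catCA.
have [ha hb hb'] : [/\ 0 < a <= n, 0 < b <= n & 0 < b' <= n]%N.
  by split; apply: sn_mem; rewrite sE mem_cat !inE eqxx ?orbT.
have nu : ((size u).+2 < n)%N by rewrite -sn_size sE size_cat /= -addn2; lia.
have e1 : k1 = weight (size u).+2 a b' * (weight (size u).+1 b b' * h).
  apply: (IH' u a b (b' :: v')) => //.
  apply: (@sorting_step_at _ (u ++ [:: b]) a b' v' _ _ (u ++ b :: b' :: a :: v')) => //.
  - by rewrite (leq_trans ab) // ltnW.
  - by rewrite size_cat addn1.
  - by rewrite -catA.
  - by rewrite -catA.
  exact: sorting_step.
have e2 : k2 = weight (size u).+1 a b' * (weight (size u).+2 a b * h).
  apply: (IH' _ b b' v' _ _ ab' sE') => //.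
  rewrite -catA /=; apply: sorting_step; first by rewrite (leq_trans ab) // ltnW.
  apply: (@sorting_step_at _ (u ++ [:: b']) a b v' _ _ (u ++ b' :: b :: a :: v')) => //.
  - by rewrite size_cat addn1.
  - by rewrite -catA.
  - by rewrite -catA.
by rewrite e1 e2 !mulrA weight_braid //; lia.
Qed.

End Sorting.

Section LexProduct.
Variables (F : fieldType) (q : F) (n : nat) (A : algType F) (T : nat -> A).
Variable X : nat -> F.
Local Notation fac := (fac q T X).
Local Notation sorting := (sorting q T X).

Lemma sorting_move a s u v h : all (ltn a) s -> sorting (u ++ s ++ a :: v) h ->
  sorting (u ++ a :: s ++ v)
    (\prod_(0 <= t < size s) weight q T X (size u + t).+1 a (nth 0%N s t) * h).
Proof.
elim: s u => [|b s IH] u /=; first by rewrite big_geq // mul1r.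
move=> /andP[ab as_] sh; rewrite big_nat_recl //= addn0 -mulrA.
apply: sorting_step => //.
have -> : u ++ b :: a :: s ++ v = (rcons u b) ++ a :: s ++ v by rewrite cat_rcons.
have := IH (rcons u b) as_; rewrite cat_rcons => /(_ sh); congr (sorting _ _).
by congr (_ * _); apply: eq_bigr => t _; rewrite size_rcons addnS.
Qed.

(** In the order <_1, label 1 is carried to the end first, then label 2 up to
    label 1, and so on; the factors with [j <= i'] are 1. *)
Lemma sorting_lex i : (0 < i <= n.+1)%N ->
  sorting (iota i (n.+1 - i) ++ rev (iota 1 i.-1))
    (\prod_(i <= i' < n.+1) \prod_(1 <= j < n.+1) fac i' j).
Proof.
case: i => // i /= iN; rewrite subSS.
move Ed : (n - i)%N => d; elim: d i Ed iN => [|d IH] i Ed iN.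
  rewrite big_geq; last by lia.
  apply: sorting_done; rewrite /= rev_sorted; exact: iota_ltn_sorted.
rewrite big_ltn; last by lia.
have -> : \prod_(1 <= j < n.+1) fac i.+1 j =
    \prod_(0 <= t < size (iota i.+2 d))
      weight q T X (size (Nil nat) + t).+1 i.+1 (nth 0%N (iota i.+2 d) t).
  rewrite (@big_cat_nat _ _ _ i.+2) //=; try lia.
  rewrite [X in X * _]big_nat big1 ?mul1r; last first.
    by move=> j jj; rewrite fac_ge //; lia.
  rewrite size_iota -{1}[i.+2]add0n big_addn (_ : (n.+1 - i.+2 = d)%N); last by lia.
  apply: eq_big_nat => t td; rewrite nth_iota //= facE; last by lia.
  by rewrite /weight addnC (_ : i.+2 + t - i.+1 = t.+1)%N //; lia.
rewrite -[iota _ _ ++ _]/([::] ++ i.+1 :: iota i.+2 d ++ rev (iota 1 i)).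
apply: sorting_move; first by apply/allP => j /=; rewrite mem_iota => /andP[].
rewrite cat0s -cat_rcons; have := IH i.+1.
rewrite (_ : iota 1 i.+1 = rcons (iota 1 i) i.+1) ?rev_rcons.
  by rewrite cat_rcons; apply; lia.
by rewrite -cats1 -[in LHS](addn1 i) iotaD add1n.
Qed.

End LexProduct.

Section ReducedWords.
Variables (F : fieldType) (q : F) (n : nat).
Implicit Types (s : 'S_n) (g : sgen n) (ks : seq (sgen n)) (x : n.-tuple F).

(** The arrangement s(1), ..., s(n): multiplying s by a simple transposition on
    the left exchanges two neighbours in this list. *)
Definition labels s : seq nat := [seq (nat_of_ord (s i)).+1 | i <- enum 'I_n].

Lemma labels_perm s : perm_eq (labels s) (iota 1 n).
Proof.
have -> : iota 1 n = [seq (nat_of_ord i).+1 | i <- enum 'I_n].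
  by rewrite (map_comp S val) val_enum_ord -[1%N]addn0 iotaDl.
rewrite /labels (map_comp (fun i : 'I_n => (nat_of_ord i).+1) s); apply: perm_map.
apply: uniq_perm; rewrite ?enum_uniq ?(map_inj_uniq perm_inj) ?enum_uniq //.
move=> i; rewrite mem_enum; apply/mapP; exists ((s^-1)%g i); rewrite ?mem_enum //.
by rewrite permKV.
Qed.

Lemma nth_labels s (i : 'I_n) : nth 0%N (labels s) i = (nat_of_ord (s i)).+1.
Proof. by rewrite /labels (nth_map i) ?size_enum_ord // nth_ord_enum. Qed.

Lemma labels_inj : injective labels.
Proof.
move=> s t e; apply/permP => i; apply/val_inj/succn_inj.
by have := congr1 (fun l => nth 0%N l i) e; rewrite !nth_labels.
Qed.

Lemma labels_w0 : labels (w0 n) = rev (iota 1 n).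
Proof.
apply: (@eq_from_nth _ 0%N); first by rewrite size_rev size_map size_enum_ord size_iota.
move=> i; rewrite size_map size_enum_ord => ni.
rewrite nth_rev ?size_iota // nth_iota; last by lia.
by rewrite (nth_labels _ (Ordinal ni)) permE /=; lia.
Qed.

Lemma sorted_w0 : sorted gtn (labels (w0 n)).
Proof. by rewrite labels_w0 rev_sorted; exact: iota_ltn_sorted. Qed.

Lemma sorted_labels s : sorted gtn (labels s) -> s = w0 n.
Proof.
move=> ss; apply: labels_inj; apply: (sorted_eq (leT := gtn)) => //.
- by move=> a b c /= ab bc; apply: ltn_trans bc ab.
- by move=> a b /= /andP[ab]; rewrite ltnNge ltnW.
- exact: sorted_w0.
- by rewrite (permPl (labels_perm _)) perm_sym labels_perm.
Qed.

Lemma enum_sgen g : exists u v, enum 'I_n = u ++ sgen_l g :: sgen_r g :: v /\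
  size u = (val g).-1.
Proof.
case: (sgen_lt g) => gl gr; have g0 : (0 < val g)%N by case: (g) => k /= /andP[].
have gE : (val g).-1.+1 = val g by rewrite prednK.
exists (take (val g).-1 (enum 'I_n)), (drop (val g).+1 (enum 'I_n)); split; last first.
  by rewrite size_takel // size_enum_ord ltnW.
rewrite -{1}[enum 'I_n](cat_take_drop (val g).-1); congr (_ ++ _).
rewrite (drop_nth (sgen_l g)) ?size_enum_ord // gE.
rewrite (drop_nth (sgen_l g)) ?size_enum_ord //; congr [:: _, _ & _].
  exact: (nth_ord_enum (sgen_l g) (sgen_l g)).
exact: (nth_ord_enum (sgen_l g) (sgen_r g)).
Qed.

Lemma labels_simple g s : exists u v,
  [/\ labels s = u ++ (s (sgen_l g)).+1 :: (s (sgen_r g)).+1 :: v,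
      labels (simple g * s) = u ++ (s (sgen_r g)).+1 :: (s (sgen_l g)).+1 :: v
    & size u = (val g).-1].
Proof.
have [u [v [eE us]]] := enum_sgen g; have := enum_uniq 'I_n; rewrite eE cat_uniq /=.
rewrite !inE !negb_or => /and5P[_ /and3P[lu ru _] /andP[_ lv] rv _].
pose f t (i : 'I_n) := (nat_of_ord (perm.fun_of_perm t i)).+1.
exists (map (f s) u), (map (f s) v); rewrite size_map; split=> //.
  by rewrite /labels eE map_cat.
have out w : sgen_l g \notin w -> sgen_r g \notin w -> map (f (simple g * s)%g) w = map (f s) w.
  move=> lw rw; apply/eq_in_map => i iw; rewrite /f permM /simple tpermD //.
    by apply: contraNneq lw => ->.
  by apply: contraNneq rw => ->.
rewrite /labels eE map_cat /= -/(f _) -/(map (f (simple g * s)%g) u) !out //.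
by rewrite !permM /simple tpermL tpermR.
Qed.

End ReducedWords.

Section ReducedProducts.
Variables (F : fieldType) (q : F) (n : nat).
Implicit Types (s : 'S_n) (g : sgen n) (ks : seq (sgen n)) (x : n.-tuple F).
Local Notation sorting x := (sorting q (T q n) (pcoord x)).

Lemma perm_point_simple g s x :
  perm_point (simple g) (perm_point s x) = perm_point (simple g * s)%g x.
Proof. by apply: eq_from_tnth => i; rewrite !tnth_mktuple permM. Qed.

Lemma phi_weight g s x :
  phi q g (perm_point s x) =
  weight q (T q n) (pcoord x) (val g) (s (sgen_l g)).+1 (s (sgen_r g)).+1.
Proof. by rewrite /phi !tnth_mktuple /weight /pcoord !(tnth_nth 0). Qed.

(** Every exchange changes the number of ascents by one, so a word that leads
    to w_0 within that number of steps never exchanges a descent. *)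
Lemma word_sorting ks s x : (\prod_(g <- rev ks) simple g * s)%g = w0 n ->
  (ascents (labels s) <= size ks)%N /\
  ((size ks <= ascents (labels s))%N ->
     sorting x (labels s) (phi_word q ks (perm_point s x))).
Proof.
elim: ks s => [|g ks IH] s.
  rewrite big_nil mul1g => ->; rewrite (ascents0 (sorted_w0 n)); split=> // _.
  exact/sorting_done/sorted_w0.
rewrite rev_cons -cats1 big_cat big_seq1 /= -mulgA => /IH; rewrite -perm_point_simple => -[lo hi].
have g0 : (0 < val g)%N by case: (g) => k /= /andP[].
have [u [v [sE gE us]]] := labels_simple g s.
rewrite phi_weight; case: (ltngtP (s (sgen_l g)) (s (sgen_r g))) => lr.
- have aE : ascents (labels s) = (ascents (labels (simple g * s)%g)).+1.
    by rewrite sE gE ascents_swap.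
  rewrite aE !ltnS; split=> // /hi gs.
  by rewrite -(prednK g0); apply: sorting_step_at us sE gE gs.
- have aE : ascents (labels (simple g * s)%g) = (ascents (labels s)).+1.
    by rewrite sE gE ascents_swap.
  by split=> [|bad]; [|exfalso]; move: lo; rewrite aE /=; lia.
have := enum_uniq 'I_n; have [u' [v' [-> _]]] := enum_sgen g.
rewrite cat_uniq /= !inE; have /perm_inj-> := val_inj lr.
by rewrite eqxx /= !andbF.
Qed.

Lemma word_exists s : exists ks,
  (\prod_(g <- rev ks) simple g * s)%g = w0 n /\ size ks = ascents (labels s).
Proof.
move: {2}(ascents _) (erefl (ascents (labels s))) => m; elim: m s => [|m IH] s sm.
all: have [ss|] := boolP (sorted gtn (labels s)).
- by exists [::]; rewrite big_nil mul1g (ascents0 ss) (sorted_labels ss).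
- case/ascent_exists; first by rewrite (perm_uniq (labels_perm s)) iota_uniq.
  by move=> u [a [b [v [ab sE]]]]; move: sm; rewrite sE ascents_swap.
- by move: sm; rewrite ascents0.
case/ascent_exists; first by rewrite (perm_uniq (labels_perm s)) iota_uniq.
move=> u [a [b [v [ab sE]]]].
have un : (0 < (size u).+1 < n)%N.
  have := size_iota 1 n; rewrite -(perm_size (labels_perm s)) sE size_cat /=; lia.
pose g : sgen n := exist (fun k => is_true (0 < k < n)%N) _ un.
have [u' [v' [sE' gE us]]] := labels_simple g s.
have uu : (size u <= size u')%N by rewrite us.
have [t uE vE] := cat_eq_size uu (etrans (esym sE) sE').
have t0 : t = [::] by apply: size0nil; move: us; rewrite uE size_cat /=; lia.
move: vE; rewrite t0 => -[aE bE _]; rewrite aE bE in ab.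
have gm : ascents (labels (simple g * s)%g) = m.
  by move: sm; rewrite sE' gE ascents_swap // => -[].
have [ks [ksE kss]] := IH _ gm.
exists (g :: ks); rewrite rev_cons -cats1 big_cat big_seq1 /= -mulgA ksE kss gm.
by rewrite sm.
Qed.

Lemma perm_point1 x : perm_point 1%g x = x.
Proof. by apply: eq_from_tnth => i; rewrite tnth_mktuple perm1. Qed.

Lemma labels1 : labels (1%g : 'S_n) = iota 1 n.
Proof.
apply: (@eq_from_nth _ 0%N); first by rewrite size_map size_enum_ord size_iota.
move=> i; rewrite size_map size_enum_ord => ni.
by rewrite (nth_labels _ (Ordinal ni)) perm1 nth_iota.
Qed.

Lemma reduced_word_exists : exists ks, reduced_word (w0 n) ks.
Proof.
have [ks [ksE kss]] := word_exists 1%g; exists ks; rewrite mulg1 in ksE.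
split=> // ks'; rewrite /is_word => ksE'.
by have [] := @word_sorting ks' 1%g [tuple 0 | _ < n]; rewrite ?mulg1 // kss.
Qed.

Lemma generic_neq0 x i : generic x -> (0 < i <= n)%N -> pcoord x i != 0.
Proof.
case=> _ x0 i0; apply: contraNneq x0 => <-.
by rewrite /pcoord mem_nth // size_tuple; lia.
Qed.

Lemma generic_inj x i j : generic x -> (0 < i)%N -> (i < j <= n)%N ->
  pcoord x i != pcoord x j.
Proof. by case=> ux _ i0 ij; rewrite /pcoord nth_uniq ?size_tuple //; lia. Qed.

(** A reduced decomposition has as many letters as there are pairs, so that it
    is a sequence of exchanges as in [sorting], like the lexicographic one. *)
Lemma reduced_product ks x : reduced_word (w0 n) ks -> generic x ->
  phi_word q ks x =
  \prod_(1 <= i < n.+1) \prod_(1 <= j < n.+1) fac q (T q n) (pcoord x) i j.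
Proof.
move=> [ksE ksm] gx; have [ks' [ksE' kss']] := word_exists 1%g.
have [|_ /(_ _)] := @word_sorting ks 1%g x; first by rewrite mulg1.
rewrite mulg1 in ksE'; rewrite -kss' => /(_ (ksm _ ksE')).
rewrite perm_point1 labels1 => sks.
have := @sorting_lex _ q n _ (T q n) (pcoord x) 1 isT; rewrite subn1 /= cats0.
apply: (sorting_unique (hecke_relT q n) (@T_out _ q n) _ _ (perm_refl _)) sks.
- by move=> i; apply: generic_neq0.
- by move=> i j; apply: generic_inj.
Qed.

End ReducedProducts.

(** * The rows of a Cherednik diagram *)

Section Rows.
Variable lam : diagram.
Hypothesis lam_diag : is_diagram lam.
Implicit Types i k l r : nat.

(** Row [r] of the row filling consists of the [k] with
    [offset r.-1 < k <= offset r]. *)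
Definition offset r : nat := \sum_(1 <= i < r.+1) row_len lam i.

(** The contents of the first and of the last box of row [r]. *)
Definition alpha r : int := row_a lam r - r%:Z.
Definition beta r : int := row_b lam r - r%:Z.

Lemma offset0 : offset 0 = 0%N.
Proof. by rewrite /offset big_geq. Qed.

Lemma offsetS r : offset r.+1 = (offset r + row_len lam r.+1)%N.
Proof. by rewrite /offset big_nat_recr. Qed.

Lemma offset_pred r : (0 < r)%N -> offset r = (offset r.-1 + row_len lam r)%N.
Proof. by case: r => // r _; rewrite offsetS. Qed.

Lemma leq_offset k l : (k <= l)%N -> (offset k <= offset l)%N.
Proof.
elim: l => [|l IH]; first by rewrite leqn0 => /eqP->.
rewrite leq_eqVlt => /predU1P[->//|/IH kl].
by rewrite offsetS (leq_trans kl) // leq_addr.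
Qed.

Lemma row_lenE r : (0 < r <= size lam)%N ->
  (row_len lam r)%:Z = beta r - alpha r + 1.
Proof.
move=> /lam_diag ab; rewrite /row_len /beta /alpha; lia.
Qed.

Lemma row_len_gt0 r : (0 < r <= size lam)%N -> (0 < row_len lam r)%N.
Proof.
by move=> rs; have := row_lenE rs; have := lam_diag rs; rewrite /alpha /beta; lia.
Qed.

Definition in_row r k := (offset r.-1 < k <= offset r)%N.

Lemma nth_box r k : (0 < r <= size lam)%N -> in_row r k ->
  box lam k = (r, row_a lam r + (k - (offset r.-1).+1)%N%:Z).
Proof.
move=> rs /andP[kr rk]; rewrite /box /boxes.
pose f i := [seq (i, row_a lam i + t%:Z) | t <- iota 0 (row_len lam i)].
have szf s : size (flatten [seq f i | i <- iota 1 s]) = offset s.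
  elim: s => [|s IH]; first by rewrite offset0.
  rewrite -(addn1 s) iotaD map_cat flatten_cat size_cat IH addn1 offsetS add1n /=.
  by rewrite cats0 size_map size_iota.
have -> : iota 1 (size lam) = iota 1 r.-1 ++ r :: iota r.+1 (size lam - r).
  have sE : size lam = (r.-1 + (size lam - r).+1)%N by lia.
  rewrite {1}sE iotaD; congr (_ ++ _).
  by rewrite add1n prednK //; lia.
rewrite map_cat flatten_cat nth_cat -/f szf ifF; last by lia.
rewrite /= nth_cat size_map size_iota ifT; last first.
  by rewrite (offset_pred (r := r)) in rk; lia.
rewrite (nth_map 0%N) ?size_iota ?nth_iota //; last 2 first.
- by rewrite (offset_pred (r := r)) in rk; lia.
- by rewrite (offset_pred (r := r)) in rk; lia.
by congr (_, _ + _%:Z); lia.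
Qed.

Lemma row_ofE r k : (0 < r <= size lam)%N -> in_row r k -> row_of lam k = r.
Proof. by move=> rs rk; rewrite /row_of (nth_box rs rk). Qed.

Lemma contentE r k : (0 < r <= size lam)%N -> in_row r k ->
  content lam k = alpha r + (k - (offset r.-1).+1)%N%:Z.
Proof. by move=> rs rk; rewrite /content (nth_box rs rk) /alpha /= addrAC. Qed.

Lemma leftmostE r k : (0 < r <= size lam)%N -> in_row r k ->
  leftmost lam k = (k == (offset r.-1).+1).
Proof.
move=> rs rk; rewrite /leftmost (row_ofE rs rk) (nth_box rs rk) /=.
by move: rk => /andP[k1 k2]; apply/eqP/eqP; lia.
Qed.

Lemma in_row_exists k : (0 < k <= degree lam)%N ->
  exists2 r, (0 < r <= size lam)%N & in_row r k.
Proof.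
rewrite /degree -/(offset _); elim: (size lam) => [|s IH].
  by rewrite offset0; lia.
move=> ks; have [kl|kl] := leqP k (offset s).
  by have [|r rs rk] := IH; [lia | exists r => //; lia].
by exists s.+1; rewrite /in_row ?leqnn //= kl; lia.
Qed.

Lemma in_row_le r k : (0 < r <= size lam)%N -> in_row r k -> (0 < k <= degree lam)%N.
Proof.
move=> rs /andP[k1 k2]; have : (offset r <= offset (size lam))%N.
  by apply: leq_offset; lia.
by rewrite /degree -/(offset _); lia.
Qed.

Lemma row_of_eq r k : (0 < r <= size lam)%N -> (0 < k <= degree lam)%N ->
  (row_of lam k == r) = in_row r k.
Proof.
move=> rs /in_row_exists[r' rs' rk']; rewrite (row_ofE rs' rk').
apply/eqP/idP => [<-//|rk]; apply/eqP; move: rk rk' => /andP[k1 k2] /andP[k3 k4].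
have [rr|rr|//] := ltngtP r r'.
  have : (offset r <= offset r'.-1)%N by apply: leq_offset; lia.
  lia.
have : (offset r' <= offset r.-1)%N by apply: leq_offset; lia.
lia.
Qed.

Lemma content_inj k l : (0 < k <= degree lam)%N -> (0 < l <= degree lam)%N ->
  row_of lam k = row_of lam l -> content lam k = content lam l -> k = l.
Proof.
move=> kn ln; have [r rs rk] := in_row_exists kn.
rewrite (row_ofE rs rk) => /esym/eqP; rewrite row_of_eq // => rl.
rewrite (contentE rs rk) (contentE rs rl).
by move: rk rl => /andP[? ?] /andP[? ?]; lia.
Qed.

Lemma content_next k : (0 < k)%N -> (k < degree lam)%N ->
  row_of lam k = row_of lam k.+1 -> content lam k.+1 = content lam k + 1.
Proof.
move=> k0 kn; have [|r rs rk] := @in_row_exists k; first by lia.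
rewrite (row_ofE rs rk) => /esym/eqP; rewrite row_of_eq // => rk1.
rewrite (contentE rs rk) (contentE rs rk1).
by move: rk => /andP[]; lia.
Qed.

Hypothesis lam_cher : cherednik lam.

(** Read along the diagonals, the right ends of the rows move weakly to the
    left, and so do the left ends of rows with a common right end.  Hence the
    rows above row l that end on its diagonal are the last ones, and among
    them the rows parallel to row l are again the last ones. *)
Lemma rows_order k l : (0 < k)%N -> (k <= l <= size lam)%N ->
  beta l < beta k \/ beta l = beta k /\ alpha l <= alpha k.
Proof.
move=> k0; elim: l => [|l IH] kl; first by lia.
have [<-|kl'] := eqVneq k l.+1; first by right.
have [|lt|[be al]] := IH; first by lia.
  case: lam_cher => _ /(_ l); rewrite /beta /alpha in lt *.
  by case; [lia | move=> ?; left; lia | move=> [? ?]; left; lia].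
case: lam_cher => _ /(_ l); rewrite /beta /alpha in be al *.
by case; [lia | move=> ?; left; lia | move=> [? ?]; right; lia].
Qed.

Lemma same_endE k l : same_end lam k l = (beta k == beta l).
Proof. by []. Qed.

Lemma parallelE k l :
  parallel lam k l = (alpha k == alpha l) && (beta k == beta l).
Proof. by []. Qed.

Lemma same_end_rows l : (0 < l <= size lam)%N ->
  exists k0, (0 < k0 <= l)%N /\
    forall k, (0 < k <= l)%N -> same_end lam k l = (k0 <= k)%N.
Proof.
move=> ls; have ex : exists k, (0 < k <= l)%N && same_end lam k l.
  by exists l; rewrite leqnn same_endE eqxx; lia.
have [k0 /andP[k0l kle] k0min] := ex_minnP ex; exists k0; split=> // k kl.
apply/idP/idP => [ke|kk]; first by apply: k0min; rewrite kl.
have h1 : (0 < k0)%N by lia.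
have h2 : (k0 <= k <= size lam)%N by lia.
have h3 : (0 < k)%N by lia.
have h4 : (k <= l <= size lam)%N by lia.
rewrite !same_endE in kle *; move/eqP: kle => kle; apply/eqP.
by case: (rows_order h1 h2) (rows_order h3 h4) => [?|[? _]] [?|[? _]]; lia.
Qed.

Lemma parallel_rows l : (0 < l <= size lam)%N ->
  exists p, (0 < p <= l)%N /\
    forall k, (0 < k <= l)%N -> parallel lam k l = (p <= k)%N.
Proof.
move=> ls; have ex : exists k, (0 < k <= l)%N && parallel lam k l.
  by exists l; rewrite leqnn parallelE !eqxx; lia.
have [p /andP[pl pp] pmin] := ex_minnP ex; exists p; split=> // k kl.
apply/idP/idP => [ke|kk]; first by apply: pmin; rewrite kl.
have h1 : (0 < p)%N by lia.
have h2 : (p <= k <= size lam)%N by lia.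
have h3 : (0 < k)%N by lia.
have h4 : (k <= l <= size lam)%N by lia.
rewrite !parallelE in pp *; move/andP: pp => [/eqP al /eqP be]; apply/andP.
by case: (rows_order h1 h2) (rows_order h3 h4) => [?|[? ?]] [?|[? ?]];
  split; apply/eqP; lia.
Qed.

Lemma parallel_len k l : (0 < k <= size lam)%N -> (0 < l <= size lam)%N ->
  parallel lam k l -> row_len lam k = row_len lam l.
Proof.
move=> ks ls; rewrite parallelE => /andP[/eqP al /eqP be].
by have := row_lenE ks; have := row_lenE ls; rewrite al be; lia.
Qed.

End Rows.

Lemma prod_rows (lam : diagram) (B : pzRingType) (f : nat -> B) k l : (0 < k)%N -> (k <= l.+1)%N ->
  \prod_((offset lam k.-1).+1 <= i < (offset lam l).+1) f i =
  \prod_(k <= r < l.+1) \prod_((offset lam r.-1).+1 <= i < (offset lam r).+1) f i.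
Proof.
move=> k0; elim: l => [|l IH] kl.
  by rewrite (_ : k = 1%N) ?offset0 ?[in RHS]big_geq // ?big_geq //; lia.
have [->|kl'] := eqVneq k l.+2; first by rewrite !big_geq.
rewrite [in RHS]big_nat_recr /=; last by lia.
rewrite -IH; last by lia.
rewrite -big_cat_nat // ltnS; last exact/leq_offset.
by apply: leq_offset; lia.
Qed.

(** * Values of rational functions *)

Section RegularValues.
Variables (F : fieldType) (n : nat) (A : algType F).
Variables (D : n.-tuple F -> Prop) (pt : n.-tuple F).
Implicit Types (c : n.-tuple F -> F) (psi : n.-tuple F -> A) (v : F) (E : A).

(** This is [regular_value] for functions with values in an arbitrary algebra. *)
Definition value_at psi E : Prop :=
  exists (d : {mpoly F[n]}) (N : nat) (p : 'I_N -> {mpoly F[n]}) (h : 'I_N -> A),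
  let P x := \sum_(i < N) (p i).@[tnth x] *: h i in
  [/\ d.@[tnth pt] != 0,
      forall x, D x -> d.@[tnth x] *: psi x = P x
    & E = (d.@[tnth pt])^-1 *: P pt].

(** The coefficients of the factors are handled separately because they can be
    divided, which [value_at] does not allow. *)
Definition scalar_value_at c v : Prop :=
  exists d p : {mpoly F[n]},
  [/\ d.@[tnth pt] != 0,
      forall x, D x -> d.@[tnth x] * c x = p.@[tnth x]
    & d.@[tnth pt] * v = p.@[tnth pt]].

(** The numerator of a product of functions is a sum over pairs, and that of a sum
    of functions a sum over a disjoint union. *)
Lemma value_fin (I : finType) (d : {mpoly F[n]}) (p : I -> {mpoly F[n]})
    (h : I -> A) psi E : d.@[tnth pt] != 0 ->
    (forall x, D x -> d.@[tnth x] *: psi x = \sum_i (p i).@[tnth x] *: h i) ->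
    d.@[tnth pt] *: E = \sum_i (p i).@[tnth pt] *: h i ->
  value_at psi E.
Proof.
move=> d0 dP dE; exists d, #|I|, (p \o enum_val), (h \o enum_val).
have sumE x : \sum_(i < #|I|) ((p \o enum_val) i).@[tnth x] *: (h \o enum_val) i =
    \sum_i (p i).@[tnth x] *: h i.
  by rewrite [RHS](reindex _ (onW_bij _ (enum_val_bij I))).
split=> // [x Dx|]; first by rewrite sumE dP.
by rewrite sumE -dE scalerA mulVf // scale1r.
Qed.

Lemma value_scalar c v : scalar_value_at c v -> value_at (fun x => (c x)%:A) v%:A.
Proof.
case=> d [p [d0 dc dv]].
apply: (@value_fin unit d (fun=> p) (fun=> 1)) => // [x Dx|].
  by rewrite big_const card_unit /= addr0 scalerA dc.
by rewrite big_const card_unit /= addr0 scalerA dv.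
Qed.

Lemma value_mul psi psi' E E' : value_at psi E -> value_at psi' E' ->
  value_at (fun x => psi x * psi' x) (E * E').
Proof.
case=> d [N [p [h [d0 dP ->]]]] [d' [N' [p' [h' [d0' dP' ->]]]]].
have PP x : (\sum_(i < N) (p i).@[tnth x] *: h i) *
      (\sum_(i < N') (p' i).@[tnth x] *: h' i) =
    \sum_(ij : 'I_N * 'I_N') (p ij.1 * p' ij.2).@[tnth x] *: (h ij.1 * h' ij.2).
  rewrite big_distrlr /= pair_big /=; apply: eq_bigr => ij _.
  by rewrite mevalM -scalerAl -scalerAr scalerA.
apply: (@value_fin _ (d * d') (fun ij => p ij.1 * p' ij.2)
          (fun ij => h ij.1 * h' ij.2)).
- by rewrite mevalM mulf_neq0.
- by move=> x Dx; rewrite mevalM -PP -dP // -dP' // -scalerAl -scalerAr scalerA.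
rewrite mevalM -PP -scalerAl -scalerAr !scalerA [X in X *: _](_ : _ = 1) ?scale1r //.
by field; rewrite d0 d0'.
Qed.

Lemma value_cst E : value_at (fun=> E) E.
Proof.
apply: (@value_fin unit 1 (fun=> 1) (fun=> E)); rewrite ?meval1 ?oner_neq0 // => *.
all: by rewrite big_const card_unit /= addr0 ?meval1.
Qed.

Lemma value_add psi psi' E E' : value_at psi E -> value_at psi' E' ->
  value_at (fun x => psi x + psi' x) (E + E').
Proof.
case=> d [N [p [h [d0 dP ->]]]] [d' [N' [p' [h' [d0' dP' ->]]]]].
pose P (i : 'I_N + 'I_N') := match i with inl i => d' * p i | inr i => d * p' i end.
pose h'' (i : 'I_N + 'I_N') := match i with inl i => h i | inr i => h' i end.
have PP x : d'.@[tnth x] *: (\sum_(i < N) (p i).@[tnth x] *: h i) +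
      d.@[tnth x] *: (\sum_(i < N') (p' i).@[tnth x] *: h' i) =
    \sum_i (P i).@[tnth x] *: h'' i.
  rewrite big_sumType /= !scaler_sumr; congr (_ + _); apply: eq_bigr => i _;
    by rewrite mevalM scalerA.
apply: (@value_fin _ (d * d') P h'').
- by rewrite mevalM mulf_neq0.
- move=> x Dx; rewrite mevalM -PP -dP // -dP' // scalerDr !scalerA.
  by rewrite [d.@[_] * _]mulrC.
rewrite mevalM -PP scalerDr !scalerA mulrAC divff // mul1r -mulrA divff //.
by rewrite mulr1.
Qed.

Lemma value_ext psi psi' E : (forall x, D x -> psi x = psi' x) ->
  value_at psi E -> value_at psi' E.
Proof.
by move=> ee [d [N [p [h [d0 dP dE]]]]]; exists d, N, p, h; split=> // x Dx; rewrite -ee ?dP.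
Qed.

Lemma value_prod (f : nat -> n.-tuple F -> A) (E : nat -> A) a b :
    (forall i, (a <= i < b)%N -> value_at (f i) (E i)) ->
  value_at (fun x => \prod_(a <= i < b) f i x) (\prod_(a <= i < b) E i).
Proof.
move=> fE; have [ba|/ltnW ab] := leqP b a.
  by rewrite big_geq //; apply: value_ext (value_cst 1) => x _; rewrite big_geq.
rewrite -(subnKC ab) in fE *; elim: (b - a)%N fE => [|m IH] fE.
  rewrite addn0 big_geq //.
  by apply: value_ext (value_cst 1) => x _; rewrite big_geq.
rewrite addnS big_nat_recr ?leq_addr //=.
apply: (@value_ext (fun x => (\prod_(a <= i < a + m) f i x) * f (a + m)%N x)).
  by move=> x _; rewrite big_nat_recr ?leq_addr.
apply: value_mul; last by apply: fE; lia.
by apply: IH => i im; apply: fE; lia.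
Qed.

Lemma scalar_cst v : scalar_value_at (fun=> v) v.
Proof. by exists 1, v%:MP; rewrite meval1 oner_neq0 !mul1r; split=> // *; rewrite ?mevalC ?meval1 ?mul1r. Qed.

Lemma scalar_coord (i : 'I_n) : scalar_value_at (fun x => tnth x i) (tnth pt i).
Proof.
exists 1, 'X_i; rewrite meval1 oner_neq0 !mul1r mevalXU.
by split=> // *; rewrite mevalXU meval1 mul1r.
Qed.

Lemma scalar_sub c c' v v' : scalar_value_at c v -> scalar_value_at c' v' ->
  scalar_value_at (fun x => c x - c' x) (v - v').
Proof.
case=> d [p [d0 dc dv]] [d' [p' [d0' dc' dv']]].
exists (d * d'), (d' * p - d * p'); rewrite mevalB !mevalM mulf_neq0 // -dv -dv'.
by split=> // [x Dx|]; rewrite ?mevalB ?mevalM -?dc -?dc' //; ring.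
Qed.

Lemma scalar_div c c' v v' : scalar_value_at c v -> scalar_value_at c' v' ->
    v' != 0 -> (forall x, D x -> c' x != 0) ->
  scalar_value_at (fun x => c x / c' x) (v / v').
Proof.
case=> d [p [d0 dc dv]] [d' [p' [d0' dc' dv']]] v0 c0.
exists (d * p'), (d' * p); rewrite !mevalM -dv -dv' !mulf_neq0 //.
split=> // [x Dx|]; last by field.
by rewrite !mevalM -dc // -dc' //; field; exact: c0.
Qed.

End RegularValues.

(** * Uniqueness of the value at the content point *)

Section Density.
Variables (F : fieldType) (q : F).
Hypotheses (q0 : q != 0) (q_root : forall m, (0 < m)%N -> q ^+ m != 1).

Lemma expz_inj (a b : int) : q ^ a = q ^ b -> a = b.
Proof.
wlog ab : a b / a <= b.
  by move=> W e; have [ab|/ltW ba] := leP a b; [exact: W | apply/esym/W].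
move=> e; have : q ^ (b - a) = 1 by rewrite expfzDr // -e -expfzDr // subrr expr0z.
have [m mE] : exists m : nat, b - a = m%:Z by exists `|b - a|%N; lia.
rewrite mE -exprnP; case: m mE => [|m] mE; first by lia.
by move=> qm; have := q_root (ltn0Sn m); rewrite qm eqxx.
Qed.

(** The row of the values at [w] is a linear combination of the rows of the values
    at finitely many [z t]: a combination of the polynomials that vanishes at more
    points than its degree is zero, so that it vanishes at [w], too. *)
Lemma poly_relation (V : lmodType F) N (P : 'I_N -> {poly F}) (h : 'I_N -> V)
    (z : nat -> F) w : injective z ->
  (forall t, \sum_i (P i).[z t] *: h i = 0) -> \sum_i (P i).[w] *: h i = 0.
Proof.
move=> z_inj zP; pose M := (\max_i size (P i))%N.
pose B := \matrix_(t < M, i < N) (P i).[z t].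
have : (\row_i (P i).[w] <= B)%MS.
  rewrite submxE; apply/eqP/rowP => j; rewrite !mxE.
  pose Q := \sum_i (cokermx B i j) *: P i.
  have QE x : Q.[x] = \sum_i (P i).[x] * cokermx B i j.
    by rewrite horner_sum; apply: eq_bigr => i _; rewrite hornerZ mulrC.
  rewrite (eq_bigr (fun i => (P i).[w] * cokermx B i j)) => [|i _]; last by rewrite !mxE.
  rewrite -QE; suff -> : Q = 0 by rewrite horner0.
  apply/eqP; apply: contraT => Q0.
  have : (size [seq z t | t <- iota 0 M] < size Q)%N.
    apply: max_poly_roots => //; last by rewrite map_inj_uniq ?iota_uniq.
    apply/allP => x /mapP[t]; rewrite mem_iota add0n => /andP[_ tM] ->{x}.
    have BE : (B *m cokermx B) (Ordinal tM) j = 0 by rewrite mulmx_coker mxE.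
    rewrite rootE QE; apply/eqP; rewrite -[RHS]BE [RHS]mxE.
    by apply: eq_bigr => i _; rewrite [B _ _]mxE.
  rewrite size_map size_iota ltnNge (leq_trans (size_sum _ _ _)) //.
  apply/bigmax_leqP => i _; apply: leq_trans (size_scale_leq _ _) _.
  exact: leq_bigmax.
case/submxP => L LE.
have PE i : (P i).[w] = \sum_t L 0 t * (P i).[z t].
  have := congr1 (fun C : 'rV_N => C 0 i) LE; rewrite !mxE => ->.
  by apply: eq_bigr => t _; rewrite !mxE.
rewrite (eq_bigr (fun i => \sum_(t < M) L 0 t *: ((P i).[z t] *: h i))).
  rewrite exchange_big /= big1 // => t _.
  by rewrite -scaler_sumr zP scaler0.
by move=> i _; rewrite PE scaler_suml; apply: eq_bigr => t _; rewrite scalerA.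
Qed.

Variables (n : nat) (lam : diagram).
Hypotheses (lam_diag : is_diagram lam) (lam_degree : degree lam = n).

Definition domain (x : n.-tuple F) : Prop := F_lambda q lam x /\ generic x.

(** This curve runs in F_lambda and passes through the content point at z = 1.  At
    z = q^M its coordinates are the powers of q with exponents c_k + M r, with r
    the row of k, and these are distinct if M is large. *)
Definition curve z : n.-tuple F :=
  [tuple q ^ content lam i.+1 * z ^+ row_of lam i.+1 | i < n].

Lemma pcoord_curve z k : (0 < k <= n)%N ->
  pcoord (curve z) k = q ^ content lam k * z ^+ row_of lam k.
Proof.
case: k => // k kn; rewrite /pcoord /=.
by rewrite -(tnth_nth 0 (curve z) (Ordinal kn)) tnth_mktuple.
Qed.

Lemma curve1 : curve 1 = content_point q n lam.
Proof. by apply: eq_from_tnth => i; rewrite !tnth_mktuple expr1n mulr1. Qed.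

Lemma curve_domain : exists M0, forall M, (M0 <= M)%N -> domain (curve (q ^+ M)).
Proof.
(* Two contents differ by at most 2 B, so for M > 2 B the exponent c_k + M r
   determines r, and then c_k. *)
pose B := (\sum_(i < n) absz (content lam i.+1))%N; exists B.*2.+1 => M MB.
have cB (i : 'I_n) : (absz (content lam i.+1) <= B)%N.
  by rewrite /B (bigD1 i) //= leq_addr.
split; [|split].
- move=> k l kn ln rkl; rewrite !pcoord_curve // rkl.
  by rewrite -mulrA; congr (_ * _); exact: mulrC.
- apply/tuple_uniqP => i j; rewrite !tnth_mktuple -!exprM !exprnP -!expfzDr //.
  move=> /expz_inj e; have ci := cB i; have cj := cB j.
  have rij : row_of lam i.+1 = row_of lam j.+1.
    have [rr|rr|//] := ltngtP (row_of lam i.+1) (row_of lam j.+1).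
      have : (M * (row_of lam i.+1).+1 <= M * row_of lam j.+1)%N by rewrite leq_mul.
      by rewrite mulnS; lia.
    have : (M * (row_of lam j.+1).+1 <= M * row_of lam i.+1)%N by rewrite leq_mul.
    by rewrite mulnS; lia.
  apply/val_inj/succn_inj/(content_inj (lam := lam)); rewrite ?lam_degree //=.
  by rewrite rij in e; lia.
apply/negP; case/tnthP=> i /esym/eqP; rewrite tnth_mktuple mulf_eq0 expfz_eq0 (negPf q0).
by rewrite andbF /= expf_eq0 expf_eq0 (negPf q0) !andbF.
Qed.

Lemma curve_poly (p : {mpoly F[n]}) :
  exists P : {poly F}, forall z, P.[z] = p.@[tnth (curve z)].
Proof.
exists (\sum_(m <- msupp p) p@_m *:
  \prod_(i < n) ((q ^ content lam i.+1)%:P * 'X ^+ row_of lam i.+1) ^+ m i) => z.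
rewrite mevalE horner_sum; apply: eq_bigr => m _; rewrite hornerZ; congr (_ * _).
rewrite horner_prod; apply: eq_bigr => i _.
by rewrite horner_exp hornerM hornerC hornerXn tnth_mktuple.
Qed.

(** The content point belongs to the closure of the generic points of
    F_lambda, so a rational function has at most one value there. *)
Lemma value_unique (A : algType F) (psi : n.-tuple F -> A) E E' :
  value_at domain (content_point q n lam) psi E ->
  value_at domain (content_point q n lam) psi E' -> E = E'.
Proof.
rewrite -curve1 => -[d [N [p [h [d0 dP ->]]]]] [d' [N' [p' [h' [d0' dP' ->]]]]].
have [M0 M0P] := curve_domain.
have [Q QE] := choice curve_poly.
pose P (i : 'I_(N + N')) := match split i with
  inl i => Q (d' * p i) | inr i => - Q (d * p' i) end.
pose h'' (i : 'I_(N + N')) := match split i with inl i => h i | inr i => h' i end.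
have PE z : \sum_i (P i).[z] *: h'' i =
    d'.@[tnth (curve z)] *: (\sum_(i < N) (p i).@[tnth (curve z)] *: h i) -
    d.@[tnth (curve z)] *: (\sum_(i < N') (p' i).@[tnth (curve z)] *: h' i).
  rewrite big_split_ord /= !scaler_sumr -sumrN /P /h''.
  congr (_ + _); apply: eq_bigr => i _.
    by rewrite (unsplitK (inl i)) QE mevalM scalerA.
  by rewrite (unsplitK (inr i)) hornerN QE mevalM scaleNr scalerA.
have z_inj : injective (fun t => q ^+ (M0 + t)).
  move=> t t' /= e; apply/eqP; rewrite -(eqn_add2l M0); apply/eqP.
  by have := @expz_inj (M0 + t)%N (M0 + t')%N e; case.
have zP t : \sum_i (P i).[q ^+ (M0 + t)] *: h'' i = 0.
  have Dt : domain (curve (q ^+ (M0 + t))) by apply/M0P/leq_addr.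
  rewrite PE -(dP _ Dt) -(dP' _ Dt) !scalerA.
  by rewrite mulrC subrr.
have := poly_relation 1 z_inj zP; rewrite PE => /eqP; rewrite subr_eq0 => /eqP e.
apply: (scalerI (mulf_neq0 d0 d0')); rewrite !scalerA mulrAC divff // mul1r e.
by rewrite -mulrA divff // mulr1.
Qed.

End Density.

(** * The product on F_lambda without poles *)

Section Replacement.
Variables (F : fieldType) (q : F) (n : nat) (A : algType F) (T : nat -> A).
Hypotheses (T_rel : hecke_rel q n T).
Hypothesis (T_out : forall k, ~~ (0 < k < n)%N -> T k = 0).
Hypotheses (q1 : 1 - q != 0) (q2 : 1 + q != 0).
Variable lam : diagram.
Hypothesis lam_cher : cherednik lam.
Hypothesis lam_degree : degree lam = n.
Let lam_diag : is_diagram lam := proj1 lam_cher.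

Local Notation S := (offset lam).
Local Notation row := (row_of lam).
Local Notation ct := (content lam).

(** The product over P_kl in the special order. *)
Definition block (G : nat -> nat -> A) k l : A :=
  if same_end lam k l then
    \prod_((S k.-1).+1 <= i < (S k).+1) \prod_((S l.-1).+1 <= j < (S l).+1) G i j
  else
    \prod_((S l.-1).+1 <= j < (S l).+1) \prod_((S k.-1).+1 <= i < (S k).+1) G i j.

Section Point.
Variable X : nat -> F.

Local Notation fac := (fac q T X).
Local Notation merged := (merged q T X).

(** The factors without poles that replace those of phi_0.  A singular pair has no
    neighbour to be merged with only if its boxes are the leftmost ones of two
    parallel rows; then the factor of delta_lambda cancels the pole. *)
Definition regular_factor i j : A :=
  if row i == row j then fac i j
  else if same_end lam (row i) (row j) then
    if ct i == ct j then
      if leftmost lam j then (1 - X j / X i) *: fac i j else merged true i j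
    else if ct i == ct j + 1 then 1 else fac i j
  else if ct i == ct j then merged false i j
  else if (ct i == ct j + 1) && ~~ leftmost lam i then 1 else fac i j.

Definition delta_factor i j : F :=
  if [&& (i < j)%N, leftmost lam i, leftmost lam j & parallel lam (row i) (row j)]
  then 1 - X j / X i else 1.

Hypothesis X_neq0 : forall i, (0 < i <= n)%N -> X i != 0.
Hypothesis X_inj : forall i j, (0 < i)%N -> (i < j <= n)%N -> X i != X j.
Hypothesis X_row : forall i, (0 < i < n)%N -> row i = row i.+1 -> X i.+1 = q * X i.

Local Notation G := regular_factor.
Local Notation w := delta_factor.

Lemma offset_n r : (r <= size lam)%N -> (S r <= n)%N.
Proof. by move=> rs; rewrite -lam_degree; apply: leq_offset. Qed.

Lemma row_step r i : (0 < r <= size lam)%N -> (S r.-1 < i < S r)%N ->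
  X i.+1 = q * X i.
Proof.
move=> rs ir; have rn : (S r <= n)%N by apply: offset_n; lia.
apply: X_row; first by lia.
by rewrite !(row_ofE (r := r)) // /in_row; lia.
Qed.

(** Since rows k and l end on the same diagonal and row l begins weakly to the
    left, row l contains exactly one [j] with the content of [i]. *)
Lemma cross_regular k l i R : (0 < k)%N -> (k < l <= size lam)%N ->
    same_end lam k l -> in_row lam k i ->
    (forall j, (S l.-1 < j < S l)%N -> T (j - i) * R = q *: R) ->
  (\prod_((S l.-1).+1 <= j < (S l).+1) w i j) *: (cross q T X (S l.-1) (S l) i * R) =
  \prod_((S l.-1).+1 <= j < (S l).+1) G i j * R.
Proof.
move=> k0 kl kle ik RT.
have ks : (0 < k <= size lam)%N by lia.
have ls : (0 < l <= size lam)%N by lia.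
have ri := row_ofE ks ik; have ci := contentE ks ik.
have kS : (S k <= S l.-1)%N by apply: leq_offset; lia.
have ln : (S l <= n)%N by apply: offset_n; lia.
have kl' : (k <= l <= size lam)%N by lia.
have [|[be al]] := rows_order lam_cher k0 kl'.
  by move: kle => /eqP; rewrite -/(beta lam k) -/(beta lam l) => ->; rewrite ltxx.
have Lk := row_lenE lam_diag ks; have Ll := row_lenE lam_diag ls.
have Sk := offset_pred lam (proj1 (andP ks)); have Sl := offset_pred lam (proj1 (andP ls)).
have [i1 i2] := andP ik.
have jrow j : (S l.-1 < j <= S l)%N ->
    [/\ row j = l, ct j = alpha lam l + (j - (S l.-1).+1)%N%:Z,
       leftmost lam j = (j == (S l.-1).+1) & (i < j)%N].
  by move=> jl; rewrite (row_ofE ls jl) (contentE ls jl) (leftmostE ls jl); split=> //; lia.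
have GE j : (S l.-1 < j <= S l)%N -> G i j =
    if ct i == ct j then
      if j == (S l.-1).+1 then (1 - X j / X i) *: fac i j else merged true i j
    else if ct i == ct j + 1 then 1 else fac i j.
  move=> jl; have [rj cj lj ij] := jrow j jl.
  by rewrite /regular_factor ri rj kle lj ifF //; lia.
pose j := ((S l.-1).+1 + absz (ct i - alpha lam l))%N.
have jl : (S l.-1 < j <= S l)%N by rewrite /j; lia.
have [rj cj lj ij] := jrow j jl.
have cij : ct i = ct j by rewrite cj /j; lia.
have eqj j' : (S l.-1 < j' <= S l)%N -> (ct i == ct j') = (j' == j).
  by move=> jl'; have [_ -> _ _] := jrow _ jl'; rewrite cij cj; apply/eqP/eqP; lia.
have eqj1 j' : (S l.-1 < j' <= S l)%N -> (ct i == ct j' + 1) = (j'.+1 == j).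
  by move=> jl'; have [_ -> _ _] := jrow _ jl'; rewrite cij cj; apply/eqP/eqP; lia.
have wE j' : (S l.-1 < j' <= S l)%N -> j' != j -> w i j' = 1.
  move=> jl' jj; have [rj' cj' lj' ij'] := jrow _ jl'.
  rewrite /delta_factor (leftmostE ks ik) lj' ri rj' parallelE ifF //.
  apply: contraNF jj => /and4P[_ /eqP iE /eqP j'E /andP[/eqP aE _]].
  by rewrite -eqj // cj' ci iE j'E aE !subnn.
have [jE|jE] := eqVneq j (S l.-1).+1; last first.
  rewrite (cross_merge T_rel T_out q1 q2 X_neq0 X_inj (j := j)) //; try lia.
  - rewrite big_nat big1 ?scale1r => [|j' jl']; last first.
      have [j'E|] := eqVneq j' j; last by apply: wE; lia.
      by rewrite j'E /delta_factor lj (negPf jE) /= !andbF.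
    congr (_ * _); apply: eq_big_nat => j' jl'; rewrite GE // eqj // eqj1 //.
    by case: eqP => // ->; rewrite (negPf jE).
  - by have := @row_step l j.-1 ls; rewrite prednK; [apply; lia | lia].
  - by apply: RT; lia.
have bl (B : pzRingType) (f : nat -> B) : \prod_((S l.-1).+1 <= j' < (S l).+1) f j' =
    f (S l.-1).+1 * \prod_((S l.-1).+2 <= j' < (S l).+1) f j'.
  by rewrite big_ltn //; lia.
rewrite /cross !bl.
rewrite [X in _ * X *: _]big_nat [X in _ * X *: _]big1 ?mulr1; last first.
  by move=> j' jl'; apply: wE; lia.
have j0l : (S l.-1 < (S l.-1).+1 <= S l)%N by lia.
rewrite !scalerAl (GE _ j0l) (eqj _ j0l) jE !eqxx; congr (_ * _ * _).
  congr (_ *: _); rewrite -jE /delta_factor ij (leftmostE ks ik) lj jE eqxx -jE ri rj.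
  rewrite parallelE be eqxx !andbT ifT //; apply/andP.
  by move: cij; rewrite ci cj jE; split; apply/eqP; lia.
by apply: eq_big_nat => j' jl'; rewrite GE ?eqj ?eqj1 ?ifF //; lia.
Qed.

Lemma cross_same_row l i : (0 < l <= size lam)%N -> in_row lam l i ->
  \prod_((S l.-1).+1 <= j < (S l).+1) w i j = 1 /\
  \prod_((S l.-1).+1 <= j < (S l).+1) G i j = cross q T X (S l.-1) (S l) i.
Proof.
move=> ls il; have ri := row_ofE ls il; split.
  rewrite big_nat big1 // => j jl; have jr : in_row lam l j by exact: jl.
  rewrite /delta_factor (leftmostE ls il) (leftmostE ls jr) ifF //.
  by apply/negP => /and4P[]; lia.
apply: eq_big_nat => j jl; have jr : in_row lam l j by exact: jl.
by rewrite /regular_factor ri (row_ofE ls jr) eqxx.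
Qed.

(** For the rows above row l with the same end, the crossings are replaced from
    the left, since the remaining crossings stay divisible by the factors of
    the neighbours in row l. *)
Lemma crossings_regular k l : (0 < k)%N -> (k <= l <= size lam)%N ->
    (forall k', (k <= k' <= l)%N -> same_end lam k' l) ->
  (\prod_((S k.-1).+1 <= i < (S l).+1)
     \prod_((S l.-1).+1 <= j < (S l).+1) w i j) *:
     crossings q T X (S l.-1) (S l) (S k.-1).+1 =
  \prod_((S k.-1).+1 <= i < (S l).+1) \prod_((S l.-1).+1 <= j < (S l).+1) G i j.
Proof.
move=> k0 kl kle.
have ls : (0 < l <= size lam)%N by lia.
have ln : (S l <= n)%N by apply: offset_n; lia.
suff H d i : (S l - i = d)%N -> (S k.-1 < i)%N ->
    (\prod_(i <= i' < (S l).+1) \prod_((S l.-1).+1 <= j < (S l).+1) w i' j) *: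
       crossings q T X (S l.-1) (S l) i =
    \prod_(i <= i' < (S l).+1) \prod_((S l.-1).+1 <= j < (S l).+1) G i' j.
  exact: H (erefl _) (leqnn _).
elim: d i => [|d IH] i id ki.
  have [->|il] := eqVneq i (S l); last first.
    by rewrite /crossings !big_geq ?scale1r //; lia.
  rewrite /crossings !big_nat1.
  have [|wE GE] := @cross_same_row l (S l) ls; last by rewrite wE GE scale1r.
  by rewrite /in_row leqnn (offset_pred lam (proj1 (andP ls))) -[X in (X < _)%N]addn0 ltn_add2l row_len_gt0.
rewrite /crossings !(@big_ltn _ _ _ i); [|lia..].
rewrite -/(crossings q T X (S l.-1) (S l) i.+1).
have {}IH := IH i.+1.
have [r rs ir] : exists2 r, (0 < r <= size lam)%N & in_row lam r i.
  by apply: in_row_exists; rewrite lam_degree; lia.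
have [i1 i2] := andP ir.
have kr : (k <= r)%N.
  rewrite leqNgt; apply/negP => rk.
  have : (S r <= S k.-1)%N by apply: leq_offset; lia.
  by lia.
have rl : (r <= l)%N.
  rewrite leqNgt; apply/negP => lr.
  have : (S l <= S r.-1)%N by apply: leq_offset; lia.
  by lia.
rewrite -IH; [|lia..].
rewrite -scalerA scalerAr [RHS](_ : _ = (\prod_(i.+1 <= i' < (S l).+1)
     \prod_((S l.-1).+1 <= j < (S l).+1) w i' j) *:
     ((\prod_((S l.-1).+1 <= j < (S l).+1) G i j) *
       crossings q T X (S l.-1) (S l) i.+1)); last by rewrite -scalerAr.
rewrite -scalerAr scalerA mulrC -scalerA; congr (_ *: _).
have [rE|rl'] := eqVneq r l.
  by rewrite rE in ir; have [-> ->] := cross_same_row ls ir; rewrite scale1r.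
apply: (@cross_regular r) => //; try lia.
  by apply: kle; lia.
move=> j jl.
have lr : (S r <= S l.-1)%N by apply: leq_offset; lia.
rewrite (_ : j - i = (j - i.+1).+1)%N; last by lia.
apply: (crossings_div T_rel T_out q1 q2 X_neq0 X_inj) => //; try lia.
by move=> j' jl'; apply: (row_step ls).
Qed.

(** Row k ends to the right of row l, so that the [i] with the content of [j], if
    it exists, has a right neighbour; it exists if [j] is not to the left of
    row k. *)
Lemma col_regular k l j L : (0 < k)%N -> (k < l <= size lam)%N ->
    ~~ same_end lam k l -> in_row lam l j ->
    (forall i, (S k.-1 < i < S k)%N -> L * T (j - i).-1 = q *: L) ->
  L * col q T X (S k.-1) (S k) j = L * \prod_((S k.-1).+1 <= i < (S k).+1) G i j.
Proof.
move=> k0 kl kle jl LT.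
have ks : (0 < k <= size lam)%N by lia.
have ls : (0 < l <= size lam)%N by lia.
have rj := row_ofE ls jl; have cj := contentE ls jl.
have kS : (S k <= S l.-1)%N by apply: leq_offset; lia.
have ln : (S l <= n)%N by apply: offset_n; lia.
have kl' : (k <= l <= size lam)%N by lia.
have be : beta lam l < beta lam k.
  have [//|[be _]] := rows_order lam_cher k0 kl'.
  by move: kle; rewrite same_endE be eqxx.
have Lk := row_lenE lam_diag ks; have Ll := row_lenE lam_diag ls.
have Sk := offset_pred lam (proj1 (andP ks)); have Sl := offset_pred lam (proj1 (andP ls)).
have [j1 j2] := andP jl.
have irow i : (S k.-1 < i <= S k)%N ->
    [/\ row i = k, ct i = alpha lam k + (i - (S k.-1).+1)%N%:Z,
       leftmost lam i = (i == (S k.-1).+1) & (i < j)%N].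
  by move=> ik; rewrite (row_ofE ks ik) (contentE ks ik) (leftmostE ks ik); split=> //; lia.
have GE i : (S k.-1 < i <= S k)%N -> G i j =
    if ct i == ct j then merged false i j
    else if (ct i == ct j + 1) && (i != (S k.-1).+1) then 1 else fac i j.
  move=> ik; have [ri ci li ij] := irow i ik.
  by rewrite /regular_factor ri rj (negPf kle) li ifF //; lia.
have [ca|ca] := ltP (ct j) (alpha lam k).
  congr (_ * _); apply: eq_big_nat => i ik; rewrite GE //.
  by have [_ -> _ _] := irow _ ik; rewrite !ifF //; lia.
pose i := ((S k.-1).+1 + absz (ct j - alpha lam k))%N.
have ik : (S k.-1 < i < S k)%N by rewrite /i; lia.
have ik' : (S k.-1 < i <= S k)%N by lia.
have [ri ci li ij] := irow i ik'.
have cij : ct i = ct j by rewrite ci /i; lia.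
rewrite (col_merge T_rel T_out q1 q2 X_neq0 X_inj (i := i)) //; first last.
- exact: LT.
- exact: (row_step ks).
- by lia.
congr (_ * _); apply: eq_big_nat => i' ik1; rewrite GE //.
have [_ ci' _ _] := irow _ ik1.
have -> : (ct i' == ct j) = (i' == i) by rewrite ci' -cij ci; apply/eqP/eqP; lia.
suff -> : (ct i' == ct j + 1) && (i' != (S k.-1).+1) = (i' == i.+1).
  by case: eqP => [->|].
by rewrite ci' -cij ci; apply/andP/eqP => [[/eqP ? ?]|?]; [|split]; lia.
Qed.

(** For the rows above row l with a different end, the columns are replaced from
    the right, since the product to the left of a column stays divisible by
    the factors of the neighbours in the crossed row. *)
Lemma cols_regular k l L : (0 < k)%N -> (k < l <= size lam)%N ->
    ~~ same_end lam k l ->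
    (forall i, (S k.-1 < i < S k)%N -> L * T (S l.-1 - i)%N = q *: L) ->
  L * \prod_((S l.-1).+1 <= j < (S l).+1) col q T X (S k.-1) (S k) j =
  L * block G k l.
Proof.
move=> k0 kl kle LT; rewrite /block (negPf kle).
have ks : (0 < k <= size lam)%N by lia.
have ln : (S l <= n)%N by apply: offset_n; lia.
have kS : (S k <= S l.-1)%N by apply: leq_offset; lia.
suff H J : (S l.-1 <= J <= S l)%N ->
    L * \prod_((S l.-1).+1 <= j < J.+1) col q T X (S k.-1) (S k) j =
    L * \prod_((S l.-1).+1 <= j < J.+1) \prod_((S k.-1).+1 <= i < (S k).+1) G i j.
  by apply: H; rewrite leqnn andbT; apply: leq_offset; lia.
elim: J => [|J IH] Jl; first by rewrite !big_geq.
have [JE|Jl'] := eqVneq (S l.-1) J.+1; first by rewrite !big_geq // JE.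
rewrite !(@big_nat_recr _ _ _ J.+1) /=; [|lia..].
rewrite !mulrA -IH; last by lia.
apply: (@col_regular k l) => // [|i ik]; first by rewrite /in_row; lia.
rewrite (_ : (J.+1 - i).-1 = J - i)%N; last by lia.
apply: (cols_div T_rel T_out q1 q2 X_neq0 X_inj) => //; try lia.
- exact: (row_step ks).
- exact: LT.
Qed.

End Point.
End Replacement.

Section Total.
Variables (F : fieldType) (q : F) (n : nat) (A : algType F) (T : nat -> A).
Hypotheses (T_rel : hecke_rel q n T).
Hypothesis (T_out : forall k, ~~ (0 < k < n)%N -> T k = 0).
Hypotheses (q1 : 1 - q != 0) (q2 : 1 + q != 0).
Variable lam : diagram.
Hypothesis lam_cher : cherednik lam.
Hypothesis lam_degree : degree lam = n.
Let lam_diag : is_diagram lam := proj1 lam_cher.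

Local Notation S := (offset lam).
Local Notation row := (row_of lam).

Variable X : nat -> F.
Hypothesis X_neq0 : forall i, (0 < i <= n)%N -> X i != 0.
Hypothesis X_inj : forall i j, (0 < i)%N -> (i < j <= n)%N -> X i != X j.
Hypothesis X_row : forall i, (0 < i < n)%N -> row i = row i.+1 -> X i.+1 = q * X i.

Local Notation fac := (fac q T X).
Local Notation G := (regular_factor q T lam X).
Local Notation w := (delta_factor lam X).

(** Entries of rows with the end of row l are crossed last, in the order of their
    labels; the rows with another end come first, and there the divisibility on
    the right passes over the preceding blocks because it concerns generators of
    smaller index. *)
Lemma staircase_regular l : (0 < l <= size lam)%N ->
  (\prod_((S l.-1).+1 <= j < (S l).+1) \prod_(1 <= i < (S l).+1) w i j) *:
     staircase q T X (S l) =
  staircase q T X (S l.-1) * \prod_(1 <= k < l.+1) block lam G k l.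
Proof.
move=> ls; have ln : (S l <= n)%N by apply: (offset_n lam_degree); lia.
have ll : (S l.-1 <= S l)%N by apply: leq_offset; lia.
have [k0 [k0l kle]] := same_end_rows lam_cher ls.
have k0S : (S k0.-1 <= S l.-1)%N by apply: leq_offset; lia.
rewrite (staircase_split T_rel T_out _ ll) (@big_cat_nat _ _ _ (S k0.-1).+1 1) //=; last by lia.
rewrite exchange_big /= (@big_cat_nat _ _ _ (S k0.-1).+1 1) //=; last by lia.
rewrite [X in (X * _) *: _]big_nat [X in (X * _) *: _]big1 ?mul1r; last first.
  move=> i ik; rewrite big_nat big1 // => j jl.
  have [r rs ir] : exists2 r, (0 < r <= size lam)%N & in_row lam r i.
    by apply: in_row_exists; rewrite lam_degree; lia.
  have jr : in_row lam l j by exact: jl.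
  have [i1 i2] := andP ir.
  have rk : (r < k0)%N.
    rewrite ltnNge; apply/negP => rk.
    have : (S k0.-1 <= S r.-1)%N by apply: leq_offset; lia.
    by lia.
  rewrite /delta_factor (row_ofE rs ir) (row_ofE ls jr) ifF //.
  apply/negP => /and4P[_ _ _]; rewrite parallelE => /andP[_].
  by rewrite -same_endE kle; lia.
rewrite mulrA scalerAr [X in _ * X](_ : _ =
    \prod_(k0 <= k < l.+1) block lam G k l); last first.
  rewrite -/(crossings q T X (S l.-1) (S l) (S k0.-1).+1).
  rewrite (crossings_regular T_rel T_out) //; first 1 last.
  - by lia.
  - by lia.
  - by move=> k kk; rewrite kle; lia.
  rewrite prod_rows; [|lia..]; apply: eq_big_nat => k kk.
  by rewrite /block kle ?ifT //; lia.
rewrite [in RHS](@big_cat_nat _ _ _ k0) /=; [|lia..].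
rewrite mulrA; congr (_ * _).
rewrite (_ : \prod_(1 <= i < (S k0.-1).+1) _ = \prod_(1 <= k < k0)
   \prod_((S k.-1).+1 <= i < (S k).+1) cross q T X (S l.-1) (S l) i); last first.
  have := @prod_rows lam A (cross q T X (S l.-1) (S l)) 1 k0.-1.
  by rewrite offset0 prednK; [apply; lia|lia].
suff H K : (0 < K <= k0)%N -> staircase q T X (S l.-1) * \prod_(1 <= k < K)
   \prod_((S k.-1).+1 <= i < (S k).+1) cross q T X (S l.-1) (S l) i =
   staircase q T X (S l.-1) * \prod_(1 <= k < K) block lam G k l.
  by apply: H; lia.
elim: K => [|K IH] Kk; first by lia.
have [->|K0] := eqVneq K 0%N; first by rewrite !big_geq.
rewrite !(@big_nat_recr _ _ _ K) /=; [|lia..].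
rewrite !mulrA -IH; last by lia.
rewrite /cross -exchange_prod; last first.
  by move=> i i' j j'; apply: (fac_comm T_rel T_out).
apply: (cols_regular T_rel T_out q1 q2 lam_cher lam_degree X_neq0 X_inj) => //; try lia.
  by rewrite kle; lia.
move=> i ik; rewrite -mulrA.
have Kl : (S K <= S l.-1)%N by apply: leq_offset; lia.
rewrite (_ : _ * T _ = T (S l.-1 - i) * \prod_(1 <= k < K)
   \prod_((S k.-1).+1 <= i < (S k).+1) cross q T X (S l.-1) (S l) i); last first.
  apply/esym/commr_prod_nat => k kK; apply: commr_prod_nat => i' ik'.
  have kK' : (S k <= S K.-1)%N by apply: leq_offset; lia.
  apply: commr_prod_nat => j jl; apply: (T_fac T_rel T_out); apply/implyP; lia.
rewrite mulrA (staircase_div T_rel T_out q1 q2 X_neq0 X_inj) ?scalerAl //; try lia.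
have Ks : (0 < K <= size lam)%N by lia.
by apply: X_row; [lia | rewrite !(row_ofE Ks) // /in_row; lia].
Qed.

Lemma staircase_regular_total r : (r <= size lam)%N ->
  (\prod_(1 <= l < r.+1) \prod_((S l.-1).+1 <= j < (S l).+1)
     \prod_(1 <= i < (S l).+1) w i j) *: staircase q T X (S r) =
  \prod_(1 <= l < r.+1) \prod_(1 <= k < l.+1) block lam G k l.
Proof.
elim: r => [|r IH] rs.
  by rewrite !big_geq // scale1r offset0 /staircase big_geq.
rewrite big_nat_recr //= [in RHS]big_nat_recr //= -IH; last by lia.
by have /= := @staircase_regular r.+1 rs; rewrite -scalerAl => <-; rewrite scalerA.
Qed.

End Total.

(** * The values of the factors at the content point *)

Section Values.
Variables (F : fieldType) (q : F) (n : nat) (A : algType F) (T : nat -> A).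
Hypotheses (q0 : q != 0) (q_root : forall m, (0 < m)%N -> q ^+ m != 1).
Variable lam : diagram.
Hypothesis lam_cher : cherednik lam.
Hypothesis lam_degree : degree lam = n.
Let lam_diag : is_diagram lam := proj1 lam_cher.

Local Notation S := (offset lam).
Local Notation row := (row_of lam).
Local Notation ct := (content lam).
Local Notation br := (bracket q).
Local Notation value := (value_at (domain q lam) (content_point q n lam)).
Local Notation scalar := (scalar_value_at (domain q lam) (content_point q n lam)).

Definition content_factor i j : A :=
  if (i < j)%N then T (j - i)%N + (br (q ^ ct j / q ^ ct i))%:A else 1.

Definition three_terms (e : bool) i j : A :=
  let k := (j - i - 1)%N in
  (if e then T k * T k.+1 else T k.+1 * T k) - q *: T k.+1 - q%:A.

Definition factor_value i j : A :=
  if row i == row j then content_factor i j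
  else if same_end lam (row i) (row j) then
    if ct i == ct j then
      if leftmost lam j then (1 - q)%:A else three_terms true i j
    else if ct i == ct j + 1 then 1 else content_factor i j
  else if ct i == ct j then three_terms false i j
  else if (ct i == ct j + 1) && ~~ leftmost lam i then 1 else content_factor i j.

Lemma domain_row (x : n.-tuple F) i : domain q lam x -> (0 < i < n)%N ->
  row i = row i.+1 -> pcoord x i.+1 = q * pcoord x i.
Proof.
move=> [Fx _] iN rr; have i0 : (0 < i)%N by lia.
have := Fx i.+1 i _ _ (esym rr); rewrite content_next //; last by rewrite lam_degree; lia.
move=> /(_ _ _) H; have {}H : pcoord x i.+1 * q ^ ct i = q ^ (ct i + 1) * pcoord x i.
  by apply: H; lia.
apply: (mulIf (expfz_neq0 (ct i) q0)); rewrite H expfzDr // expr1z; ring.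
Qed.

Lemma scalar_pcoord i : (0 < i <= n)%N -> scalar (fun x => pcoord x i) (q ^ ct i).
Proof.
case: i => // i iN; have := scalar_coord (domain q lam) (content_point q n lam) (Ordinal iN).
rewrite tnth_mktuple; congr scalar_value_at; apply/funext => x.
by rewrite (tnth_nth 0).
Qed.

Lemma scalar_ratio i j : (0 < i <= n)%N -> (0 < j <= n)%N ->
  scalar (fun x => pcoord x j / pcoord x i) (q ^ ct j / q ^ ct i).
Proof.
move=> i0 j0; apply: scalar_div; first exact: scalar_pcoord.
- exact: scalar_pcoord.
- exact: expfz_neq0.
- by move=> x [_ gx]; apply: generic_neq0.
Qed.

Lemma scalar_1ratio i j : (0 < i <= n)%N -> (0 < j <= n)%N ->
  scalar (fun x => 1 - pcoord x j / pcoord x i) (1 - q ^ ct j / q ^ ct i).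
Proof.
by move=> i0 j0; apply: scalar_sub; [exact: scalar_cst | exact: scalar_ratio].
Qed.

Lemma content_ratio1 i j : (1 - q ^ ct j / q ^ ct i == 0) = (ct i == ct j).
Proof.
have qi : q ^ ct i != 0 by exact: expfz_neq0.
rewrite subr_eq0 -(inj_eq (mulIf qi)) mul1r divfK //.
by apply/eqP/eqP => [/(expz_inj q0 q_root)|->].
Qed.

Lemma domain_ratio1 (x : n.-tuple F) i j : domain q lam x -> (0 < i)%N -> (i < j <= n)%N ->
  1 - pcoord x j / pcoord x i != 0.
Proof.
move=> [_ gx] i0 ij; apply: ratio_neq1; last exact: generic_inj.
by apply: generic_neq0 => //; lia.
Qed.

Lemma scalar_over f v i j : (0 < i)%N -> (i < j <= n)%N -> ct i != ct j ->
    scalar f v ->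
  scalar (fun x => f x / (1 - pcoord x j / pcoord x i)) (v / (1 - q ^ ct j / q ^ ct i)).
Proof.
move=> i0 ij cij fv; apply: scalar_div => //.
- by apply: scalar_1ratio; lia.
- by rewrite content_ratio1.
- by move=> x Dx; apply: domain_ratio1.
Qed.

Lemma value_fac i j : (0 < i)%N -> (0 < j <= n)%N -> ((i < j)%N -> ct i != ct j) ->
  value (fun x => fac q T (pcoord x) i j) (content_factor i j).
Proof.
move=> i0 jn cij; rewrite /fac /content_factor; case: ltnP => ij; last exact: value_cst.
apply: value_add; first exact: value_cst.
by apply/value_scalar/scalar_over; [| lia | exact: cij | exact: scalar_cst].
Qed.

Lemma value_scale c v (h : A) : scalar c v -> value (fun x => c x *: h) (v *: h).
Proof.
move=> cv; have := value_mul (value_scalar A cv) (value_cst _ _ h).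
rewrite mulr_algl; congr value_at; apply/funext => x; exact: mulr_algl.
Qed.

(** At the content point the ratio [w] in the merged factor is q^-1, and so
    [(1 - q) / (1 - w)] is [- q]. *)
Lemma value_merged e i j : (0 < i)%N -> (i.+1 < j <= n)%N -> ct i = ct j ->
    (if e then ct j.-1 = ct j - 1 else ct i.+1 = ct i + 1) ->
  value (fun x => merged q T (pcoord x) e i j) (three_terms e i j).
Proof.
move=> i0 ij cij ce; rewrite /merged /three_terms.
pose i' := if e then i else i.+1; pose j' := if e then j.-1 else j.
have ij' : (0 < i')%N /\ (i' < j' <= n)%N by rewrite /i' /j'; case: (e); lia.
have cij' : ct i' = ct j' + 1 by rewrite /i' /j'; case: (e) ce => ->; rewrite cij; ring.
have wE (x : n.-tuple F) : (if e then pcoord x j.-1 / pcoord x i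
    else pcoord x j / pcoord x i.+1) = pcoord x j' / pcoord x i'.
  by rewrite /i' /j'; case: (e).
have cE : q ^ ct j' / q ^ ct i' = q^-1.
  have qj : q ^ ct j' != 0 by exact: expfz_neq0.
  by rewrite cij' expfzDr // expr1z; field; rewrite q0 qj.
have cn : ct i' != ct j' by lia.
have sv f v : scalar f v ->
    scalar (fun x => f x / (1 - pcoord x j' / pcoord x i')) (v / (1 - q^-1)).
  by rewrite -cE; case: ij' => ? ?; exact: scalar_over.
have q1 : 1 - q != 0 by rewrite subr_eq0 eq_sym -(expr1 q) q_root.
rewrite [(- (q *: _))](_ : _ = (0 / (1 - q^-1) - q) *: T (j - i - 1).+1); last first.
  by rewrite mul0r sub0r scaleNr.
rewrite -scaleNr [(- q)%:A](_ : _ = ((1 - q) / (1 - q^-1))%:A); last first.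
  congr (_ *: _); field.
  by rewrite q0 -(opprB 1 q) oppr_eq0.
apply: (@value_ext _ _ _ _ _ (fun x => (if e then T (j - i - 1) * T (j - i - 1).+1
    else T (j - i - 1).+1 * T (j - i - 1)) +
   ((1 - pcoord x j / pcoord x i) / (1 - pcoord x j' / pcoord x i') - q) *:
     T (j - i - 1).+1 + ((1 - q) / (1 - pcoord x j' / pcoord x i'))%:A)).
  by move=> x _; rewrite wE.
apply: value_add; last by apply/value_scalar/sv/scalar_cst.
apply: value_add; first exact: value_cst.
apply: value_scale; apply: scalar_sub; last exact: scalar_cst.
apply: sv; have <- : 1 - q ^ ct j / q ^ ct i = 0.
  by apply/eqP; rewrite content_ratio1 cij.
by apply: scalar_1ratio; lia.
Qed.

Lemma value_regular i j : (0 < i)%N -> (0 < j <= n)%N -> (i <= n)%N ->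
    (row i <= row j)%N ->
  value (fun x => regular_factor q T lam (pcoord x) i j) (factor_value i j).
Proof.
move=> i0 jn iN rij.
have [k ks ik] : exists2 k, (0 < k <= size lam)%N & in_row lam k i.
  by apply: in_row_exists; rewrite lam_degree; lia.
have [l ls jl] : exists2 l, (0 < l <= size lam)%N & in_row lam l j.
  by apply: in_row_exists; rewrite lam_degree; lia.
have ri := row_ofE ks ik; have rj := row_ofE ls jl.
have ci := contentE ks ik; have cj := contentE ls jl.
have li := leftmostE ks ik; have lj := leftmostE ls jl.
have [i1 i2] := andP ik; have [j1 j2] := andP jl.
rewrite /regular_factor /factor_value.
have [rE|rne] := eqVneq (row i) (row j).
  apply: value_fac => // ij; apply/eqP => cE.
  have ijE : i = j by apply: (content_inj (lam := lam)) rE cE; rewrite lam_degree ?i0.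
  by rewrite ijE ltnn in ij.
rewrite ri rj in rij rne *.
have kl : (k < l)%N by lia.
have kS : (S k <= S l.-1)%N by apply: leq_offset; lia.
have ij : (i < j)%N by lia.
have k0 : (0 < k)%N by lia.
have kls : (k <= l <= size lam)%N by lia.
have Lk := row_lenE lam_diag ks; have Ll := row_lenE lam_diag ls.
have Sk := offset_pred lam (proj1 (andP ks)); have Sl := offset_pred lam (proj1 (andP ls)).
have fac_ok : ct i != ct j -> value (fun x => fac q T (pcoord x) i j) (content_factor i j).
  by move=> cij; apply: value_fac.
have be := rows_order lam_cher k0 kls.
case: ifP => kle.
  have [cij|cij] := eqVneq (ct i) (ct j); last first.
    by case: ifP => _; [exact: value_cst | exact: fac_ok].
  have [jE|jE] := boolP (leftmost lam j); last first.
    apply: value_merged => //.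
      by rewrite lj in jE; lia.
    rewrite lj in jE; have jl' : in_row lam l j.-1 by rewrite /in_row; lia.
    by rewrite cj (contentE ls jl'); lia.
  apply: (@value_ext _ _ _ _ _ (fun x =>
      (1 - pcoord x j / pcoord x i) *: T (j - i) + (1 - q)%:A)).
    move=> x Dx; rewrite facE // scalerDr scalerA; congr (_ + _ *: _).
    by rewrite /bracket mulrC divfK //; apply: domain_ratio1 => //; lia.
  rewrite -[X in value _ X]add0r -(scale0r (T (j - i))).
  apply: value_add; last exact: value_cst.
  apply: value_scale; have <- : 1 - q ^ ct j / q ^ ct i = 0.
    by apply/eqP; rewrite content_ratio1 cij.
  by apply: scalar_1ratio; lia.
have {}be : beta lam l < beta lam k.
  by case: be => // -[be _]; move: kle; rewrite same_endE be eqxx.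
have [cij|cij] := eqVneq (ct i) (ct j); last first.
  by case: ifP => _; [exact: value_cst | exact: fac_ok].
have iS : (i < S k)%N by lia.
apply: value_merged => //; first by lia.
have ik' : in_row lam k i.+1 by rewrite /in_row; lia.
by rewrite ci (contentE ks ik'); lia.
Qed.

Lemma value_block k l : (0 < k)%N -> (k <= l <= size lam)%N ->
  value (fun x => block lam (regular_factor q T lam (pcoord x)) k l)
        (block lam factor_value k l).
Proof.
move=> k0 kl; have ln : (S l <= n)%N by apply: offset_n; lia.
have kS : (S k <= S l)%N by apply: leq_offset; lia.
have H i j : (S k.-1 < i <= S k)%N -> (S l.-1 < j <= S l)%N ->
    value (fun x => regular_factor q T lam (pcoord x) i j) (factor_value i j).
  move=> ik jl; apply: value_regular; try lia.
  by rewrite (row_ofE (r := k)) ?(row_ofE (r := l)) //; lia.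
by rewrite /block; case: ifP => _; apply: value_prod => i ii; apply: value_prod => j jj;
  apply: H.
Qed.

(** The value of delta_lambda phi_0 for the diagram of the first [r] rows. *)
Definition value_upto r : A :=
  \prod_(1 <= l < r.+1) \prod_(1 <= k < l.+1) block lam factor_value k l.

Lemma value_upto_value r : (r <= size lam)%N ->
  value (fun x => \prod_(1 <= l < r.+1) \prod_(1 <= k < l.+1)
     block lam (regular_factor q T lam (pcoord x)) k l) (value_upto r).
Proof.
move=> rs; apply: value_prod => l lr; apply: value_prod => k kl.
by apply: value_block; lia.
Qed.

End Values.

(** * The value of delta_lambda phi_0 *)

Section ElambdaValue.
Variables (F : fieldType) (q : F) (n : nat).
Hypotheses (q0 : q != 0) (q_root : forall m, (0 < m)%N -> q ^+ m != 1).
Variable lam : diagram.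
Hypothesis lam_cher : cherednik lam.
Hypothesis lam_degree : degree lam = n.
Let lam_diag : is_diagram lam := proj1 lam_cher.

Local Notation S := (offset lam).
Local Notation row := (row_of lam).
Local Notation value := (value_at (domain q lam) (content_point q n lam)).
Local Notation value_upto := (value_upto q (T q n) lam).

Lemma one_sub_q : 1 - q != 0.
Proof. by rewrite subr_eq0 eq_sym -(expr1 q) q_root. Qed.

Lemma one_add_q : 1 + q != 0.
Proof.
have := q_root (isT : 0 < 2)%N; rewrite -subr_eq0 subr_sqr_1 mulf_eq0 negb_or => /andP[_].
by rewrite addrC.
Qed.

Lemma offset_size : S (size lam) = n.
Proof. exact: lam_degree. Qed.

Lemma delta_prod (x : n.-tuple F) : delta lam x =
  \prod_(1 <= l < (size lam).+1) \prod_((S l.-1).+1 <= j < (S l).+1)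
     \prod_(1 <= i < (S l).+1) delta_factor lam (pcoord x) i j.
Proof.
rewrite /delta /pairs big_filter_cond big_mkcond big_allpairs /=.
have iE : iota 1 n = index_iota 1 n.+1 by rewrite /index_iota subn1.
rewrite iE exchange_big /=.
have := @prod_rows lam F (fun j => \prod_(1 <= i < n.+1) delta_factor lam (pcoord x) i j)
   1 (size lam) isT isT.
rewrite offset0 offset_size => ->; apply: eq_big_nat => l ls.
have ln : (S l <= n)%N by apply: (offset_n lam_degree); lia.
apply: eq_big_nat => j jl.
rewrite (@big_cat_nat _ _ _ (S l).+1 1 n.+1) //=.
rewrite [X in _ * X]big_nat [X in _ * X]big1 ?mulr1 // => i il.
by rewrite /delta_factor ifF //; lia.
Qed.

Lemma domain_regular r (x : n.-tuple F) : domain q lam x -> (r <= size lam)%N ->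
  (\prod_(1 <= l < r.+1) \prod_((S l.-1).+1 <= j < (S l).+1)
     \prod_(1 <= i < (S l).+1) delta_factor lam (pcoord x) i j) *:
     staircase q (T q n) (pcoord x) (S r) =
  \prod_(1 <= l < r.+1) \prod_(1 <= k < l.+1)
     block lam (regular_factor q (T q n) lam (pcoord x)) k l.
Proof.
move=> Dx rs; have [_ gx] := Dx.
apply: (staircase_regular_total (hecke_relT q n) (@T_out _ q n) one_sub_q one_add_q lam_cher lam_degree) => //.
- by move=> i; apply: generic_neq0.
- by move=> i j; apply: generic_inj.
- by move=> i; apply: domain_row.
Qed.

(** On the domain, delta_lambda phi_0 is a product of factors that have a value at the
    content point. *)
Lemma is_E_lambda_value : is_E_lambda lam (value_upto (size lam)).
Proof.
move=> ks ksr.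
have := value_upto_value (A := hecke q n) (T q n) q0 q_root lam_cher lam_degree (leqnn _).
apply: value_ext => x Dx; have [_ gx] := Dx.
rewrite -domain_regular // -delta_prod (reduced_product q ksr gx) offset_size.
by rewrite (staircase_split (hecke_relT q n) (@T_out _ q n) _ (leq0n n)) /staircase big_geq // mul1r.
Qed.

Lemma E_lambda_value : E_lambda q n lam = value_upto (size lam).
Proof.
apply: (@xget_unique _ _ (@is_E_lambda F q n lam)); first exact: is_E_lambda_value.
move=> E' HE'; have [ks ksr] := reduced_word_exists q n.
exact: (value_unique q0 q_root lam_degree (A := hecke q n)
  (HE' ks ksr) (is_E_lambda_value ksr)).
Qed.

(** At generic points this is [staircase_div]; both sides are values of the same
    rational function. *)
Lemma value_upto_div r i : (r <= size lam)%N -> (0 < i < S r)%N -> row i = row i.+1 ->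
  value_upto r * T q n (S r - i) = q *: value_upto r.
Proof.
move=> rs ir rii; have vr := value_upto_value (A := hecke q n) (T q n) q0 q_root lam_cher lam_degree rs.
have rn : (S r <= n)%N by apply: (offset_n lam_degree).
rewrite -mulr_algr; apply: (value_unique q0 q_root lam_degree
  (value_mul vr (value_cst _ _ _))).
apply: value_ext (value_mul vr (value_cst _ _ _)) => x Dx; have [_ gx] := Dx.
rewrite -domain_regular // mulr_algr -!scalerAl scalerA mulrC -scalerA.
congr (_ *: _); apply/esym.
apply: (staircase_div (hecke_relT q n) (@T_out _ q n) one_sub_q one_add_q) => //.
- by move=> k; apply: generic_neq0.
- by move=> k l; apply: generic_inj.
- by apply: (domain_row q0 lam_degree) => //; lia.
Qed.

End ElambdaValue.

(** * Parallel rows *)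

Section ParallelScalars.
Variables (F : fieldType) (q : F).
Hypotheses (q0 : q != 0) (q_root : forall m, (0 < m)%N -> q ^+ m != 1).
Local Notation br := (bracket q).

Lemma sub_expq m : (0 < m)%N -> 1 - q ^+ m != 0.
Proof. by move=> m0; rewrite subr_eq0 eq_sym q_root. Qed.

(** The scalars to which the factors of the pairs (s, t) in E_m, and E_m itself,
    reduce if every T_d is replaced by q; the second is the quantum factorial
    of m. *)
Definition trivial_row m s := \prod_(s.+1 <= t < m.+1) (q + br (q ^+ (t - s))).

Definition trivial_symmetrizer m := \prod_(1 <= s < m.+1) trivial_row m s.

(** The scalar to which the factors of the pairs (s, t) with [t <= s] reduce in the
    block of two parallel rows; the last factor - q comes from the three-term
    factor at [t = s]. *)
Definition parallel_row s : F :=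
  if s == 1%N then 1 - q
  else (\prod_(1 <= t < s.-1) (q + br (q ^- (s - t)))) * - q.

Lemma trivial_rowE m s : (s <= m)%N ->
  trivial_row m s = (1 - q ^+ (m - s).+1) / (1 - q).
Proof.
have q1 := sub_expq (isT : 0 < 1)%N; rewrite expr1 in q1.
elim: m => [|m IH] sm.
  by rewrite /trivial_row big_geq ?divff // ?ltnS //; case: s sm.
have [->|sm'] := eqVneq s m.+1.
  by rewrite /trivial_row big_geq // subnn expr1 divff.
rewrite /trivial_row big_nat_recr /=; last by lia.
rewrite -/(trivial_row m s) IH; last by lia.
have -> : (m.+1 - s = (m - s).+1)%N by lia.
have := sub_expq (ltn0Sn (m - s)); rewrite /bracket (exprS q (m - s).+1).
by move: (q ^+ _) => y y1; field; rewrite q1 y1.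
Qed.

Lemma trivial_symmetrizerS m : trivial_symmetrizer m.+1 =
  (1 - q ^+ m.+1) / (1 - q) * trivial_symmetrizer m.
Proof.
rewrite /trivial_symmetrizer big_ltn // trivial_rowE // subn1 /=; congr (_ * _).
rewrite big_add1 /=; apply: eq_big_nat => s sm.
by rewrite !trivial_rowE //; lia.
Qed.

Lemma parallel_rowE s : (1 < s)%N ->
  parallel_row s = - q ^+ s.-1 * (1 - q) / (1 - q ^+ s.-1).
Proof.
case: s => // -[//|s] _; rewrite /parallel_row /= big_nat_rev /=.
have q1 := sub_expq (isT : 0 < 1)%N; rewrite expr1 in q1.
have -> : \prod_(1 <= t < s.+1) (q + br (q ^- (s.+2 - (1 + s.+1 - t.+1)))) =
    q ^+ s * (1 - q) / (1 - q ^+ s.+1).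
  rewrite (eq_big_nat _ _ (F2 := fun t => q + br (q ^- t.+1))) => [|t ts]; last first.
    by rewrite (_ : (s.+2 - (1 + s.+1 - t.+1) = t.+1)%N) //; lia.
  elim: s => [|s IH]; first by rewrite big_geq // expr0 mul1r expr1 divff.
  rewrite big_nat_recr //= IH /bracket.
  have := sub_expq (ltn0Sn s); have := sub_expq (ltn0Sn s.+1).
  have := expf_neq0 s q0; rewrite !(exprS q).
  move: (q ^+ s) => y y0 y2 y1; field.
  rewrite y1 y2 q0 y0 !andbT /=.
  by rewrite -(opprB 1) oppr_eq0.
by rewrite exprS; ring.
Qed.

(** The rows s > 1 contribute - q^(s-1) (1 - q) / (1 - q^(s-1)), whose denominators
    cancel with those factors of the quantum factorial. *)
Lemma f_scalE m : (0 < m)%N ->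
  (\prod_(1 <= s < m.+1) parallel_row s) * trivial_symmetrizer m = f_scal q m.
Proof.
have q1 := sub_expq (isT : 0 < 1)%N; rewrite expr1 in q1.
elim: m => // m IH _; case: m IH => [_|m /(_ isT) IH].
  rewrite big_nat1 /trivial_symmetrizer big_nat1 /trivial_row big_geq //.
  by rewrite /parallel_row /f_scal /= !expr1 expr0; ring.
rewrite big_nat_recr //= trivial_symmetrizerS [_ * trivial_symmetrizer _]mulrC.
rewrite mulrACA IH parallel_rowE // /f_scal.
have -> : ((m.+2 * m.+2.-1)./2 = (m.+1 * m.+1.-1)./2 + m.+1)%N.
  rewrite -[m.+2.-1]/m.+1 -[m.+1.-1]/m.
  have -> : (m.+2 * m.+1 = m.+1 * m + m.+1.*2)%N by lia.
  by rewrite halfD odd_double andbF doubleK.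
rewrite -[m.+2.-1]/m.+1 -[m.+1.-1]/m.
rewrite exprD [(-1) ^+ m.+2]exprS [q ^+ m.+2]exprS.
have := sub_expq (ltn0Sn m).
move: (q ^+ m.+1) (q ^+ _) ((-1) ^+ _) => y z e y1; field.
by rewrite q1 y1.
Qed.

End ParallelScalars.

Section ParallelBlocks.
Variables (F : fieldType) (q : F) (n : nat) (A : algType F) (T : nat -> A).
Hypotheses (T_rel : hecke_rel q n T).
Hypothesis (T_out : forall k, ~~ (0 < k < n)%N -> T k = 0).
Local Notation br := (bracket q).

Definition symmetrizer_row D m s : A :=
  \prod_(s.+1 <= t < m.+1) (T (D + (t - s)) + (br (q ^+ (t - s)))%:A).

(** This is E_m^(D). *)
Definition symmetrizer D m : A := \prod_(1 <= s < m.+1) symmetrizer_row D m s.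

(** The value of the factor of the entries at positions [s] and [t] of two
    parallel rows, with [D] the difference of the entries for [s = t].  The pairs
    with [s = t] are the singular ones, and for [t.+1 = s] the factor is merged
    into the next one. *)
Definition parallel_factor D s t : A :=
  if t == s then
    if s == 1%N then (1 - q)%:A else T D.-1 * T D - q *: T D - q%:A
  else if t.+1 == s then 1
  else if (t < s)%N then T (D - (s - t)) + (br (q ^- (s - t)))%:A
  else T (D + (t - s)) + (br (q ^+ (t - s)))%:A.

Lemma scalar_prodr (L : A) (f : nat -> A) (c : nat -> F) a b :
    (forall i, (a <= i < b)%N -> L * f i = c i *: L) ->
  L * \prod_(a <= i < b) f i = (\prod_(a <= i < b) c i) *: L.
Proof.
move=> fc; have [ba|/ltnW ab] := leqP b a.
  by rewrite !big_geq // mulr1 scale1r.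
rewrite -(subnKC ab) in fc *; elim: (b - a)%N fc => [|m IH] fc.
  by rewrite addn0 !big_geq // mulr1 scale1r.
rewrite addnS !big_nat_recr ?leq_addr //= mulrA IH => [|i im]; last by apply: fc; lia.
by rewrite -scalerAl fc ?scalerA //; lia.
Qed.

Lemma symmetrizer_absorb (L : A) D m :
    (forall d, (D < d < D + m)%N -> L * T d = q *: L) ->
  L * symmetrizer D m = trivial_symmetrizer q m *: L.
Proof.
move=> LT; apply: scalar_prodr => s sm; apply: scalar_prodr => t st.
by rewrite mulrDr mulr_algr LT ?scalerDl //; lia.
Qed.

(** On L the generators of index below D act by q, which makes the factors up to
    the singular pair scalar.  The remaining factors are those of the pairs
    (s, t) of E_m^(D). *)
Lemma parallel_row_value (L : A) D m s : (m <= D)%N -> (0 < s <= m)%N ->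
    (forall d, (D < d + m)%N && (d < D)%N -> L * T d = q *: L) ->
  L * \prod_(1 <= t < m.+1) parallel_factor D s t =
  parallel_row q s *: (L * symmetrizer_row D m s).
Proof.
move=> mD sm LT.
have tail : \prod_(s.+1 <= t < m.+1) parallel_factor D s t = symmetrizer_row D m s.
  by apply: eq_big_nat => t st; rewrite /parallel_factor !ifN_eq ?ifF //; lia.
rewrite (@big_nat_cut _ _ _ s); last by lia.
rewrite tail [X in _ * X * _]/parallel_factor eqxx /parallel_row.
have [->|s1] := eqVneq s 1%N.
  by rewrite big_geq // mul1r mulr_algl -scalerAr.
have -> : \prod_(1 <= t < s) parallel_factor D s t =
    \prod_(1 <= t < s.-1) (T (D - (s - t)) + (br (q ^- (s - t)))%:A).
  case: s s1 sm {tail} => // s s1 sm; rewrite big_nat_recr /=; last by lia.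
  rewrite [X in _ * X](_ : _ = 1) ?mulr1; last first.
    by rewrite /parallel_factor eqxx ifN_eq //; lia.
  apply: eq_big_nat => t st; rewrite /parallel_factor.
  by do 2 (case: eqP => [|_]; first by lia); rewrite ifT //; lia.
have LP : L * \prod_(1 <= t < s.-1) (T (D - (s - t)) + (br (q ^- (s - t)))%:A) =
    (\prod_(1 <= t < s.-1) (q + br (q ^- (s - t)))) *: L.
  apply: scalar_prodr => t st.
  by rewrite mulrDr mulr_algr LT ?scalerDl //; lia.
rewrite !mulrA LP -!scalerAl -[in RHS]scalerA; congr (_ *: _).
rewrite scalerAl; congr (_ * _).
rewrite !mulrBr mulrA LT; last by lia.
by rewrite -scalerAl -scalerAr subrr sub0r mulr_algr scaleNr.
Qed.

(** The factors of E_m^(D) left by the preceding rows have generators of index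
    above D, so they do not affect the action of those below D. *)
Lemma parallel_block_value (L : A) D m : (m <= D)%N ->
    (forall d, (D < d + m)%N && (d < D)%N -> L * T d = q *: L) ->
  L * \prod_(1 <= s < m.+1) \prod_(1 <= t < m.+1) parallel_factor D s t =
  (\prod_(1 <= s < m.+1) parallel_row q s) *: (L * symmetrizer D m).
Proof.
move=> mD LT; rewrite /symmetrizer.
suff H M : (M <= m)%N ->
    L * \prod_(1 <= s < M.+1) \prod_(1 <= t < m.+1) parallel_factor D s t =
    (\prod_(1 <= s < M.+1) parallel_row q s) *:
       (L * \prod_(1 <= s < M.+1) symmetrizer_row D m s) by exact: H.
elim: M => [|M IH] Mm; first by rewrite !big_geq // scale1r.
rewrite [in LHS]big_nat_recr //= mulrA IH; last by lia.
rewrite -scalerAl parallel_row_value //.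
- by rewrite !(@big_nat_recr _ _ _ M.+1) //= scalerA mulrA.
move=> d dD; rewrite -mulrA (_ : _ * T d = T d *
    \prod_(1 <= s < M.+1) symmetrizer_row D m s).
  by rewrite mulrA LT // -scalerAl.
apply/esym/commr_prod_nat => s sM; apply: commr_prod_nat => t st.
by apply: comm_addalg; apply: (T_comm T_rel T_out); lia.
Qed.

Lemma symmetrizer_comm D m d : (d < D)%N -> GRing.comm (T d) (symmetrizer D m).
Proof.
move=> dD; apply: commr_prod_nat => s sm; apply: commr_prod_nat => t st.
by apply: comm_addalg; apply: (T_comm T_rel T_out); lia.
Qed.

End ParallelBlocks.

(** * The special order *)

Section SpecialOrder.
Variable lam : diagram.
Local Notation S := (offset lam).
Local Notation row := (row_of lam).

Lemma le1_trans : transitive le1.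
Proof. by move=> [a b] [c d] [e f]; rewrite /le1 /=; lia. Qed.

Lemma le2_trans : transitive le2.
Proof. by move=> [a b] [c d] [e f]; rewrite /le2 /=; lia. Qed.

Lemma le1_anti : antisymmetric le1.
Proof. by move=> [a b] [c d]; rewrite /le1 /= => H; congr (_, _); lia. Qed.

Lemma le2_anti : antisymmetric le2.
Proof. by move=> [a b] [c d]; rewrite /le2 /= => H; congr (_, _); lia. Qed.

Lemma special_le_total : total (special_le lam).
Proof.
move=> [a b] [c d]; rewrite /special_le /=.
case: ifP => [/andP[/eqP-> /eqP->]|ne].
  by rewrite !eqxx /=; case: ifP => _; rewrite /le1 /le2 /=; lia.
by rewrite ifF; lia.
Qed.

Lemma special_le_trans : transitive (special_le lam).
Proof.
move=> [y1 y2] [x1 x2] [z1 z2]; rewrite /special_le /=.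
case: ifP => [/andP[/eqP <- /eqP <-]|xy].
  case: ifP => _; case: ifP => _ //; [exact: le1_trans | exact: le2_trans].
case: ifP => [/andP[/eqP <- /eqP <-]|yz]; first by rewrite xy.
by case: ifP => xz; lia.
Qed.

Lemma mem_pairs n xi : (xi \in pairs n) = [&& 0 < xi.1, xi.1 < xi.2 & xi.2 <= n]%N.
Proof.
case: xi => i j; rewrite mem_filter /=; apply/andP/and3P => [[ij]|[i0 ij jn]].
  by case/allpairsP => -[a b] /= [+ + [iE jE]]; rewrite !mem_iota iE jE; split; lia.
by split=> //; apply/allpairsP; exists (i, j); rewrite !mem_iota /=; split=> //; lia.
Qed.

Lemma pairs_uniq n : uniq (pairs n).
Proof.
apply: filter_uniq; apply: allpairs_uniq; rewrite ?iota_uniq //.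
by move=> [a b] [c d] _ _ [-> ->].
Qed.

Lemma sorted_allpairs (r : rel (nat * nat)) (h : nat -> nat -> nat * nat) s t :
    transitive r ->
    (forall i i' j j', (i < i')%N -> r (h i j) (h i' j')) ->
    (forall i j j', (j < j')%N -> r (h i j) (h i j')) ->
    sorted ltn s -> sorted ltn t ->
  sorted r [seq h i j | i <- s, j <- t].
Proof.
move=> r_tr r1 r2; rewrite !(sorted_pairwise ltn_trans) sorted_pairwise // => + tt.
elim: s => //= i s IH /andP[is_ ss]; rewrite pairwise_cat IH // andbT.
apply/andP; split; last first.
  by rewrite pairwise_map; apply: sub_pairwise tt => j j' /=; exact: r2.
apply/allrelP => _ _ /mapP[j _ ->] /allpairsP[[i' j'] /= [i's _ ->]].
by apply: r1; exact: (allP is_).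
Qed.

Definition row_entries k := index_iota (S k.-1).+1 (S k).+1.

(** Both lists are sorted for the total order to which the special order restricts on
    P_kl, and they have the same members. *)
Lemma special_block n k l : degree lam = n ->
    (0 < k <= size lam)%N -> (0 < l <= size lam)%N ->
  [seq xi <- special_seq n lam | in_block lam k l xi] =
  [seq xi <- if same_end lam k l
             then [seq (i, j) | i <- row_entries k, j <- row_entries l]
             else [seq (i, j) | j <- row_entries l, i <- row_entries k]
  | (xi.1 < xi.2)%N].
Proof.
move=> lam_degree ks ls; set B := if _ then _ else _.
pose r := if same_end lam k l then le1 else le2.
have r_tr : transitive r by rewrite /r; case: ifP => _; [exact: le1_trans | exact: le2_trans].
have r_anti : antisymmetric r by rewrite /r; case: ifP => _; [exact: le1_anti | exact: le2_anti].
apply: (sorted_eq r_tr r_anti).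
- rewrite sorted_pairwise //.
  have : pairwise (special_le lam) [seq xi <- special_seq n lam | in_block lam k l xi].
    rewrite -sorted_pairwise; last exact: special_le_trans.
    apply: sorted_filter; first exact: special_le_trans.
    by apply: sort_sorted; exact: special_le_total.
  have : all (in_block lam k l) [seq xi <- special_seq n lam | in_block lam k l xi].
    exact: filter_all.
  elim: [seq _ <- _ | _] => //= x s IH /andP[xb sb] /andP[xs ss].
  rewrite IH // andbT; apply/allP => y ys.
  have := allP xs _ ys; have := allP sb _ ys; move: xb.
  rewrite /in_block /special_le => /andP[/eqP-> /eqP->] /andP[/eqP-> /eqP->].
  by rewrite !eqxx /= /r; case: ifP.
- apply: sorted_filter => //; rewrite /B /r; case: ifP => _.
    apply: sorted_allpairs; rewrite ?iota_ltn_sorted //; first exact: le1_trans.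
      by move=> *; rewrite /le1 /=; lia.
    by move=> *; rewrite /le1 /=; lia.
  apply: (sorted_allpairs (h := fun j i => (i, j))); rewrite ?iota_ltn_sorted //.
  - exact: le2_trans.
  - by move=> *; rewrite /le2 /=; lia.
  - by move=> *; rewrite /le2 /=; lia.
apply: uniq_perm.
- by rewrite filter_uniq // sort_uniq pairs_uniq.
- apply: filter_uniq; rewrite /B; case: ifP => _.
    by apply: allpairs_uniq; rewrite ?iota_uniq // => -[? ?] [? ?] _ _ [-> ->].
  by apply: allpairs_uniq; rewrite ?iota_uniq // => -[? ?] [? ?] _ _ [-> ->].
move=> [i j]; rewrite !mem_filter mem_sort mem_pairs /in_block /=.
have -> : ((i, j) \in B) = (in_row lam k i) && (in_row lam l j).
  rewrite /B; case: ifP => _; apply/allpairsP/andP.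
  - by move=> [[a b] /= [+ + [-> ->]]]; rewrite !mem_index_iota.
  - by move=> [ik jl]; exists (i, j); rewrite !mem_index_iota.
  - by move=> [[a b] /= [+ + [-> ->]]]; rewrite !mem_index_iota.
  - by move=> [ik jl]; exists (j, i); rewrite !mem_index_iota.
have [ij|] := ltnP i j; last by rewrite andbF andbF.
have [i0|i0] := boolP (0 < i <= degree lam)%N; last first.
  rewrite [in RHS](_ : in_row lam k i = false); last first.
    by apply: contraNF i0; exact: in_row_le.
  by apply/negbTE; rewrite !negb_and; move: i0; rewrite lam_degree; lia.
have [j0|j0] := boolP (0 < j <= degree lam)%N; last first.
  rewrite [in RHS](_ : in_row lam l j = false); last first.
    by apply: contraNF j0; exact: in_row_le.
  by rewrite andbF; apply/negbTE; rewrite !negb_and; move: j0; rewrite lam_degree; lia.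
rewrite !row_of_eq // -lam_degree.
by move: i0 j0 => /andP[-> _] /andP[_ ->]; rewrite !andbT.
Qed.

End SpecialOrder.

Section BlockFactors.
Variables (F : fieldType) (q : F) (n : nat) (lam : diagram).
Hypothesis lam_cher : cherednik lam.
Hypothesis lam_degree : degree lam = n.
Let lam_diag : is_diagram lam := proj1 lam_cher.
Local Notation S := (offset lam).
Local Notation row := (row_of lam).
Local Notation ct := (content lam).
Local Notation V := (factor_value q (T q n) lam).

(** A pair of P_kl is absorbed by a singular pair of the same block: by its right
    neighbour in row l if e = -, which exists since the rows have the same end,
    or by its left neighbour in row k if e = +. *)
Lemma absorbedE i j k l : (0 < k)%N -> (k <= l <= size lam)%N ->
    in_row lam k i -> in_row lam l j -> (i < j)%N ->
    (k == l) || ~~ parallel lam k l ->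
  absorbed n lam (i, j) =
  [&& k != l, ct i == ct j + 1 & same_end lam k l || ~~ leftmost lam i].
Proof.
move=> k0 kl ik jl ij par.
have ks : (0 < k <= size lam)%N by lia.
have ls : (0 < l <= size lam)%N by lia.
have ri := row_ofE ks ik; have rj := row_ofE ls jl.
have ci := contentE ks ik; have cj := contentE ls jl; have li := leftmostE ks ik.
have [i1 i2] := andP ik; have [j1 j2] := andP jl.
have Lk := row_lenE lam_diag ks; have Ll := row_lenE lam_diag ls.
have Sk := offset_pred lam (proj1 (andP ks)); have Sl := offset_pred lam (proj1 (andP ls)).
have ln : (S l <= n)%N by apply: (offset_n lam_degree); lia.
apply/hasP/and3P.
  case=> -[a b]; rewrite mem_pairs /= => /and3P[a0 ab bn].
  rewrite /remaining_singular /singular /= => /andP[/andP[/eqP cab nab]].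
  rewrite /xi_e /e_minus /=; case: ifP => ae.
    rewrite /xi_minus /=; case: ifP => // /eqP rb /eqP[aE bE].
    subst a; have bE' : b = j.+1 by lia.
    subst b; rewrite /= in rb; rewrite -rb ri rj in nab ae.
    have cb : ct j.+1 = ct j + 1 by apply: content_next => //; lia.
    split; [|by rewrite cab cb|by rewrite ae].
    by apply: contraNneq nab => ->; rewrite parallelE !eqxx.
  rewrite /xi_plus /=; case: ifP => // /eqP ra /eqP[aE bE].
  subst i b; rewrite ra ri rj in nab ae.
  have ca : ct a.+1 = ct a + 1 by apply: content_next => //; lia.
  have ak : in_row lam k a by rewrite -row_of_eq ?lam_degree ?ra ?ri //; lia.
  split; [|by rewrite -cab ca|by rewrite ae li /=; move: ak => /andP[]; lia].
  by apply: contraNneq nab => ->; rewrite parallelE !eqxx.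
move=> [kl' /eqP cij end_or]; rewrite (negPf kl') /= in par.
have [se|nse] := boolP (same_end lam k l).
  have jl' : in_row lam l j.+1 by move: se => /eqP; rewrite -/(beta lam k) -/(beta lam l) /in_row; lia.
  exists (i, j.+1); first by rewrite mem_pairs /=; move: jl' => /andP[]; lia.
  rewrite /remaining_singular /singular /= ri (row_ofE ls jl') par andbT.
  rewrite (contentE ls jl') /xi_e /e_minus /= ri (row_ofE ls jl') se /xi_minus /=.
  by rewrite rj (row_ofE ls jl') !eqxx andbT; apply/eqP; lia.
rewrite (negPf nse) /= li in end_or.
case: i => [|a] in ik jl ij ri ci li i1 i2 cij end_or *; first by lia.
have ak : in_row lam k a by rewrite /in_row; lia.
exists (a, j); first by rewrite mem_pairs /=; lia.
rewrite /remaining_singular /singular /= (row_ofE ks ak) rj par andbT.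
rewrite (contentE ks ak) /xi_e /e_minus /= (row_ofE ks ak) rj (negPf nse) /xi_plus /=.
by rewrite ri (row_ofE ks ak) !eqxx andbT; apply/eqP; lia.
Qed.

(** A leftmost [j] with the content of [i] occurs only if the rows are parallel:
    of two other rows with the same end, row l begins further to the left. *)
Lemma pair_factor_value i j k l : (0 < k)%N -> (k <= l <= size lam)%N ->
    in_row lam k i -> in_row lam l j -> (i < j)%N ->
    (k == l) || ~~ parallel lam k l ->
  pair_factor q n lam (i, j) = V i j.
Proof.
move=> k0 kl ik jl ij par; rewrite /pair_factor (absorbedE k0 kl ik jl ij par).
have ks : (0 < k <= size lam)%N by lia.
have ls : (0 < l <= size lam)%N by lia.
have ri := row_ofE ks ik; have rj := row_ofE ls jl.
have ci := contentE ks ik; have cj := contentE ls jl; have lj := leftmostE ls jl.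
have [i1 i2] := andP ik; have [j1 j2] := andP jl.
rewrite /remaining_singular /singular /three_term /e_minus /= ri rj.
rewrite /factor_value ri rj /evaluated_factor /content_factor ij /=.
have [klE|kl'] := eqVneq k l; first by rewrite klE parallelE !eqxx /= andbF.
rewrite (negPf kl') /= in par; rewrite par andbT.
have kle := rows_order lam_cher k0 kl.
have [se|nse] := boolP (same_end lam k l); rewrite /= ?andbT.
  have [cij|//] := eqVneq (ct i) (ct j); rewrite ifN //.
  move: par; rewrite parallelE -same_endE se andbT => al.
  rewrite lj; apply: contraNneq al => jE; apply/eqP.
  by move: se => /eqP; rewrite -/(beta lam k) -/(beta lam l); lia.
by have [cij|//] := eqVneq (ct i) (ct j).
Qed.

Lemma block_value k l : (0 < k)%N -> (k <= l <= size lam)%N ->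
    (k == l) || ~~ parallel lam k l ->
  \prod_(xi <- special_seq n lam | in_block lam k l xi) pair_factor q n lam xi =
  block lam V k l.
Proof.
move=> k0 kl par.
have ks : (0 < k <= size lam)%N by lia.
have ls : (0 < l <= size lam)%N by lia.
have VE i j : in_row lam k i -> in_row lam l j ->
    (if (i < j)%N then pair_factor q n lam (i, j) else 1) = V i j.
  move=> ik jl; case: ltnP => ij; first exact: pair_factor_value par.
  rewrite /factor_value (row_ofE ks ik) (row_ofE ls jl) /content_factor ltnNge ij /=.
  have [//|kl'] := eqVneq k l.
  have : (S k <= S l.-1)%N by apply: leq_offset; lia.
  by move: ik jl => /andP[] ? ? /andP[]; lia.
rewrite -big_filter special_block // big_filter big_mkcond /block /row_entries.
by have [se|nse] := boolP (same_end lam k l); rewrite big_allpairs_dep;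
  apply: eq_big_nat => i ii; apply: eq_big_nat => j jj; exact: VE.
Qed.

End BlockFactors.

(** * E_m and the blocks of parallel rows *)

Lemma shift_prod (B : pzRingType) (f : nat -> B) a m :
  \prod_(a.+1 <= i < (a + m).+1) f i = \prod_(1 <= s < m.+1) f (a + s)%N.
Proof.
rewrite -add1n big_addn (_ : ((a + m).+1 - a = m.+1)%N); last by lia.
by apply: eq_bigr => s _; rewrite addnC.
Qed.

Section OneRow.
Variables (F : fieldType) (q : F) (n : nat).
Hypotheses (q0 : q != 0) (q_root : forall m, (0 < m)%N -> q ^+ m != 1).

Definition one_row (m : nat) : diagram := [:: (0, m%:Z - 1)].

Lemma one_row_offset m : (0 < m)%N -> offset (one_row m) 1 = m.
Proof. by move=> m0; rewrite offsetS offset0 /row_len /row_a /row_b /=; lia. Qed.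

Lemma one_row_cherednik m : (0 < m)%N -> cherednik (one_row m).
Proof.
move=> m0; split=> i /=; last by lia.
move=> i1; have -> : i = 1%N by lia.
by rewrite /row_a /row_b /=; lia.
Qed.

Lemma ratioX (a b : int) m : a - b = m%:Z -> q ^ a / q ^ b = q ^+ m.
Proof. by move=> abm; rewrite invr_expz -expfzDr // abm. Qed.

Lemma ratioXN (a b : int) m : b - a = m%:Z -> q ^ a / q ^ b = q ^- m.
Proof. by move=> /ratioX<-; rewrite invfM invrK mulrC. Qed.

(** One row has neither singular pairs nor parallel rows, so that E_m is the product
    of the values of the factors themselves. *)
Lemma E_lambda_one_row m : (0 < m)%N ->
  E_lambda q m (one_row m) = symmetrizer q (T q m) 0 m.
Proof.
move=> m0; have lam_cher := one_row_cherednik m0; have lS := one_row_offset m0.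
rewrite E_lambda_value // /value_upto !big_nat1 /block same_endE eqxx offset0 lS.
have rE i : (0 < i <= m)%N -> in_row (one_row m) 1 i by rewrite /in_row offset0 lS.
apply: eq_big_nat => s sm; rewrite (@big_cat_nat _ _ _ s.+1) //=; last by lia.
have FE t : (0 < t <= m)%N -> factor_value q (T q m) (one_row m) s t =
    content_factor q (T q m) (one_row m) s t.
  by move=> tm; rewrite /factor_value !(row_ofE (r := 1) (lam := one_row m)) ?rE // eqxx.
rewrite [X in X * _]big_nat [X in X * _]big1 ?mul1r; last first.
  by move=> t ts; rewrite FE ?/content_factor ?ifF //; lia.
apply: eq_big_nat => t st; rewrite FE ?/content_factor ?ifT //; try lia.
rewrite !(contentE (r := 1) (lam := one_row m)) ?rE //; try lia.
rewrite offset0 (ratioX (m := (t - s)%N)) //; lia.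
Qed.

Lemma iota_symmetrizer m h : (h + m <= n)%N ->
  iota_hecke n h (symmetrizer q (T q m) 0 m) = symmetrizer q (T q n) h m.
Proof.
move=> hm; have [iD iM i1 iZ iT] := hecke_lift_morph (iota_hecke_rel q hm).
rewrite /iota_hecke /symmetrizer (big_morph _ iM i1); apply: eq_big_nat => s sm.
rewrite /symmetrizer_row (big_morph _ iM i1); apply: eq_big_nat => t st.
rewrite iD iZ i1 iT; last by lia.
by rewrite add0n addnC.
Qed.

Lemma E_row_symmetrizer m h : (0 < m)%N -> (h + m <= n)%N ->
  E_row q n m h = symmetrizer q (T q n) h m.
Proof.
by move=> m0 hm; rewrite /E_row -/(one_row m) E_lambda_one_row // iota_symmetrizer.
Qed.

End OneRow.

Section Commuting.
Variables (F : fieldType) (q : F) (n : nat) (lam : diagram).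
Hypothesis lam_cher : cherednik lam.
Let lam_diag : is_diagram lam := proj1 lam_cher.
Local Notation S := (offset lam).
Local Notation T := (T q n).
Local Notation V := (factor_value q T lam).

(** The factors of the pairs [(i, j)] of P_kl have generators of index at least
    [j - i - 1]; the index [j - i - 1] occurs only in three-term factors, and
    there either [j] is not leftmost or [i] is not rightmost in its row. *)
Lemma value_comm d b0 k l i j : (0 < k)%N -> (k < l <= size lam)%N ->
    ~~ parallel lam k l -> in_row lam k i -> in_row lam l j ->
    (S k <= b0)%N -> (d + b0 < S l.-1)%N ->
  GRing.comm (T d) (V i j).
Proof.
move=> k0 kl par ik jl kb db.
have ks : (0 < k <= size lam)%N by lia.
have ls : (0 < l <= size lam)%N by lia.
have kl' : (k <= l <= size lam)%N by lia.
have ri := row_ofE ks ik; have rj := row_ofE ls jl.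
have ci := contentE ks ik; have cj := contentE ls jl; have lj := leftmostE ls jl.
have [i1 i2] := andP ik; have [j1 j2] := andP jl.
have Lk := row_lenE lam_diag ks; have Ll := row_lenE lam_diag ls.
have Sk := offset_pred lam (proj1 (andP ks)); have Sl := offset_pred lam (proj1 (andP ls)).
have kle := rows_order lam_cher k0 kl'.
have Tc e : (d.+1 < e)%N -> GRing.comm (T d) (T e).
  by move=> de; apply: (T_comm (hecke_relT q n) (@T_out _ q n)); rewrite de.
have cc : GRing.comm (T d) (content_factor q T lam i j).
  rewrite /content_factor; case: ifP => ij; last exact: commr1.
  by apply: comm_addalg; apply: Tc; lia.
have tt e : (d.+2 < j - i)%N -> GRing.comm (T d) (three_terms q T e i j).
  move=> de; rewrite /three_terms.
  have c1 : GRing.comm (T d) (T (j - i - 1)) by apply: Tc; lia.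
  have c2 : GRing.comm (T d) (T (j - i - 1).+1) by apply: Tc; lia.
  apply: commrB; last exact: comm_alg.
  apply: commrB; last exact: comm_scale.
  by case: e; apply: commrM.
rewrite /factor_value ri rj ifF; last by lia.
have [se|nse] := boolP (same_end lam k l).
  case: eqP => cij; last by case: ifP => _ //; exact: commr1.
  rewrite lj; case: eqP => jE; first exact: comm_alg.
  by apply: tt; lia.
case: eqP => cij; last by case: ifP => _ //; exact: commr1.
apply: tt; have be : beta lam l < beta lam k.
  by case: kle => // -[be _]; move: nse; rewrite same_endE be eqxx.
by lia.
Qed.

Lemma blocks_comm d p l : (0 < p <= l)%N -> (l <= size lam)%N ->
    (forall k, (0 < k < p)%N -> ~~ parallel lam k l) ->
    (d + S p.-1 < S l.-1)%N ->
  GRing.comm (T d) (\prod_(1 <= k < p) block lam V k l).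
Proof.
move=> pl ls npar dp; apply: commr_prod_nat => k kp.
have H i j : in_row lam k i -> in_row lam l j -> GRing.comm (T d) (V i j).
  move=> ik jl; apply: (value_comm (b0 := S p.-1)) ik jl _ _ => //; try lia.
    by apply: npar; lia.
  by apply: leq_offset; lia.
by rewrite /block; case: ifP => _; apply: commr_prod_nat => i ii;
  apply: commr_prod_nat => j jj; apply: H.
Qed.

End Commuting.

Section ParallelRows.
Variables (F : fieldType) (q : F) (n : nat) (lam : diagram).
Hypothesis q0 : q != 0.
Hypothesis lam_diag : is_diagram lam.
Local Notation S := (offset lam).
Local Notation row := (row_of lam).
Local Notation ct := (content lam).
Local Notation T := (T q n).
Local Notation V := (factor_value q T lam).
Local Notation E := (value_upto q T lam).

Lemma parallel_block k l : (0 < k)%N -> (k < l <= size lam)%N -> parallel lam k l ->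
  block lam V k l = \prod_(1 <= s < (row_len lam l).+1)
     \prod_(1 <= t < (row_len lam l).+1)
        parallel_factor q T (S l.-1 - S k.-1) s t.
Proof.
move=> k0 kl par; have [al be] := andP par.
have ks : (0 < k <= size lam)%N by lia.
have ls : (0 < l <= size lam)%N by lia.
have km := parallel_len lam_diag ks ls par.
have Sk := offset_pred lam (proj1 (andP ks)); have Sl := offset_pred lam (proj1 (andP ls)).
have kS : (S k <= S l.-1)%N by apply: leq_offset; lia.
have m0 := row_len_gt0 lam_diag ls.
rewrite /block ifT // Sk km shift_prod; apply: eq_big_nat => s sm.
rewrite Sl shift_prod; apply: eq_big_nat => t tm.
have ik : in_row lam k (S k.-1 + s) by rewrite /in_row; lia.
have jl : in_row lam l (S l.-1 + t) by rewrite /in_row; lia.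
rewrite /factor_value (row_ofE ks ik) (row_ofE ls jl) ifF; last by lia.
rewrite [same_end _ _ _]be (leftmostE ls jl) (contentE ks ik) (contentE ls jl).
have aE : alpha lam k = alpha lam l by exact/eqP.
have cE : (alpha lam k + (S k.-1 + s - (S k.-1).+1)%N%:Z ==
    alpha lam l + (S l.-1 + t - (S l.-1).+1)%N%:Z) = (t == s) by lia.
have cE1 : (alpha lam k + (S k.-1 + s - (S k.-1).+1)%N%:Z ==
    alpha lam l + (S l.-1 + t - (S l.-1).+1)%N%:Z + 1) = (t.+1 == s) by lia.
rewrite /parallel_factor cE cE1; case: (eqVneq t s) => [ts|ts].
  rewrite ts (_ : (S l.-1 + s == (S l.-1).+1) = (s == 1%N)); last by lia.
  case: eqP => // s1.
  rewrite /three_terms (_ : (S l.-1 + s - (S k.-1 + s) - 1 = (S l.-1 - S k.-1).-1)%N); last by lia.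
  by rewrite prednK //; lia.
case: eqP => // ts1; rewrite /content_factor ifT; last by lia.
case: ltnP => st.
  rewrite (ratioXN q0 (m := (s - t)%N)); last by rewrite (contentE ks ik) (contentE ls jl); lia.
  by rewrite (_ : S l.-1 + t - (S k.-1 + s) = S l.-1 - S k.-1 - (s - t))%N //; lia.
rewrite (ratioX q0 (m := (t - s)%N)); last by rewrite (contentE ks ik) (contentE ls jl); lia.
by rewrite (_ : S l.-1 + t - (S k.-1 + s) = S l.-1 - S k.-1 + (t - s))%N //; lia.
Qed.

Lemma last_block l : (0 < l <= size lam)%N ->
  block lam V l l = symmetrizer q T 0 (row_len lam l).
Proof.
move=> ls; have Sl := offset_pred lam (proj1 (andP ls)).
rewrite /block same_endE eqxx Sl shift_prod; apply: eq_big_nat => s sm.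
have il : in_row lam l (S l.-1 + s) by rewrite /in_row; lia.
rewrite shift_prod (@big_cat_nat _ _ _ s.+1) //=; last by lia.
have VE t : (0 < t <= row_len lam l)%N -> V (S l.-1 + s) (S l.-1 + t) =
    content_factor q T lam (S l.-1 + s) (S l.-1 + t).
  move=> tm; have jl : in_row lam l (S l.-1 + t) by rewrite /in_row; lia.
  by rewrite /factor_value (row_ofE ls il) (row_ofE ls jl) eqxx.
rewrite [X in X * _]big_nat [X in X * _]big1 ?mul1r; last first.
  by move=> t ts; rewrite VE ?/content_factor ?ifF //; lia.
apply: eq_big_nat => t st; rewrite VE ?/content_factor ?ifT //; try lia.
have jl : in_row lam l (S l.-1 + t) by rewrite /in_row; lia.
rewrite (contentE ls il) (contentE ls jl) (ratioX q0 (m := (t - s)%N)); last by lia.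
by rewrite subnDl.
Qed.

End ParallelRows.

Section ModifiedProduct.
Variables (F : fieldType) (q : F) (n : nat) (lam : diagram).
Hypotheses (q0 : q != 0) (q_root : forall m, (0 < m)%N -> q ^+ m != 1).
Hypothesis lam_cher : cherednik lam.
Hypothesis lam_degree : degree lam = n.
Let lam_diag : is_diagram lam := proj1 lam_cher.
Local Notation S := (offset lam).
Local Notation T := (T q n).
Local Notation V := (factor_value q T lam).
Local Notation E := (value_upto q T lam).

(** Only the blocks of the rows p, ..., l - 1 parallel to row l are in question.
    The generators act by q on L, the product before these blocks, if they
    belong to neighbours in these rows ([LT]).  The first block produces
    [M = L E_m^(D)] ([step]); on M the generators still act by q ([MT]), and the
    symmetrizers from the other blocks and from row l are scalars ([Mabs]). *)
Lemma column_value l : (0 < l <= size lam)%N ->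
  E l.-1 * \prod_(1 <= k < l.+1) block lam V k l =
  E l.-1 * \prod_(1 <= k < l.+1) block_factor q n lam k l.
Proof.
move=> ls; have [p [pl par]] := parallel_rows lam_cher ls.
have ln : (S l <= n)%N by apply: (offset_n lam_degree); lia.
rewrite !(@big_cat_nat _ _ _ p 1 l.+1) /=; [|lia..].
have npar k : (0 < k < p)%N -> ~~ parallel lam k l by move=> kp; rewrite par; lia.
have -> : \prod_(1 <= k < p) block_factor q n lam k l = \prod_(1 <= k < p) block lam V k l.
  apply: eq_big_nat => k kp; rewrite /block_factor ifF; last by lia.
  rewrite (negPf (npar _ kp)) andbF (block_value q lam_cher lam_degree) //; try lia.
  by rewrite npar ?orbT.
rewrite !mulrA; set L := E l.-1 * _.
rewrite !(@big_nat_recr _ _ _ l p) /=; [|lia..].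
have eb : entries_before lam l = (S l.-1 - S p.-1)%N.
  rewrite /entries_before big_mkcond (@big_cat_nat _ _ _ p 1 l) /=; [|lia..].
  rewrite [X in (X + _)%N]big_nat [X in (X + _)%N]big1 ?add0n; last first.
    by move=> k kp; rewrite (negPf (npar _ kp)).
  rewrite (eq_big_nat _ _ (F2 := row_len lam)) => [|k kp]; last by rewrite par ?ifT //; lia.
  rewrite /offset !prednK; [|lia..].
  by rewrite [in RHS](@big_cat_nat _ _ _ p 1 l) /= ?addKn //; lia.
have m0 := row_len_gt0 lam_diag ls; set m := row_len lam l in m0 *.
have len k : (p <= k <= l)%N -> row_len lam k = m.
  by move=> kl; apply: (parallel_len lam_diag) => //; rewrite ?par; lia.
have Sm k : (p <= k <= l)%N -> S k = (S k.-1 + m)%N.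
  by move=> kl; rewrite offset_pred ?len //; lia.
have Sl k : (k < l)%N -> (S k <= S l.-1)%N by move=> kl; apply: leq_offset; lia.
have LT r d : (p <= r < l)%N -> (S l.-1 < d + S r)%N -> (d + S r.-1 < S l.-1)%N ->
    L * T d = q *: L.
  move=> rl d1 d2.
  have pr : (S p.-1 <= S r.-1)%N by apply: leq_offset; lia.
  rewrite /L -mulrA -(blocks_comm q n lam_cher (p := p)) //; try lia.
  rewrite mulrA scalerAl; congr (_ * _).
  have rs : (0 < r <= size lam)%N by lia.
  have rS := Sl r; have Smr := Sm r.
  rewrite (_ : d = S l.-1 - (S l.-1 - d))%N; last by lia.
  apply: (value_upto_div q0 q_root lam_cher lam_degree); try lia.
  by rewrite !(row_ofE rs) // /in_row; lia.
have [lp|lp] := eqVneq p l.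
  rewrite lp !big_geq // !mul1r; congr (_ * _).
  rewrite /block_factor eqxx eb lp subnn /= (block_value q lam_cher lam_degree) ?eqxx //; lia.
have pl' : (p < l)%N by lia.
have D0 k : (p <= k < l)%N -> (0 < S l.-1 - S k.-1)%N.
  by move=> kl; have := Sm k; have := Sl k; lia.
have FE : block_factor q n lam l l = symmetrizer q T (S l.-1 - S p.-1) m.
  rewrite /block_factor eqxx eb D0 /=; last by lia.
  apply: E_row_symmetrizer => //.
  by have := Sm l; have := Sl p; lia.
rewrite FE last_block //; set D := (S l.-1 - S p.-1)%N.
have fE : \prod_(p <= k < l) block_factor q n lam k l = (f_scal q m ^+ (l - p))%:A.
  rewrite (eq_big_nat _ _ (F2 := fun=> (f_scal q m)%:A)) => [|k kp].
    rewrite prodr_const_nat; elim: (l - p)%N => [|e IH]; first by rewrite !expr0 scale1r.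
    by rewrite !exprS IH mulr_algl scalerA.
  rewrite /block_factor ifF; last by lia.
  rewrite par; last by lia.
  by rewrite ifT ?len //; lia.
rewrite fE; set M := L * symmetrizer q T D m.
have symC d : (d < D)%N -> symmetrizer q T D m * T d = T d * symmetrizer q T D m.
  move=> dD; apply/esym; exact: (symmetrizer_comm (hecke_relT q n) (@T_out _ q n)).
have MT r d : (p <= r < l)%N -> (S l.-1 < d + S r)%N -> (d + S r.-1 < S l.-1)%N ->
    M * T d = q *: M.
  move=> rl d1 d2; have pr : (S p.-1 <= S r.-1)%N by apply: leq_offset; lia.
  rewrite /M -mulrA symC; last by rewrite /D; lia.
  by rewrite mulrA (LT r) // -scalerAl.
have Mabs r : (p <= r < l)%N ->
    M * symmetrizer q T (S l.-1 - S r) m = trivial_symmetrizer q m *: M.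
  move=> rl; apply: symmetrizer_absorb => d dm.
  by apply: (MT r) => //; have := Sm r; have := Sl r; lia.
have blockV k (N : hecke q n) : (p <= k < l)%N ->
    (forall d, (S l.-1 < d + S k)%N -> (d + S k.-1 < S l.-1)%N -> N * T d = q *: N) ->
    N * block lam V k l = (\prod_(1 <= s < m.+1) parallel_row q s) *:
      (N * symmetrizer q T (S l.-1 - S k.-1) m).
  move=> kl NT; rewrite parallel_block //; try lia; last by rewrite par; lia.
  have Smk := Sm k; have Slk := Sl k.
  apply: (parallel_block_value (hecke_relT q n) (@T_out _ q n)); first by rewrite -/m; lia.
  by move=> d; rewrite -/m => dd; apply: NT; lia.
have step K : (p < K <= l)%N -> L * \prod_(p <= k < K) block lam V k l =
    (\prod_(1 <= s < m.+1) parallel_row q s * f_scal q m ^+ (K - p.+1)) *: M.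
  elim: K => [|K IH] Kl; first by lia.
  have [<-|pK] := eqVneq p K.
    rewrite big_nat1 subnn expr0 mulr1 blockV //; first by lia.
    by move=> d; apply: (LT p); lia.
  rewrite big_nat_recr /=; last by lia.
  rewrite mulrA IH; last by lia.
  rewrite -scalerAl blockV //; last by move=> d; apply: (MT K); lia.
  rewrite Mabs; last by lia.
  rewrite !scalerA -mulrA; congr (_ *: _).
  by rewrite f_scalE // subSn ?exprSr ?mulrA //; lia.
rewrite mulrA step; last by lia.
rewrite -scalerAl (_ : 0%N = S l.-1 - S l.-1)%N ?subnn //.
have := Mabs l.-1; rewrite subnn => ->; last by lia.
rewrite mulr_algl -scalerAr scalerA; congr (_ *: _).
rewrite mulrAC f_scalE // -exprS; congr (_ ^+ _); lia.
Qed.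

Lemma modified_product_value : modified_product q n lam = E (size lam).
Proof.
rewrite /modified_product; suff H r : (r <= size lam)%N ->
    \prod_(1 <= l < r.+1) \prod_(1 <= k < l.+1) block_factor q n lam k l = E r.
  exact: H.
elim: r => [|r IH] rs; first by rewrite /value_upto !big_geq.
rewrite big_nat_recr //= IH; last by lia.
by rewrite -(@column_value r.+1) // [in RHS]/value_upto [in RHS]big_nat_recr.
Qed.

Lemma E_lambda_modified_product : E_lambda q n lam = modified_product q n lam.
Proof. by rewrite modified_product_value E_lambda_value. Qed.

End ModifiedProduct.

(** * The statement over C(q) *)

Lemma q_Cq_neq0 (R : realType) : q_Cq R != 0.
Proof. by rewrite tofrac_eq0 polyX_eq0. Qed.

Lemma q_Cq_root (R : realType) m : (0 < m)%N -> q_Cq R ^+ m != 1.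
Proof.
move=> m0; rewrite -tofracXn -tofrac1 tofrac_eq.
apply: contraTneq m0 => /(congr1 (fun p : {poly R[i]} => size p)).
by rewrite size_polyXn size_poly1 => -[->].
Qed.

Theorem corollary5 (R : realType) (n : nat) (lam : diagram)
    (lam_cherednik : cherednik lam) (lam_degree : degree lam = n) :
  E_lambda (q_Cq R) n lam = modified_product (q_Cq R) n lam.
Proof.
exact: (E_lambda_modified_product (q_Cq_neq0 R) (@q_Cq_root R) lam_cherednik lam_degree).
Qed.
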